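(* Let $\Sigma_g$ be the fundamental group of a closed Riemann surface of genus $g$. If $p\ge 5$ is a prime and $g\ge 2$, then for every field $K$ of characteristic $p$ and transcendence degree $r\ge 2$ (over $\mathbb{F}_p$), there exists a positive integer $n$ such that $\mathrm{GL}_n(K)$ contains a subgroup isomorphic to $\Sigma_g$. *)

(* Defs.v *)
From HB Require Import structures.
From mathcomp Require Import all_boot all_order all_algebra.
From mathcomp Require Import boolp classical_sets functions cardinality.
Set Implicit Arguments.
Unset Strict Implicit.
Unset Printing Implicit Defensive.

(* The notations of mpoly and of MathComp-Analysis cannot be imported together,
   whence the module. *)
Module TranscendenceBasis.
From mathcomp Require Import mpoly.
Import GRing.Theory.
Local Open Scope classical_set_scope.
Local Open Scope ring_scope.

(* For p prime and K of characteristic p, the map c |-> (c : nat)%:R is the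
   embedding of the prime field 'F_p into K. *)
Definition alg_indep (p : nat) (K : fieldType) (B : set K) : Prop :=
  forall (n : nat) (b : 'I_n -> K),
    injective b -> (forall i, B (b i)) ->
    forall P : {mpoly 'F_p[n]},
      mmap (fun c : 'F_p => (c : nat)%:R : K) b P = 0 -> P = 0.

(* A maximal algebraically independent set; the transcendence degree of K over
   'F_p is its cardinality. *)
Definition transcendence_basis (p : nat) (K : fieldType) (B : set K) : Prop :=
  alg_indep p B /\
  forall B' : set K, B `<=` B' -> alg_indep p B' -> B' = B.

End TranscendenceBasis.
Export TranscendenceBasis.

From mathcomp Require Import generic_quotient all_classical all_reals all_analysis.
From mathcomp Require Import homotopy complex lra.
From Stdlib Require Relation_Operators.
Import Order.TTheory GRing.Theory Num.Theory numFieldNormedType.Exports.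

Local Open Scope classical_set_scope.
Local Open Scope ring_scope.

Section UnitInterval.
Context (R : realType).

Definition unitI : Type := set_type (`[0%R, 1%R]%classic : set R).

HB.instance Definition _ := Topological.on unitI.

Definition uval (t : unitI) : R := set_val t.

Fact clamp_subproof (r : R) :
  Num.max 0 (Num.min 1 r) \in (`[0, 1]%classic : set R).
Proof.
by rewrite inE /= in_itv /= le_max lexx /= ge_max ler01 /= ge_min lexx.
Qed.

Definition clamp (r : R) : unitI := SigSub (clamp_subproof r).

Lemma uval_ge0 t : 0 <= uval t.
Proof. by have := set_valP t; rewrite /= in_itv => /andP[]. Qed.

Lemma uval_le1 t : uval t <= 1.
Proof. by have := set_valP t; rewrite /= in_itv => /andP[]. Qed.

Lemma clampK r : 0 <= r <= 1 -> uval (clamp r) = r.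
Proof.
by move=> /andP[r0 r1]; rewrite /uval set_valE /= (min_r r1) (max_r r0).
Qed.

Lemma uvalK t : clamp (uval t) = t.
Proof.
by apply: val_inj; rewrite -!set_valE; apply: clampK; rewrite uval_ge0 uval_le1.
Qed.

Fact unitI_zero_one : clamp 0 != clamp 1.
Proof.
apply/eqP => /(congr1 uval); rewrite !clampK ?lexx ?ler01// => /esym/eqP.
by rewrite oner_eq0.
Qed.

HB.instance Definition _ := isBiPointed.Build unitI unitI_zero_one.

Lemma uval0 : uval zero = 0. Proof. by rewrite clampK ?lexx ?ler01. Qed.
Lemma uval1 : uval one = 1. Proof. by rewrite clampK ?lexx ?ler01. Qed.
Lemma clamp0 : clamp 0 = zero. Proof. by []. Qed.
Lemma clamp1 : clamp 1 = one. Proof. by []. Qed.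

Lemma uval_continuous : continuous uval.
Proof. exact: initial_continuous. Qed.

Lemma clamp_continuous : continuous clamp.
Proof.
apply: continuous_comp_initial => x.
rewrite (_ : _ \o _ = fun r : R => Num.max (0 : R^o) (Num.min (1 : R^o) r)) //.
apply: (@continuous_max R R (fun=> 0) (fun r => Num.min 1 r)); first exact: cvg_cst.
by apply: (@continuous_min R R (fun=> 1) id) => //; exact: cvg_cst.
Qed.

Lemma paste_continuous (Y X : topologicalType) (u : Y -> R) (c : R)
    (f g : Y -> X) :
  continuous u -> continuous f -> continuous g ->
  (forall y, u y = c -> f y = g y) ->
  continuous (fun y => if u y <= c then f y else g y).
Proof.
move=> cu cf cg fg; apply/continuous_subspace_setT.
have -> : [set: Y] = u @^-1` [set x | x <= c] `|` u @^-1` [set x | c <= x].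
  by apply/esym/seteqP; split => // y _ /=; apply/orP; exact: le_total.
apply: withinU_continuous.
- by apply: preimage_closed => //; exact: closed_le.
- by apply: preimage_closed => //; exact: closed_ge.
- apply: (@subspace_eq_continuous _ _ _ f); last exact: continuous_subspaceT.
  by move=> y; rewrite inE /= /from_subspace => ->.
- apply: (@subspace_eq_continuous _ _ _ g); last exact: continuous_subspaceT.
  move=> y; rewrite inE /= /from_subspace => cy; case: ifPn => // yc.
  by apply/esym/fg/eqP; rewrite eq_le yc cy.
Qed.

End UnitInterval.

Section FundamentalGroup.
Context (R : realType) (X : topologicalType).
Local Notation I := (unitI R).

Definition path_homotopic (x y : X) (f g : {path I from x to y in X}) : Prop :=
  exists H : I * I -> X,
    [/\ continuous H,
        (forall t, H (t, zero) = f t), (forall t, H (t, one) = g t),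
        (forall s, H (zero, s) = x) & (forall s, H (one, s) = y)].

Section Homotopy.
Context (x y : X).
Implicit Types f g h : {path I from x to y in X}.

Lemma path_homotopic_refl f : path_homotopic f f.
Proof.
exists (f \o fst); split => //= s; rewrite ?path_zero ?path_one //.
move: s => z.
by apply: continuous_comp; [exact: cvg_fst|exact: cts_fun].
Qed.

Lemma continuous_pair_with (Y Z W : topologicalType) (a : Y -> Z) (b : Y -> W) :
  continuous a -> continuous b -> continuous (fun y => (a y, b y)).
Proof. by move=> ca cb z; apply: cvg_pair; [exact: ca|exact: cb]. Qed.

Lemma continuous_clamp_comp (Y : topologicalType) (u : Y -> R) :
  continuous u -> continuous (fun y => clamp (u y)).
Proof.
by move=> cu z; apply: continuous_comp; [exact: cu|exact: clamp_continuous].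
Qed.

Lemma continuous_uval_fst : continuous (fun z : I * I => uval z.1).
Proof.
by move=> z; apply: continuous_comp; [exact: cvg_fst|exact: uval_continuous].
Qed.

Lemma continuous_uval_snd : continuous (fun z : I * I => uval z.2).
Proof.
by move=> z; apply: continuous_comp; [exact: cvg_snd|exact: uval_continuous].
Qed.

Lemma continuous_affine (Y : topologicalType) (u : Y -> R) (a b : R) :
  continuous u -> continuous (fun y => a * u y + b).
Proof.
move=> cu z; apply: (@cvgD R R^o); last exact: cvg_cst.
by apply: (@cvgM R); [exact: cvg_cst|exact: cu].
Qed.

Lemma continuous_path_clamp (Y : topologicalType) (x' y' : X)
    (f : {path I from x' to y' in X}) (u : Y -> R) :
  continuous u -> continuous (fun z => f (clamp (u z))).
Proof.
move=> cu z.
exact: (continuous_comp (@continuous_clamp_comp _ _ cu z) (@cts_fun _ _ f _)).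
Qed.

Lemma path_homotopic_sym f g : path_homotopic f g -> path_homotopic g f.
Proof.
move=> [H [cH H0 H1 Hx Hy]].
exists (fun z => H (z.1, clamp (-1 * uval z.2 + 1))); split => //=.
- move=> z; apply: continuous_comp; last exact: cH.
  apply: continuous_pair_with; first by move=> ?; exact: cvg_fst.
  apply: continuous_clamp_comp; apply: continuous_affine.
  exact: continuous_uval_snd.
- by move=> t; rewrite uval0 mulr0 add0r.
- by move=> t; rewrite uval1 mulr1 addNr clamp0.
Qed.

Lemma path_homotopic_trans f g h :
  path_homotopic f g -> path_homotopic g h -> path_homotopic f h.
Proof.
move=> [H [cH H0 H1 Hx Hy]] [G [cG G0 G1 Gx Gy]].
exists (fun z => if uval z.2 <= 2^-1 then H (z.1, clamp (2 * uval z.2 + 0))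
                 else G (z.1, clamp (2 * uval z.2 + -1))); split => /=.
- apply: paste_continuous; first exact: continuous_uval_snd.
  + move=> z; apply: continuous_comp; last exact: cH.
    apply: continuous_pair_with; first by move=> ?; exact: cvg_fst.
    apply: continuous_clamp_comp; apply: continuous_affine.
    exact: continuous_uval_snd.
  + move=> z; apply: continuous_comp; last exact: cG.
    apply: continuous_pair_with; first by move=> ?; exact: cvg_fst.
    apply: continuous_clamp_comp; apply: continuous_affine.
    exact: continuous_uval_snd.
  + move=> z ->; rewrite addr0 divff ?pnatr_eq0// subrr.
    by rewrite clamp1 clamp0 H1 G0.
- by move=> t; rewrite uval0 invr_ge0 ler0n mulr0 addr0 clamp0 H0.
- move=> t; rewrite uval1 ifF; last by apply/negbTE; rewrite -ltNge; lra.
  by rewrite (_ : 2 * 1 + -1 = 1 :> R) ?clamp1 ?G1//; lra.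
- by move=> s; rewrite Hx Gx if_same.
- by move=> s; rewrite Hy Gy if_same.
Qed.

(* Two reparametrizations of a path with the same end parameters are homotopic,
   by interpolating the parameter linearly. *)
Lemma reparam_homotopic (x' y' : X) (f : {path I from x' to y' in X})
    (p q : {path I from x to y in X}) (phi psi : R -> R) :
  continuous phi -> continuous psi -> phi 0 = psi 0 -> phi 1 = psi 1 ->
  (forall t, p t = f (clamp (phi (uval t)))) ->
  (forall t, q t = f (clamp (psi (uval t)))) ->
  path_homotopic p q.
Proof.
move=> cphi cpsi e0 e1 pE qE.
exists (fun z => f (clamp ((1 - uval z.2) * phi (uval z.1) +
                           uval z.2 * psi (uval z.1)))); split => /=.
- apply: continuous_path_clamp => z.
  have cf : {for z, continuous (fun z : I * I => phi (uval z.1))}.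
    exact: (continuous_comp (@continuous_uval_fst z) (@cphi _)).
  have cs : {for z, continuous (fun z : I * I => psi (uval z.1))}.
    exact: (continuous_comp (@continuous_uval_fst z) (@cpsi _)).
  have c2 : {for z, continuous (fun z : I * I => uval z.2)}.
    exact: continuous_uval_snd.
  apply: (@cvgD R R^o); apply: (@cvgM R) => //.
  by apply: (@cvgB R R^o) => //; exact: cvg_cst.
- by move=> t; rewrite uval0 subr0 mul1r mul0r addr0 pE.
- by move=> t; rewrite uval1 subrr mul1r mul0r add0r qE.
- move=> s; rewrite uval0 -e0 -mulrDl subrK mul1r.
  by have := pE zero; rewrite uval0 path_zero.
- move=> s; rewrite uval1 -e1 -mulrDl subrK mul1r.
  by have := pE one; rewrite uval1 path_one.
Qed.

End Homotopy.

Section PathCat.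
Context (x y z : X) (f : {path I from x to y in X})
  (g : {path I from y to z in X}).

Definition path_cat (t : I) : X :=
  if uval t <= 2^-1 then f (clamp (2 * uval t))
  else g (clamp (2 * uval t - 1)).

Fact path_cat_continuous : continuous path_cat.
Proof.
apply: paste_continuous; first exact: uval_continuous.
- apply: continuous_path_clamp; under eq_fun do rewrite -[_ * _]addr0.
  by apply: continuous_affine; exact: uval_continuous.
- apply: continuous_path_clamp; apply: continuous_affine; exact: uval_continuous.
- by move=> t ->; rewrite divff ?pnatr_eq0// subrr clamp0 clamp1 path_zero path_one.
Qed.

Fact path_cat_zero : path_cat zero = x.
Proof. by rewrite /path_cat uval0 invr_ge0 ler0n mulr0 clamp0 path_zero. Qed.

Fact path_cat_one : path_cat one = z.
Proof.
rewrite /path_cat uval1 ifF; last by apply/negbTE; rewrite -ltNge; lra.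
by rewrite (_ : 2 * 1 - 1 = 1 :> R) ?clamp1 ?path_one//; lra.
Qed.

HB.instance Definition _ := isContinuous.Build I X path_cat path_cat_continuous.
HB.instance Definition _ :=
  isPath.Build I X x z path_cat path_cat_zero path_cat_one.

End PathCat.

Section PathRev.
Context (x y : X) (f : {path I from x to y in X}).

Definition path_rev (t : I) : X := f (clamp (1 - uval t)).

Fact path_rev_continuous : continuous path_rev.
Proof.
apply: continuous_path_clamp; under eq_fun do rewrite addrC -mulN1r.
by apply: continuous_affine; exact: uval_continuous.
Qed.

Fact path_rev_zero : path_rev zero = y.
Proof. by rewrite /path_rev uval0 subr0 clamp1 path_one. Qed.

Fact path_rev_one : path_rev one = x.
Proof. by rewrite /path_rev uval1 subrr clamp0 path_zero. Qed.

HB.instance Definition _ := isContinuous.Build I X path_rev path_rev_continuous.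
HB.instance Definition _ :=
  isPath.Build I X y x path_rev path_rev_zero path_rev_one.

End PathRev.

Section PathAlgebra.
Context (x y z w : X).

Lemma path_cat_homotopic (f f' : {path I from x to y in X})
    (g g' : {path I from y to z in X}) :
  path_homotopic f f' -> path_homotopic g g' ->
  path_homotopic (path_cat f g) (path_cat f' g').
Proof.
move=> [H [cH H0 H1 Hx Hy]] [G [cG G0 G1 Gx Gy]].
exists (fun v => if uval v.1 <= 2^-1 then H (clamp (2 * uval v.1 + 0), v.2)
                 else G (clamp (2 * uval v.1 + -1), v.2)); split => /=.
- apply: paste_continuous; first exact: continuous_uval_fst.
  + move=> v; apply: continuous_comp; last exact: cH.
    apply: continuous_pair_with; last by move=> ?; exact: cvg_snd.
    apply: continuous_clamp_comp; apply: continuous_affine.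
    exact: continuous_uval_fst.
  + move=> v; apply: continuous_comp; last exact: cG.
    apply: continuous_pair_with; last by move=> ?; exact: cvg_snd.
    apply: continuous_clamp_comp; apply: continuous_affine.
    exact: continuous_uval_fst.
  + move=> v ->; rewrite addr0 divff ?pnatr_eq0// subrr.
    by rewrite clamp1 clamp0 Hy Gx.
- by move=> t; rewrite /path_cat addr0 H0 G0.
- by move=> t; rewrite /path_cat addr0 H1 G1.
- by move=> s; rewrite uval0 invr_ge0 ler0n mulr0 addr0 clamp0 Hx.
- move=> s; rewrite uval1 ifF; last by apply/negbTE; rewrite -ltNge; lra.
  by rewrite (_ : 2 * 1 + -1 = 1 :> R) ?clamp1 ?Gy//; lra.
Qed.

Lemma path_rev_homotopic (f f' : {path I from x to y in X}) :
  path_homotopic f f' -> path_homotopic (path_rev f) (path_rev f').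
Proof.
move=> [H [cH H0 H1 Hx Hy]].
exists (fun v => H (clamp (-1 * uval v.1 + 1), v.2)); split => /=.
- move=> v; apply: continuous_comp; last exact: cH.
  apply: continuous_pair_with; last by move=> ?; exact: cvg_snd.
  apply: continuous_clamp_comp; apply: continuous_affine.
  exact: continuous_uval_fst.
- by move=> t; rewrite /path_rev H0 mulN1r addrC.
- by move=> t; rewrite /path_rev H1 mulN1r addrC.
- by move=> s; rewrite uval0 mulr0 add0r clamp1.
- by move=> s; rewrite uval1 mulr1 addNr clamp0.
Qed.

Lemma continuous_minR (u v : R -> R) :
  continuous u -> continuous v -> continuous (fun r => Num.min (u r) (v r)).
Proof. by move=> cu cv r; exact: (@continuous_min R R u v r (cu r) (cv r)). Qed.

Lemma continuous_maxR (u v : R -> R) :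
  continuous u -> continuous v -> continuous (fun r => Num.max (u r) (v r)).
Proof. by move=> cu cv r; exact: (@continuous_max R R u v r (cu r) (cv r)). Qed.

Lemma continuous_affineR (a b : R) : continuous (fun r : R => a * r + b).
Proof. by apply: continuous_affine => r; exact: cvg_id. Qed.

Lemma path_catA (f : {path I from x to y in X}) (g : {path I from y to z in X})
    (h : {path I from z to w in X}) :
  path_homotopic (path_cat f (path_cat g h)) (path_cat (path_cat f g) h).
Proof.
apply: (@reparam_homotopic _ _ _ _ (path_cat f (path_cat g h)) _ _
  (fun r => 1 * r + 0)
  (fun r => Num.min (Num.min (2 * r + 0) (1 * r + 4^-1)) (2^-1 * r + 2^-1))).
- exact: continuous_affineR.
- apply: continuous_minR; last exact: continuous_affineR.
  by apply: continuous_minR; exact: continuous_affineR.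
- by rewrite /Num.min; case: ifPn; case: ifPn; lra.
- by rewrite /Num.min; case: ifPn; case: ifPn; lra.
- by move=> t; rewrite mul1r addr0 uvalK.
move=> t; have := uval_ge0 t; have := uval_le1 t.
rewrite /= /path_cat /= /path_cat; move: (uval t) => r r1 r0.
set m := Num.min _ _.
have cK (v : R) : 0 <= v -> v <= 1 -> uval (clamp v) = v.
  by move=> v0 v1; apply: clampK; rewrite v0 v1.
have [r4|r4] := leP r (4^-1).
  have -> : m = 2 * r.
    by rewrite /m /Num.min; case: ifPn; case: ifPn; rewrite -?leNgt; lra.
  rewrite (cK (2 * r)); [|lra|lra].
  have -> : r <= 2^-1 by lra.
  by have -> : 2 * r <= 2^-1 by lra.
have [r2|r2] := leP r (2^-1).
  have -> : m = r + 4^-1.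
    by rewrite /m /Num.min; case: ifPn; case: ifPn; rewrite -?leNgt; lra.
  rewrite (cK (2 * r)); [|lra|lra].
  rewrite (cK (r + 4^-1)); [|lra|lra].
  rewrite (cK (2 * (r + 4^-1) - 1)); [|lra|lra].
  have -> : (r + 4^-1 <= 2^-1) = false by apply/negbTE; rewrite -ltNge; lra.
  have -> : (2 * r <= 2^-1) = false by apply/negbTE; rewrite -ltNge; lra.
  have -> : 2 * (r + 4^-1) - 1 <= 2^-1 by lra.
  by congr (g (clamp _)); lra.
have -> : m = 2^-1 * r + 2^-1.
  by rewrite /m /Num.min; case: ifPn; case: ifPn; rewrite -?leNgt; lra.
rewrite (cK (2^-1 * r + 2^-1)); [|lra|lra].
rewrite (cK (2 * (2^-1 * r + 2^-1) - 1)); [|lra|lra].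
have -> : (2^-1 * r + 2^-1 <= 2^-1) = false.
  by apply/negbTE; rewrite -ltNge; lra.
have -> : (2 * (2^-1 * r + 2^-1) - 1 <= 2^-1) = false.
  by apply/negbTE; rewrite -ltNge; lra.
by congr (h (clamp _)); lra.
Qed.

Lemma path_cat1p (f : {path I from x to y in X}) :
  path_homotopic (path_cat (cst x : {path I from x to x in X}) f) f.
Proof.
apply: (@reparam_homotopic _ _ _ _ f _ _
  (fun r => Num.max (0 * r + 0) (2 * r + -1)) (fun r => 1 * r + 0)).
- by apply: continuous_maxR; exact: continuous_affineR.
- exact: continuous_affineR.
- by rewrite /Num.max; case: ifPn; lra.
- by rewrite /Num.max; case: ifPn; lra.
- move=> t; rewrite /= /path_cat; have [t2|t2] := leP (uval t) (2^-1).
  + set m := Num.max _ _.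
    suff -> : m = 0 by rewrite clamp0 path_zero.
    rewrite /m /Num.max; move: (uval t) t2 => r r2.
    by case: ifPn => ?; lra.
  + congr (f (clamp _)).
    by rewrite /Num.max; case: ifPn; lra.
- by move=> t; rewrite mul1r addr0 uvalK.
Qed.

Lemma path_catp1 (f : {path I from x to y in X}) :
  path_homotopic (path_cat f (cst y : {path I from y to y in X})) f.
Proof.
apply: (@reparam_homotopic _ _ _ _ f _ _
  (fun r => Num.min (0 * r + 1) (2 * r + 0)) (fun r => 1 * r + 0)).
- by apply: continuous_minR; exact: continuous_affineR.
- exact: continuous_affineR.
- by rewrite /Num.min; case: ifPn; lra.
- by rewrite /Num.min; case: ifPn; lra.
- move=> t; rewrite /= /path_cat; have [t2|t2] := leP (uval t) (2^-1).
  + congr (f (clamp _)).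
    by rewrite /Num.min; case: ifPn; lra.
  + set m := Num.min _ _.
    suff -> : m = 1 by rewrite clamp1 path_one.
    rewrite /m /Num.min; move: (uval t) t2 => r r2.
    by case: ifPn => ?; lra.
- by move=> t; rewrite mul1r addr0 uvalK.
Qed.

Lemma path_catpV (f : {path I from x to y in X}) :
  path_homotopic (path_cat f (path_rev f)) (cst x).
Proof.
apply: (@reparam_homotopic _ _ _ _ f _ _
  (fun r => Num.min (2 * r + 0) (- 2 * r + 2)) (fun r => 0 * r + 0)).
- by apply: continuous_minR; exact: continuous_affineR.
- exact: continuous_affineR.
- by rewrite /Num.min; case: ifPn; lra.
- by rewrite /Num.min; case: ifPn; lra.
- move=> t; have := uval_ge0 t; have := uval_le1 t.
  rewrite /= /path_cat /= /path_rev; move: (uval t) => r r1 r0.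
  have [r2|r2] := leP r (2^-1); congr (f (clamp _)).
    by rewrite /Num.min; case: ifPn; lra.
  rewrite clampK; last by apply/andP; split; lra.
  by rewrite /Num.min; case: ifPn; lra.
- by move=> t; rewrite mul0r addr0 clamp0 path_zero.
Qed.

Lemma path_catVp (f : {path I from x to y in X}) :
  path_homotopic (path_cat (path_rev f) f) (cst y).
Proof.
apply: (@reparam_homotopic _ _ _ _ f _ _
  (fun r => Num.max (- 2 * r + 1) (2 * r + - 1)) (fun r => 0 * r + 1)).
- by apply: continuous_maxR; exact: continuous_affineR.
- exact: continuous_affineR.
- by rewrite /Num.max; case: ifPn; lra.
- by rewrite /Num.max; case: ifPn; lra.
- move=> t; have := uval_ge0 t; have := uval_le1 t.
  rewrite /= /path_cat /= /path_rev; move: (uval t) => r r1 r0.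
  have [r2|r2] := leP r (2^-1); congr (f (clamp _)).
    rewrite clampK; last by apply/andP; split; lra.
    by rewrite /Num.max; case: ifPn; lra.
  by rewrite /Num.max; case: ifPn; lra.
- by move=> t; rewrite mul0r add0r clamp1 path_one.
Qed.

End PathAlgebra.

Section Pi1.
Local Open Scope quotient_scope.
Context (x : X).
Local Notation loop := {path I from x to x in X}.

Definition loop_homotopic (f g : loop) : bool := `[< path_homotopic f g >].

Fact loop_homotopic_is_equiv : equiv_class_of loop_homotopic.
Proof.
split.
- by move=> f; apply/asboolP; exact: path_homotopic_refl.
- by move=> f g; apply/asboolP/asboolP; exact: path_homotopic_sym.
- move=> g f h /asboolP fg /asboolP gh; apply/asboolP.
  exact: path_homotopic_trans fg gh.
Qed.

Canonical loop_equiv := EquivRelPack loop_homotopic_is_equiv.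

Definition pi1 : Type := {eq_quot loop_equiv}.

HB.instance Definition _ := Choice.on pi1.
HB.instance Definition _ := EqQuotient.on pi1.

Lemma pi1_eqP (f g : loop) :
  (\pi_pi1 f = \pi_pi1 g) <-> path_homotopic f g.
Proof.
split; first by move/eqP; rewrite piE => /asboolP.
by move=> fg; apply/eqP; rewrite piE; apply/asboolP.
Qed.

Lemma repr_pi1 (f : loop) : path_homotopic (repr (\pi_pi1 f)) f.
Proof. by apply/pi1_eqP; rewrite reprK. Qed.

Definition pi1_one : pi1 := \pi_pi1 (cst x : loop).
Definition pi1_inv (a : pi1) : pi1 := \pi_pi1 (path_rev (repr a) : loop).
Definition pi1_mul (a b : pi1) : pi1 :=
  \pi_pi1 (path_cat (repr a) (repr b) : loop).

Lemma pi1_mulE (f g : loop) :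
  pi1_mul (\pi_pi1 f) (\pi_pi1 g) = \pi_pi1 (path_cat f g : loop).
Proof. by apply/pi1_eqP; apply: path_cat_homotopic; exact: repr_pi1. Qed.

Lemma pi1_invE (f : loop) : pi1_inv (\pi_pi1 f) = \pi_pi1 (path_rev f : loop).
Proof. by apply/pi1_eqP; apply: path_rev_homotopic; exact: repr_pi1. Qed.

Fact pi1_mulA : associative pi1_mul.
Proof.
elim/quotW => f; elim/quotW => g; elim/quotW => h.
rewrite (pi1_mulE g h) (pi1_mulE f g) (pi1_mulE f) (pi1_mulE _ h).
by apply/pi1_eqP; exact: path_catA.
Qed.

Fact pi1_mul1g : left_id pi1_one pi1_mul.
Proof.
by elim/quotW => f; rewrite pi1_mulE; apply/pi1_eqP; exact: path_cat1p.
Qed.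

Fact pi1_mulg1 : right_id pi1_one pi1_mul.
Proof.
by elim/quotW => f; rewrite pi1_mulE; apply/pi1_eqP; exact: path_catp1.
Qed.

Fact pi1_mulVg : left_inverse pi1_one pi1_inv pi1_mul.
Proof.
elim/quotW => f; rewrite pi1_invE pi1_mulE.
by apply/pi1_eqP; exact: path_catVp.
Qed.

Fact pi1_mulgV : right_inverse pi1_one pi1_inv pi1_mul.
Proof.
elim/quotW => f; rewrite pi1_invE pi1_mulE.
by apply/pi1_eqP; exact: path_catpV.
Qed.

HB.instance Definition _ := isGroup.Build pi1
  pi1_mulA pi1_mul1g pi1_mulg1 pi1_mulVg pi1_mulgV.

End Pi1.

End FundamentalGroup.

Section GeneralLinearGroup.
Context (n : nat) (K : fieldType).

Definition GL : Type := {A : 'M[K]_n | A \in unitmx}.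

HB.instance Definition _ := SubType.on GL.
HB.instance Definition _ := Choice.on GL.

Definition GL_one : GL := Sub 1%:M (unitmx1 _ _).

Fact GL_mul_subproof (A B : GL) : val A *m val B \in unitmx.
Proof. by rewrite unitmx_mul !(valP A, valP B). Qed.

Definition GL_mul (A B : GL) : GL := Sub (val A *m val B) (GL_mul_subproof A B).

Fact GL_inv_subproof (A : GL) : invmx (val A) \in unitmx.
Proof. by rewrite unitmx_inv (valP A). Qed.

Definition GL_inv (A : GL) : GL := Sub (invmx (val A)) (GL_inv_subproof A).

Fact GL_mulA : associative GL_mul.
Proof. by move=> A B C; apply: val_inj; rewrite !SubK mulmxA. Qed.

Fact GL_mul1g : left_id GL_one GL_mul.
Proof. by move=> A; apply: val_inj; rewrite !SubK mul1mx. Qed.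

Fact GL_mulg1 : right_id GL_one GL_mul.
Proof. by move=> A; apply: val_inj; rewrite !SubK mulmx1. Qed.

Fact GL_mulVg : left_inverse GL_one GL_inv GL_mul.
Proof. by move=> A; apply: val_inj; rewrite !SubK mulVmx// (valP A). Qed.

Fact GL_mulgV : right_inverse GL_one GL_inv GL_mul.
Proof. by move=> A; apply: val_inj; rewrite !SubK mulmxV// (valP A). Qed.

HB.instance Definition _ := isGroup.Build GL
  GL_mulA GL_mul1g GL_mulg1 GL_mulVg GL_mulgV.

End GeneralLinearGroup.

Definition contains_subgroup_isomorphic_to (G S : groupType) : Prop :=
  exists (H : {pred G}) (f : S -> G),
    [/\ group_closed H,
        {morph f : a b / (a * b)%g},
        injective f &
        forall c : G, c \in H <-> exists a, f a = c].

Section RiemannSurface.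
Context (R : realType).

Definition cplx : numFieldType := R[i].

Record complex_chart (X : topologicalType) := ComplexChart {
  chart_dom : set X;
  chart_map : X -> cplx;
  chart_inv : cplx -> X;
  chart_dom_open : open chart_dom;
  chart_img_open : open (chart_map @` chart_dom);
  chart_mapK : {in chart_dom, cancel chart_map chart_inv};
  chart_map_continuous : {within chart_dom, continuous chart_map};
  chart_inv_continuous : {within chart_map @` chart_dom, continuous chart_inv}
}.

(* Complex differentiability of the transition map at every point of the image
   of the overlap: the field of scalars in [derivable] is cplx. *)
Definition chart_compatible (X : topologicalType) (c d : complex_chart X) :=
  forall w : cplx, (chart_map c @` (chart_dom c `&` chart_dom d)) w ->
    @derivable cplx cplx^o cplx^o (chart_map d \o chart_inv c) w 1.

Definition complex_atlas (X : topologicalType) (A : set (complex_chart X)) :=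
  (forall x, exists2 c, A c & chart_dom c x) /\
  (forall c d, A c -> A d -> chart_compatible c d).

Definition closed_riemann_surface (X : topologicalType) : Prop :=
  [/\ hausdorff_space X, connected [set: X], compact [set: X] &
      exists A : set (complex_chart X), complex_atlas A].

Definition closed_disc : set (R * R) := [set z | z.1 ^+ 2 + z.2 ^+ 2 <= 1].

(* The unit circle cut into 4g equal arcs; the i-th arc is t in [i, i + 1]. *)
Definition circle_pt (g : nat) (t : R) : R * R :=
  (cos (2 * trigo.pi * t / (4 * g)%:R), sin (2 * trigo.pi * t / (4 * g)%:R)).

(* Counterclockwise the boundary reads a_0 b_0 a_0^-1 b_0^-1 a_1 b_1 ...: the
   arcs 4k and 4k+2 are identified with opposite orientations, and so are the
   arcs 4k+1 and 4k+3. *)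
Definition side_pairing (g : nat) (z w : R * R) : Prop :=
  exists (k : nat) (u : R), [/\ (k < g)%N, 0 <= u <= 1 &
    (z = circle_pt g ((4 * k)%:R + u) /\ w = circle_pt g ((4 * k + 3)%:R - u))
    \/
    (z = circle_pt g ((4 * k + 1)%:R + u) /\
     w = circle_pt g ((4 * k + 4)%:R - u))].

(* X is homeomorphic to the orientable surface with g handles, given as the
   4g-gon with the side pairings above.  When X is Hausdorff, a continuous
   surjection q from the compact disc is a quotient map, so only its fibres need
   to be specified.  Meant for 0 < g. *)
Definition has_genus (g : nat) (X : topologicalType) : Prop :=
  exists q : R * R -> X,
    [/\ {within closed_disc, continuous q},
        q @` closed_disc = [set: X] &
        {in closed_disc &, forall z w,
          q z = q w <->
          Relation_Operators.clos_refl_sym_trans _ (side_pairing g) z w}].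

End RiemannSurface.

(* Main.v *)
From HB Require Import structures.
Require Import Defs.
From mathcomp Require Import all_boot all_order all_algebra.
From mathcomp Require Import zify ring.

(** The idea.  Let F be the free group on a and b, and let c be the commutator
    of a and b.  The group of genus two is the amalgam of two copies of F along
    the subgroup generated by c, and the group
    of genus g >= 2 is a subgroup of index g - 1 in it, the kernel of the map
    to Z/(g - 1) that sends the a of the first copy to 1 and the other three
    generators to 0.  So two
    things are needed: a faithful representation of the amalgam in GL_2(K), and
    the fact that the fundamental group of the 4g-gon with sides identified has
    the expected presentation.

    Representation.  K contains a polynomial ring in two variables s and T over
    the prime field ([polynomial_embedding]).  Two explicit matrices over the
    polynomials in s generate a free group, because the coefficients of highest
    degree of their letters are matrices of rank one whose images and kernels
    are in general position ([lead_wordmx]); they are chosen so that c becomes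
    a diagonal matrix.  A word with a vanishing off-diagonal entry begins or ends
    like a power of c, and a purely combinatorial argument on reduced words
    ([word_subgroup_comm]) shows that it is a power of c.  The second copy of F
    is the conjugate of the first by diag(T, 1), which commutes with c.  In an
    alternating product of syllables that are not powers of c, the coefficient
    of the highest power of T is a product of those nonzero off-diagonal
    entries ([lead_syllmx]), so that no such product is trivial.  This is
    Shalen's criterion for amalgams, and gives [genus2_faithful].

    Cyclic cover.  Instead of embedding one abstract group in another, a group
    Gam with the generators and relation of genus g acts, through the letters
    of the group of genus two, on the g - 1 sheets Gam * 'I_(g - 1)
    ([cover_act]).  An element that the representation kills comes from a word
    that the representation of the amalgam kills, hence acts trivially and is
    trivial ([rho_faithful]).

    Topology.  Two statements about the surface suffice.  Any two families in a
    group that satisfy the surface relation are the images of the standard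
    loops under a homomorphism ([surface_hom]); it is the holonomy of an
    explicit locally constant cocycle, built from a function on the polygon
    whose jumps across the identified sides are the prescribed elements
    ([potential_side]).  And the standard loops satisfy the surface relation and
    generate ([surface_relation], [surface_generation]): a path is cut into
    pieces lying in charts, where it can be replaced by two segments through a
    common point, so that only loops joining two points of one fibre of the
    polygon remain. *)

(** * Words in two letters *)

Module Words.
Set Implicit Arguments.
Unset Strict Implicit.
Unset Printing Implicit Defensive.

Definition letter := (bool * bool)%type.
Definition linv (x : letter) : letter := (x.1, ~~ x.2).
Definition push (x : letter) (w : seq letter) : seq letter :=
  if w is y :: w' then if y == linv x then w' else x :: w else [:: x].
Definition red (w : seq letter) : seq letter := foldr push [::] w.
Definition reduced (w : seq letter) : bool := sorted (fun x y => y != linv x) w.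
Definition winv (w : seq letter) : seq letter := rev (map linv w).

Lemma linvK : involutive linv.
Proof. by case=> a b; rewrite /linv /= negbK. Qed.

Lemma reduced_push x w : reduced w -> reduced (push x w).
Proof.
case: w => //= y w; case: eqP => [_|/eqP yx] rw; first exact: (path_sorted rw).
by rewrite /= yx.
Qed.

Lemma reduced_red w : reduced (red w).
Proof. by elim: w => //= x w IH; exact: reduced_push. Qed.

Lemma red_id w : reduced w -> red w = w.
Proof.
elim: w => //= x w IH rxw; rewrite IH; last exact: (path_sorted rxw).
by case: w rxw {IH} => //= y w /andP[/negbTE -> _].
Qed.

Lemma pushK x w : reduced w -> push (linv x) (push x w) = w.
Proof.
case: w => [|y w] /=; first by rewrite linvK eqxx.
case: eqP => [-> |_] /=; last by rewrite linvK eqxx.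
by case: w => //= z w; rewrite linvK => /andP[/negbTE -> _].
Qed.

Lemma winvK : involutive winv.
Proof. by move=> w; rewrite /winv map_rev revK (mapK linvK). Qed.

Lemma reduced_winv w : reduced w -> reduced (winv w).
Proof.
rewrite /winv /reduced rev_sorted sorted_map.
congr (is_true _); apply: eq_sorted => x y /=.
by rewrite linvK eq_sym.
Qed.

Section Act.
Variables (S : Type) (act : letter -> S -> S).
Hypothesis actK : forall x, cancel (act x) (act (linv x)).

Definition run w s := foldr act s w.

Lemma run_cat u v s : run (u ++ v) s = run u (run v s).
Proof. by rewrite /run foldr_cat. Qed.

Lemma run_push x w s : run (push x w) s = act x (run w s).
Proof.
case: w => //= y w; case: eqP => [->|//].
by rewrite -{1}[x]linvK actK.
Qed.

Lemma run_red w s : run (red w) s = run w s.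
Proof. by elim: w => //= x w IH; rewrite run_push IH. Qed.

Lemma run_winvl w s : run (winv w) (run w s) = s.
Proof.
elim: w s => //= x w IH s.
by rewrite /winv /= rev_cons -cats1 run_cat /= actK IH.
Qed.

Lemma run_winvr w s : run w (run (winv w) s) = s.
Proof. by rewrite -{1}[w]winvK run_winvl. Qed.

End Act.

Lemma red_cat u v : red (u ++ v) = run push u (red v).
Proof. by rewrite /red foldr_cat. Qed.

Lemma red_winv_cat u w : red (u ++ winv u ++ w) = red w.
Proof.
elim: u w => //= x u IH w.
rewrite /winv /= rev_cons -cats1 -!catA IH /=.
have := pushK (linv x) (reduced_red w).
by rewrite linvK.
Qed.

(** Elements of the free group are represented by arbitrary words, hence the first
    field. *)
Record word_subgroup (P : seq letter -> Prop) : Prop := WordSubgroup {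
  ws_red : forall w, P (red w) <-> P w;
  ws_cat : forall u v, P u -> P v -> P (u ++ v);
  ws_inv : forall u, P u -> P (winv u) }.

Definition comm (g : bool) : seq letter :=
  [:: (g, false); (~~ g, false); (g, true); (~~ g, true)].

Lemma word_subgroup_cancel P u w : word_subgroup P ->
  P u -> P (winv u ++ w) -> P w.
Proof.
move=> sP Pu Puw; apply/(ws_red sP); rewrite -(red_winv_cat u).
by apply/(ws_red sP)/(ws_cat sP).
Qed.

(** In c^-1 w the prefix that w shares with c cancels. *)
Lemma red_comm_inv g v : reduced ((g, false) :: v) ->
  let u := red (winv (comm g) ++ (g, false) :: v) in
  [\/ exists2 t, v = [:: (~~ g, false), (g, true) & t] & u = push (~~ g, false) t,
      exists2 t, v = (~~ g, false) :: t & u = [:: (~~ g, false), (g, false) & t] |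
      u = [:: (~~ g, false), (g, false), (~~ g, true) & v]].
Proof.
move=> rv u; have {u} -> : u = run push (winv (comm g)) ((g, false) :: v).
  by rewrite /u red_cat red_id.
case: v rv => [|x v] rv; first by constructor 3; case: g {rv}.
have [xE|xN] := eqVneq x (~~ g, false); last first.
  by constructor 3; move: xN rv; case: x => [[] []]; case: g.
subst x; case: v rv => [|y v] rv.
  by constructor 2; exists [::] => //; case: g {rv}.
have [yE|yN] := eqVneq y (g, true).
  by subst y; constructor 1; exists v => //; case: g {rv}.
constructor 2; exists (y :: v) => //.
by move: yN rv; case: y => [[] []]; case: g.
Qed.

Lemma winv_rcons w x : winv (rcons w x) = linv x :: winv w.
Proof. by rewrite /winv map_rcons rev_rcons. Qed.

Lemma winv_cons x w : winv (x :: w) = rcons (winv w) (linv x).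
Proof. by rewrite /winv /= rev_cons. Qed.

Section CommutatorEnds.
Variables (g : bool) (P : seq letter -> Prop).
Hypotheses (sP : word_subgroup P) (Pc : P (comm g)).
Hypothesis Pends : forall x w, reduced (x :: w) -> P (x :: w) ->
  x = (g, false) \/ last x w = (g, true).

(** If w begins with the first letter of c, then c^-1 w does not, unless w begins
    with three letters of c; so its last letter is the inverse of that first
    letter, and the inverse of c^-1 w is again a reduced word in P that begins
    with it. *)
Lemma comm_ends_step v : reduced ((g, false) :: v) -> P ((g, false) :: v) ->
  [\/ exists t, v = [:: (~~ g, false), (g, true) & t],
      exists t, [/\ v = (~~ g, false) :: rcons t (g, true),
        reduced ((g, false) :: winv t ++ [:: (g, true); (~~ g, true)]) &
        P ((g, false) :: winv t ++ [:: (g, true); (~~ g, true)])] |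
      exists t, [/\ v = rcons t (g, true),
        reduced ((g, false) :: winv t ++ [:: (~~ g, false); (g, true); (~~ g, true)]) &
        P ((g, false) :: winv t ++ [:: (~~ g, false); (g, true); (~~ g, true)])]].
Proof.
move=> rv Pv; set u := red (winv (comm g) ++ (g, false) :: v).
have Pu : P u by apply/(ws_red sP)/(ws_cat sP) => //; exact: (ws_inv sP).
have ru : reduced u by exact: reduced_red.
have PVu := ws_inv sP Pu; have rVu := reduced_winv ru.
have := red_comm_inv rv; rewrite -/u => -[[t -> _]|[t vE uE]|uE].
- by constructor 1; exists t.
- constructor 2; rewrite uE in Pu ru PVu rVu.
  have [|/=] := Pends ru Pu; first by case: (g).
  case/lastP: t vE {u uE Pu ru} PVu rVu => [|t x] vE; first by case: (g).
  rewrite last_rcons !winv_cons winv_rcons -!cats1 -catA => PVu rVu xE; subst x.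
  rewrite /linv /= in PVu rVu.
  by exists t; split; rewrite ?vE ?cats1.
- constructor 3; rewrite uE in Pu ru PVu rVu.
  have [|/=] := Pends ru Pu; first by case: (g).
  case/lastP: v {u rv Pv uE Pu ru} PVu rVu => [|t x]; first by case: (g).
  rewrite last_rcons !winv_cons winv_rcons -!cats1 -!catA => PVu rVu xE; subst x.
  rewrite /linv /= in PVu rVu.
  by exists t; split; rewrite ?cats1.
Qed.

(** The step is applied to w, and then to the inverse of c^-1 w.  The last letter of
    the latter excludes all but the first alternative; and its first three
    letters come from the inverse of w. *)
Lemma comm_ends v : reduced ((g, false) :: v) -> P ((g, false) :: v) ->
  (exists t, v = [:: (~~ g, false), (g, true) & t]) \/
  (exists t, winv ((g, false) :: v) = [:: (g, false), (~~ g, false), (g, true) & t]).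
Proof.
have prefix z : last (g, false) z = (~~ g, true) ->
    reduced ((g, false) :: z) -> P ((g, false) :: z) ->
    exists t, z = [:: (~~ g, false), (g, true) & t].
  move=> lz rz Pz; case: (comm_ends_step rz Pz) => // -[t [zE _ _]];
  by move: lz; rewrite zE /= last_rcons; case: (g).
move=> rv Pv; case: (comm_ends_step rv Pv); first by left.
- move=> [t [vE rz Pz]]; right; have := reduced_winv rv.
  have [|s] := prefix _ _ rz Pz; first by rewrite last_cat.
  rewrite vE 2!winv_cons winv_rcons /linv /=.
  case: (winv t) => [|x [|y [|z' z]]] /=; first by case: (g).
  + by case: (g) => -[->].
  + by move=> [-> -> _] _; exists [:: (~~ g, true); (g, true)].
  + by move=> [-> -> _] _; exists (z' :: rcons (rcons z (~~ g, true)) (g, true)).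
- move=> [t [vE rz Pz]]; right; have := reduced_winv rv.
  have [|s] := prefix _ _ rz Pz; first by rewrite last_cat.
  rewrite vE winv_cons winv_rcons /linv /= .
  case: (winv t) => [|x [|y [|z' z]]] /=; first by case: (g).
  + by case: (g) => -[-> _].
  + by move=> [-> -> _] _; exists [:: (g, true)].
  + by move=> [-> -> _] _; exists (z' :: rcons z (g, true)).
Qed.
End CommutatorEnds.

Lemma red_comm_inv_prefix g v : 
  red (winv (comm g) ++ [:: (g, false), (~~ g, false), (g, true) & v]) =
  push (~~ g, false) (red v).
Proof.
pose u := winv [:: (g, false); (~~ g, false); (g, true)].
rewrite (_ : _ ++ _ = (~~ g, false) :: (u ++ winv u ++ v)); last by case: g @u.
by rewrite -(red_winv_cat u v).
Qed.

Lemma size_push x w : size (push x w) <= (size w).+1.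
Proof. by case: w => //= y w; case: ifP => //= _; lia. Qed.

Lemma size_red w : size (red w) <= size w.
Proof. by elim: w => //= x w IH; have := size_push x (red w); lia. Qed.

(** The property of the ends of the elements of P is that of the stabilizer of the
    attracting end of c in the action of the free group on its tree; such a
    stabilizer consists of powers of c.  The powers of c are replaced by an
    arbitrary subgroup Q containing c.  By induction on the length: an element
    of P or its inverse begins with three letters of c, and multiplying by c^-1
    shortens it. *)
Lemma word_subgroup_comm g (P Q : seq letter -> Prop) :
  word_subgroup P -> word_subgroup Q -> P (comm g) -> Q (comm g) ->
  (forall x w, reduced (x :: w) -> P (x :: w) ->
     x = (g, false) \/ last x w = (g, true)) ->
  forall w, P w -> Q w.
Proof.
move=> sP sQ Pc Qc Pends w.
have [n] := ubnP (size w); elim: n w => // n IH w le_w Pw.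
have shorten u (v : seq letter) : u = [:: (g, false), (~~ g, false), (g, true) & v] ->
    P u -> size u <= n -> Q u.
  move=> uE Pu un; apply: (word_subgroup_cancel sQ Qc).
  apply/(ws_red sQ)/IH; last first.
    by apply/(ws_red sP)/(ws_cat sP) => //; exact: (ws_inv sP).
  rewrite uE red_comm_inv_prefix; apply: leq_ltn_trans (size_push _ _) _.
  apply: (@leq_ltn_trans (size v).+1); first by rewrite ltnS size_red.
  by apply: leq_trans un; rewrite uE.
have Qstart u (v : seq letter) : u = (g, false) :: v -> reduced u -> P u -> size u <= n -> Q u.
  move=> uE ru Pu un; move: (ru) (Pu); rewrite uE => rv Pv.
  case: (comm_ends sP Pc Pends rv Pv) => -[t tE].
    by apply: (shorten _ t); [rewrite tE|rewrite -uE|rewrite -uE].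
  rewrite -[_ :: _]winvK; apply: (ws_inv sQ).
  apply: (shorten _ t tE); first exact: (ws_inv sP).
  by rewrite size_rev size_map -uE.
apply/(ws_red sQ); have := reduced_red w.
have Pr : P (red w) by apply/(ws_red sP).
have : size (red w) <= n by have := size_red w; lia.
case: (red w) Pr => [|x v] Pr sr rr.
  have /(ws_red sQ) := ws_cat sQ Qc (ws_inv sQ Qc).
  by rewrite -[winv _]cats0 red_winv_cat.
case: (Pends _ _ rr Pr) => [xE|lE].
  by apply: (Qstart _ v) => //; rewrite xE.
rewrite -[_ :: _]winvK; apply: (ws_inv sQ).
have := lastI x v; rewrite lE => vE.
apply: (Qstart _ (winv (belast x v))).
- by rewrite vE winv_rcons.
- exact: reduced_winv.
- exact: (ws_inv sP).
- by rewrite size_rev size_map.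
Qed.

End Words.
Export Words.

(** * A linear representation of the genus two group *)

Module GenusTwoRepresentation.
Set Implicit Arguments.
Unset Strict Implicit.
Unset Printing Implicit Defensive.
Import GRing.Theory.
Local Open Scope ring_scope.

Section Matrix2.
Variable A : comNzRingType.
Implicit Types M N : 'M[A]_2.

Definition mx2 (a b c d : A) : 'M[A]_2 :=
  \matrix_(i, j) if i == 0 then if j == 0 then a else b
                 else if j == 0 then c else d.

Lemma ord2P (P : 'I_2 -> Prop) : P 0 -> P 1 -> forall i, P i.
Proof.
by move=> P0 P1 i; have [->|->] : i = 0 \/ i = 1;
  [case: i => [[|[|]]] //= ?; [left|right]; apply: val_inj| |].
Qed.

Lemma mx2P M N : M 0 0 = N 0 0 -> M 0 1 = N 0 1 -> M 1 0 = N 1 0 ->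
  M 1 1 = N 1 1 -> M = N.
Proof. by move=> *; apply/matrixP; apply: ord2P; apply: ord2P. Qed.

Lemma mulmx2E M N i j : (M *m N) i j = M i 0 * N 0 j + M i 1 * N 1 j.
Proof.
rewrite mxE !big_ord_recl big_ord0 addr0.
by rewrite (_ : lift ord0 ord0 = 1) //; apply: val_inj.
Qed.

Definition adj2 M := mx2 (M 1 1) (- M 0 1) (- M 1 0) (M 0 0).
Definition det2 M := M 0 0 * M 1 1 - M 0 1 * M 1 0.

Lemma adj2M M N : adj2 (M *m N) = adj2 N *m adj2 M.
Proof. by apply: mx2P; rewrite !(mulmx2E, mxE) /=; ring. Qed.

Lemma mulmx_adj2 M : M *m adj2 M = (det2 M)%:M.
Proof. by apply: mx2P; rewrite !(mulmx2E, mxE) /= /det2 ?mulr1n ?mulr0n; ring. Qed.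

Lemma adj2K : involutive adj2.
Proof. by move=> M; apply: mx2P; rewrite !mxE /= ?opprK. Qed.

Lemma adj2_1 : adj2 1%:M = 1%:M.
Proof. by apply: mx2P; rewrite !mxE //= oppr0. Qed.

Lemma det2_adj M : det2 (adj2 M) = det2 M.
Proof. by rewrite /det2 !mxE /=; ring. Qed.

Lemma det2M M N : det2 (M *m N) = det2 M * det2 N.
Proof. by rewrite /det2 !mulmx2E; ring. Qed.

Lemma det2_scalar a : det2 a%:M = a ^+ 2.
Proof. by rewrite /det2 !mxE /= mulr1n mulr0n; ring. Qed.

End Matrix2.

Section LeadingCoefficient.
Variable A : comNzRingType.
Implicit Types M N : 'M[{poly A}]_2.

Definition deg_le d M := forall i j, (size (M i j) <= d.+1)%N.
Definition coefmx d M : 'M[A]_2 := map_mx (fun q : {poly A} => q`_d) M.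

Lemma coefM_lead (p q : {poly A}) d e : (size p <= d.+1)%N -> (size q <= e.+1)%N ->
  (p * q)`_(d + e) = p`_d * q`_e.
Proof.
move=> pd qe; rewrite coefM (bigD1 (inord d)) //= inordK; last by lia.
rewrite big1 ?addr0 ?addKn // => i ne.
have [|ltd] := ltnP i d => [ltid|].
  by rewrite [q`_ _]nth_default ?mulr0 // (leq_trans qe) //; lia.
rewrite [p`_ _]nth_default ?mul0r //; apply: leq_trans pd _.
rewrite ltn_neqAle ltd andbT; apply: contra ne => /eqP de.
by apply/eqP/val_inj; rewrite /= -de inordK //; lia.
Qed.

Lemma deg_leM d e M N : deg_le d M -> deg_le e N -> deg_le (d + e) (M *m N).
Proof.
move=> dM eN i j; rewrite mulmx2E; apply: leq_trans (size_polyD _ _) _.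
rewrite geq_max; apply/andP; split; apply: leq_trans (size_polyMleq _ _) _.
  by rewrite -subn1 leq_subLR (leq_trans (leq_add (dM i 0) (eN 0 j))) //; lia.
by rewrite -subn1 leq_subLR (leq_trans (leq_add (dM i 1) (eN 1 j))) //; lia.
Qed.

Lemma coefmxM d e M N : deg_le d M -> deg_le e N ->
  coefmx (d + e) (M *m N) = coefmx d M *m coefmx e N.
Proof.
move=> dM eN; apply/matrixP => i j; rewrite mxE !mulmx2E coefD !mxE.
by rewrite !coefM_lead.
Qed.

End LeadingCoefficient.

Section FreeGroup.
Variable F : fieldType.
Hypothesis two_neq0 : 2 != 0 :> F.

(** Both matrices have a tree interpretation: at the place s = infinity they are
    hyperbolic, with axes that meet in one vertex and leave it in four distinct
    directions; so they generate a free group, and their commutator c is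
    hyperbolic, its axis leaving the vertex in the attracting directions of a
    and b.  The entries are adjusted so that the ends of this axis are the lines
    of the two basis vectors: c is diagonal, with entries s ^ 2 and s ^ -2. *)
Definition mxa : 'M[{poly F}]_2 := mx2 'X^2 'X^2 'X 1.
Definition mxb : 'M[{poly F}]_2 := mx2 1 'X (2%:R *: 'X^2 - 1) 'X^2.
(** Inverses are replaced by adjugates, which keeps the entries polynomial and
    changes matrices by nonzero scalars only. *)
Definition lettermx (x : letter) : 'M[{poly F}]_2 :=
  let M := if x.1 then mxb else mxa in if x.2 then adj2 M else M.
Definition wordmx (w : seq letter) : 'M[{poly F}]_2 :=
  run (fun x => mulmx (lettermx x)) w 1%:M.

(** The coefficient of s ^ 2 in a letter is the rank one matrix with entries
    [head_dir x i * tail_dir x j]. *)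
Definition head_dir (x : letter) (i : 'I_2) : F :=
  match x with
  | (false, false) => if i == 0 then 1 else 0
  | (false, true) => if i == 0 then -1 else 1
  | (true, false) => if i == 0 then 0 else 1
  | (true, true) => if i == 0 then 1 else - 2
  end.
Definition tail_dir (x : letter) (i : 'I_2) : F :=
  match x with
  | (false, false) => 1
  | (false, true) => if i == 0 then 0 else 1
  | (true, false) => if i == 0 then 2 else 1
  | (true, true) => if i == 0 then 1 else 0
  end.

Lemma wordmx_cons x w : wordmx (x :: w) = lettermx x *m wordmx w.
Proof. by []. Qed.

Lemma wordmx_cat u v : wordmx (u ++ v) = wordmx u *m wordmx v.
Proof.
elim: u => [|x u IH]; first by rewrite mul1mx.
by rewrite cat_cons !wordmx_cons IH mulmxA.
Qed.

Lemma lettermx_linv x : lettermx (linv x) = adj2 (lettermx x).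
Proof. by case: x => [g []]; rewrite /lettermx /= ?adj2K. Qed.

Lemma wordmx_winv w : wordmx (winv w) = adj2 (wordmx w).
Proof.
elim: w => [|x w IH]; first by rewrite adj2_1.
by rewrite winv_cons -cats1 wordmx_cat wordmx_cons mulmx1 lettermx_linv IH
   wordmx_cons adj2M.
Qed.

Lemma det2_lettermx x : det2 (lettermx x) != 0.
Proof.
have -> : det2 (lettermx x) = det2 (if x.1 then mxb else mxa).
  by rewrite /lettermx; case: x.2; rewrite ?det2_adj.
apply/eqP => /(congr1 (fun q : {poly F} => q`_2)); rewrite coef0.
case: x.1; rewrite /det2 !mxE /= ?mulr1 ?mul1r.
  rewrite mulrBr mulr1 -scalerAr -exprS !coefB coefZ !coefXn coefX /= mulr0 !subr0.
  by apply/eqP; rewrite oner_neq0.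
rewrite -exprSr !coefB !coefXn /= subr0.
by apply/eqP; rewrite oner_neq0.
Qed.

Lemma det2_wordmx w : det2 (wordmx w) != 0.
Proof.
elim: w => [|x w IH]; first by rewrite det2_scalar expr1n oner_neq0.
by rewrite wordmx_cons det2M mulf_neq0 // det2_lettermx.
Qed.

Lemma wordmx_red w : exists2 k, k != 0 & wordmx w = k *: wordmx (red w).
Proof.
elim: w => [|x w [k k0 IH]]; first by exists 1; rewrite ?oner_neq0 ?scale1r.
rewrite wordmx_cons IH /= /push; case: (red w) => [|y u].
  by exists k => //; rewrite -scalemxAr.
case: eqP => [->|_]; last by exists k => //; rewrite -scalemxAr.
exists (k * det2 (lettermx x)); first by rewrite mulf_neq0 // det2_lettermx.
rewrite -scalemxAr wordmx_cons mulmxA lettermx_linv mulmx_adj2.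
by rewrite mul_scalar_mx scalerA.
Qed.

Lemma deg_lettermx x : deg_le 2 (lettermx x).
Proof.
have sX2 : (size ('X^2 : {poly F}) <= 3)%N by rewrite size_polyXn.
have sX : (size ('X : {poly F}) <= 3)%N by rewrite size_polyX.
have s1 : (size (1%R : {poly F}) <= 3)%N by rewrite size_poly1.
have s2 : (size ((2%:R *: 'X^2 - 1)%R : {poly F}) <= 3)%N.
  apply: leq_trans (size_polyD _ _) _; rewrite size_polyN geq_max s1 andbT.
  exact: leq_trans (size_scale_leq _ _) sX2.
by case: x => [[] []]; apply: ord2P; apply: ord2P;
  rewrite /lettermx /= !mxE /= ?size_polyN.
Qed.

Lemma coef_lettermx x i j : coefmx 2 (lettermx x) i j = head_dir x i * tail_dir x j.
Proof.
rewrite mxE; case: x => [[] []]; move: i j; apply: ord2P; apply: ord2P;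
rewrite /lettermx /= !mxE /= ?coefN ?coefB ?coefZ ?coefXn ?coefX ?coef1 /=;
by rewrite ?(mulr1, mulr0, mul0r, mul1r, subr0, oppr0, mulrN1, mulN1r).
Qed.

(** Ping-pong: the kernel of the leading matrix of x contains the image of that of
    y only if y is the inverse of x.  Two of the sixteen pairings are equal
    to 2 and -2. *)
Lemma dir_neq0 x y : y != linv x ->
  tail_dir x 0 * head_dir y 0 + tail_dir x 1 * head_dir y 1 != 0.
Proof.
have N1 : -1 != 0 :> F by rewrite oppr_eq0 oner_neq0.
have N2 : - 2 != 0 :> F by rewrite oppr_eq0.
have e1 : 1 - 2 = -1 :> F by ring.
have e2 : 2 * -1 + 1 = -1 :> F by ring.
have e3 : 2 * 1 + -2 = 0 :> F by ring.
by case: x => [[] []]; case: y => [[] []] //= _;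
  rewrite ?(mulr1, mulr0, mul0r, mul1r, addr0, add0r, oner_neq0, e1, e2, N1, N2, two_neq0).
Qed.

Lemma lead_wordmx x w : reduced (x :: w) ->
  deg_le (2 * (size w).+1) (wordmx (x :: w)) /\
  exists2 k, k != 0 & forall i j, coefmx (2 * (size w).+1) (wordmx (x :: w)) i j =
    k * (head_dir x i * tail_dir (last x w) j).
Proof.
elim: w x => [|y w IH] x.
  move=> _; rewrite wordmx_cons mulmx1; split; first exact: deg_lettermx.
  by exists 1; rewrite ?oner_neq0 // => i j; rewrite coef_lettermx mul1r.
move=> /= /andP[yx rw]; have [d [k k0 lead]] := IH y rw.
rewrite mulnS -[lettermx y *m _]wordmx_cons; split; first exact: (deg_leM (deg_lettermx x)).
exists (k * (tail_dir x 0 * head_dir y 0 + tail_dir x 1 * head_dir y 1)).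
  by rewrite mulf_neq0 // dir_neq0.
move=> i j; rewrite (coefmxM (deg_lettermx x)) // mulmx2E !coef_lettermx !lead.
ring.
Qed.

(** Matrices act on column vectors: the first property says that the line of the
    first basis vector, the attracting end of the commutator, is fixed, the
    second that its repelling end is. *)
Definition fixes_e1 w := wordmx w 1 0 = 0.
Definition fixes_e2 w := wordmx w 0 1 = 0.

Lemma subgroup_fixes_e1 : word_subgroup fixes_e1.
Proof.
split=> [w|u v|u]; rewrite /fixes_e1.
- have [k k0 ->] := wordmx_red w; rewrite mxE; split=> [->|/eqP]; first by rewrite mulr0.
  by rewrite mulf_eq0 (negbTE k0) => /eqP.
- by rewrite wordmx_cat mulmx2E => -> ->; ring.
- by rewrite wordmx_winv !mxE => ->; rewrite oppr0.
Qed.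

Lemma subgroup_fixes_e2 : word_subgroup fixes_e2.
Proof.
split=> [w|u v|u]; rewrite /fixes_e2.
- have [k k0 ->] := wordmx_red w; rewrite mxE; split=> [->|/eqP]; first by rewrite mulr0.
  by rewrite mulf_eq0 (negbTE k0) => /eqP.
- by rewrite wordmx_cat mulmx2E => -> ->; ring.
- by rewrite wordmx_winv !mxE => ->; rewrite oppr0.
Qed.

Lemma comm_diag : fixes_e1 (comm false) /\ fixes_e2 (comm false).
Proof.
by rewrite /fixes_e1 /fixes_e2 /wordmx /= /lettermx /= mulmx1 !(mulmx2E, mxE) /=
  -!mul_polyC; split; ring.
Qed.

Lemma winv_comm g : winv (comm g) = comm (~~ g).
Proof. by case: g. Qed.

Lemma fixes_e1_comm (Q : seq letter -> Prop) : word_subgroup Q -> Q (comm false) ->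
  forall w, fixes_e1 w -> Q w.
Proof.
move=> sQ Qc; apply: (word_subgroup_comm subgroup_fixes_e1 sQ _ Qc).
  by case: comm_diag.
move=> x w rw; have [_ [k k0 lead]] := lead_wordmx rw.
move=> /(congr1 (fun q : {poly F} => q`_(2 * (size w).+1))).
have := lead 1 0; rewrite mxE => -> /eqP.
rewrite coef0 !mulf_eq0 (negbTE k0) /=; move: (last x w) => y.
by case: x {lead rw} => [[] []]; case: y => [[] []]; rewrite /= ?oppr_eq0 ?oner_eq0
   ?(negbTE two_neq0) // => _; (by left) || (by right).
Qed.

(** Exchanging a and b exchanges the two ends, and the commutator with its
    inverse. *)
Lemma fixes_e2_comm (Q : seq letter -> Prop) : word_subgroup Q -> Q (comm false) ->
  forall w, fixes_e2 w -> Q w.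
Proof.
move=> sQ Qc; apply: (word_subgroup_comm (g := true) subgroup_fixes_e2 sQ).
- by rewrite -[true]/(~~ false) -winv_comm; apply: (ws_inv subgroup_fixes_e2);
    case: comm_diag.
- by rewrite -[true]/(~~ false) -winv_comm; apply: (ws_inv sQ).
move=> x w rw; have [_ [k k0 lead]] := lead_wordmx rw.
move=> /(congr1 (fun q : {poly F} => q`_(2 * (size w).+1))).
have := lead 0 1; rewrite mxE => -> /eqP.
rewrite coef0 !mulf_eq0 (negbTE k0) /=; move: (last x w) => y.
by case: x {lead rw} => [[] []]; case: y => [[] []]; rewrite /= ?oppr_eq0 ?oner_eq0
   ?(negbTE two_neq0) // => _; (by left) || (by right).
Qed.

Lemma wordmx_scalar w k : wordmx w = k%:M -> red w = [::].
Proof.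
move=> wk; have [l l0 wl] := wordmx_red w.
have e1 : fixes_e1 (red w).
  by apply/(ws_red subgroup_fixes_e1); rewrite /fixes_e1 wk mxE.
have e2 : fixes_e2 (red w).
  by apply/(ws_red subgroup_fixes_e2); rewrite /fixes_e2 wk mxE.
have e3 : wordmx (red w) 0 0 = wordmx (red w) 1 1.
  apply: (mulfI l0); have := congr1 (fun M : 'M__ => M 0 0) wl.
  have := congr1 (fun M : 'M__ => M 1 1) wl.
  by rewrite wk !mxE /= => <- <-.
move: e1 e2 e3 (reduced_red w); case: (red w) => // x u e1 e2 e3 ru.
have [_ [m m0 lead]] := lead_wordmx ru; exfalso.
have := congr1 (fun q : {poly F} => q`_(2 * (size u).+1)) e3.
have := lead 0 0; have := lead 1 1; rewrite !mxE => -> ->.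
have := congr1 (fun q : {poly F} => q`_(2 * (size u).+1)) e1.
have := congr1 (fun q : {poly F} => q`_(2 * (size u).+1)) e2.
have := lead 0 1; have := lead 1 0; rewrite !mxE => -> ->; rewrite coef0.
move=> /eqP h1 /eqP h2 /(mulfI m0) /eqP.
move: h1 h2; rewrite !mulf_eq0 (negbTE m0) /=; move: (last x u) => y {lead ru e1 e2 e3}.
by case: x => [[] []]; case: y => [[] []]; rewrite /= ?oppr_eq0 ?oner_eq0 ?eqxx
   ?(negbTE two_neq0) // => _ _; rewrite !mulr1 !mulr0 ?oner_eq0 // eq_sym oner_eq0.
Qed.

End FreeGroup.

Section Proportional.
Variable A : idomainType.
Implicit Types M N : 'M[A]_2.

(** Equality up to nonzero scalars of the field of fractions. *)
Definition propto M N := exists k l, [/\ k != 0, l != 0 & k *: M = l *: N].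

Lemma propto_refl M : propto M M.
Proof. by exists 1, 1; rewrite oner_neq0. Qed.

Lemma propto_sym M N : propto M N -> propto N M.
Proof. by move=> [k [l [? ? ?]]]; exists l, k. Qed.

Lemma propto_trans M N P : propto M N -> propto N P -> propto M P.
Proof.
move=> [k [l [k0 l0 MN]]] [k' [l' [k'0 l'0 NP]]].
exists (k' * k), (l * l'); split; rewrite ?mulf_neq0 //.
by rewrite -[LHS]scalerA MN scalerA [k' * l]mulrC -[LHS]scalerA NP scalerA.
Qed.

Lemma proptoM M M' N N' : propto M M' -> propto N N' -> propto (M *m N) (M' *m N').
Proof.
move=> [k [l [k0 l0 MN]]] [k' [l' [k'0 l'0 NP]]].
exists (k * k'), (l * l'); split; rewrite ?mulf_neq0 //.
have E (a b : A) (P Q : 'M[A]_2) : (a * b) *: (P *m Q) = (a *: P) *m (b *: Q).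
  by rewrite -scalemxAl -scalemxAr scalerA.
by rewrite !E MN NP.
Qed.

Lemma proptoZ k M : k != 0 -> propto (k *: M) M.
Proof. by move=> k0; exists 1, k; rewrite oner_neq0 scale1r. Qed.

Lemma propto_scalar a M : propto M a%:M ->
  [/\ M 0 1 = 0, M 1 0 = 0 & M 0 0 = M 1 1].
Proof.
move=> [k [l [k0 l0 /matrixP e]]]; split; apply: (mulfI k0).
- by have := e 0 1; rewrite !mxE mulr0n !mulr0.
- by have := e 1 0; rewrite !mxE mulr0n !mulr0.
- by have := e 0 0; have := e 1 1; rewrite !mxE => -> ->.
Qed.

End Proportional.

Section GenusTwo.
Variable F : fieldType.
Hypothesis two_neq0 : 2 != 0 :> F.

Local Notation W := (@wordmx F).

Definition liftT (N : 'M[{poly F}]_2) : 'M[{poly {poly F}}]_2 := map_mx polyC N.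
(** The product of diag(T, 1), N and the adjugate diag(1, T) of the former. *)
Definition conjT (N : 'M[{poly F}]_2) : 'M[{poly {poly F}}]_2 :=
  mx2 ('X * (N 0 0)%:P) ('X^2 * (N 0 1)%:P) (N 1 0)%:P ('X * (N 1 1)%:P).

Definition sidemx (s : bool) N := if s then conjT N else liftT N.

Definition word2mx (w : seq (bool * letter)) : 'M[{poly {poly F}}]_2 :=
  foldr (fun x => mulmx (sidemx x.1 (lettermx F x.2))) 1%:M w.

Lemma conjTM M N : 'X *: conjT (M *m N) = conjT M *m conjT N.
Proof. by apply: mx2P; rewrite !(mulmx2E, mxE) /= !(rmorphD, rmorphM) /=; ring. Qed.

Lemma liftTM M N : liftT (M *m N) = liftT M *m liftT N.
Proof. exact: map_mxM. Qed.

Lemma polyX_neq0 (A : nzRingType) : ('X : {poly A}) != 0.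
Proof. exact: monic_neq0 (monicX _). Qed.

Lemma propto_conjTM M N : propto (conjT (M *m N)) (conjT M *m conjT N).
Proof. by rewrite -conjTM; apply: propto_sym; apply: proptoZ; exact: polyX_neq0. Qed.

Lemma propto_conjT_lift (M : 'M[{poly F}]_2) : M 0 1 = 0 -> M 1 0 = 0 -> propto (conjT M) (liftT M).
Proof.
move=> M01 M10; rewrite (_ : conjT M = 'X *: liftT M).
  by apply: proptoZ; exact: polyX_neq0.
by apply: mx2P; rewrite !mxE /= ?M01 ?M10; ring.
Qed.

Definition syllables := seq (seq letter * seq letter).
Definition syllmx (L : syllables) :=
  foldr (fun vu => mulmx (conjT (W vu.1) *m liftT (W vu.2))) 1%:M L.

(** Products of syllables of the second and the first copy, none of which lies in
    the amalgamated subgroup, except possibly the last. *)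
Fixpoint alternating (L : syllables) : Prop :=
  if L is (v, u) :: L' then
    [/\ ~ fixes_e2 F v, L' <> [::] -> ~ fixes_e1 F u & alternating L']
  else True.

Lemma deg_liftT N : deg_le 0 (liftT N).
Proof. by move=> i j; rewrite mxE size_polyC_leq1. Qed.

Lemma coef_liftT N : coefmx 0 (liftT N) = N.
Proof. by apply/matrixP => i j; rewrite !mxE coefC. Qed.

Lemma deg_conjT N : deg_le 2 (conjT N).
Proof.
have s (c : {poly F}) k : (k <= 2)%N -> (size ('X^k * c%:P)%R <= 3)%N.
  move=> k2; apply: leq_trans (size_polyMleq _ _) _.
  by rewrite size_polyXn -subn1 leq_subLR (leq_trans (leq_add (leqnn _) (size_polyC_leq1 c))) //; lia.
apply: ord2P; apply: ord2P; rewrite !mxE /=; try exact: (s _ 1%N); try exact: s.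
exact: leq_trans (size_polyC_leq1 _) _.
Qed.

Lemma coef_conjT N i j :
  coefmx 2 (conjT N) i j = if (i == 0) && (j == 1) then N 0 1 else 0.
Proof.
move: i j; apply: ord2P; apply: ord2P; rewrite !mxE /= ?coefXM ?coefXnM ?coefC //=.
Qed.

(** The coefficient of T ^ 2 in [conjT N] has N 0 1 as its only nonzero entry, in
    the same place; so the leading coefficient of the product of the syllables
    keeps only the entries 0 1 of the syllables of the second copy and the
    entries 1 0 of those of the first, and the matrix of the last syllable. *)
Lemma lead_syllmx L : alternating L -> L <> [::] ->
  deg_le (2 * size L) (syllmx L) /\ exists k u, k != 0 /\ forall j,
    coefmx (2 * size L) (syllmx L) 0 j = k * W u 1 j /\
    coefmx (2 * size L) (syllmx L) 1 j = 0.
Proof.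
elim: L => // -[v u] L IH [vP uP altL] _.
case: L IH uP altL => [|x L'] IH uP altL.
  rewrite /= mulmx1; split.
    exact: (@deg_leM _ 2 0 _ _ (deg_conjT _) (deg_liftT _)).
  exists (W v 0 1), u; split; first exact/eqP.
  move=> j; rewrite -[X in coefmx X]addn0 (coefmxM (deg_conjT _) (deg_liftT _)).
  by rewrite !mulmx2E !coef_conjT coef_liftT /=; split; ring.
have {IH} := IH altL; set L := x :: L' in uP altL * => -[//|d [k [u' [k0 lead]]]].
have dT := deg_leM (deg_conjT (W v)) (deg_liftT (W u)).
rewrite /= mulnS; split; first exact: (deg_leM dT d).
exists (W v 0 1 * W u 1 0 * k), u'; split.
  by rewrite !mulf_neq0 //; apply/eqP => //; exact: uP.
move=> j; rewrite -[(2 + _)%N]/((2 + 0) + 2 * size L)%N.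
rewrite (coefmxM dT d) (coefmxM (deg_conjT _) (deg_liftT _)).
have [l0 l1] := lead j.
by rewrite !mulmx2E !coef_conjT coef_liftT l0 l1 /=; split; ring.
Qed.

(** The leading coefficient is a nonzero matrix of rank one. *)
Lemma syllmx_not_scalar u L a : alternating L -> L <> [::] ->
  ~ propto (liftT (W u) *m syllmx L) a%:M.
Proof.
move=> altL L0 /propto_scalar[e01 e10 e00].
have [d [k [u' [k0 lead]]]] := lead_syllmx altL L0.
have cE i j : ((liftT (W u) *m syllmx L) i j)`_(2 * size L) = W u i 0 * (k * W u' 1 j).
  have := coefmxM (deg_liftT (W u)) d => /matrixP/(_ i j); rewrite mxE add0n => ->.
  by have [l0 l1] := lead j; rewrite mulmx2E coef_liftT l0 l1; ring.
have := cE 0 1; rewrite e01 coef0 => /esym h01.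
have := cE 1 0; rewrite e10 coef0 => /esym h10.
have := cE 0 0; rewrite e00 cE => /esym h00.
have du := det2_wordmx F u; have du' := det2_wordmx F u'.
have [u00|u00] := eqVneq (W u 0 0) 0.
  have u10 : W u 1 0 != 0.
    by apply: contraNneq du => u10; rewrite /det2 u00 u10; apply/eqP; ring.
  have u'10 : W u' 1 0 = 0.
    by apply/eqP; move/eqP: h10; rewrite !mulf_eq0 (negbTE u10) (negbTE k0).
  have u'11 : W u' 1 1 = 0.
    apply/eqP; move/eqP: h00; rewrite u00 mul0r eq_sym.
    by rewrite !mulf_eq0 (negbTE u10) (negbTE k0).
  by move: du'; rewrite /det2 u'10 u'11 !mulr0 subrr eqxx.
have u'11 : W u' 1 1 = 0.
  by apply/eqP; move/eqP: h01; rewrite !mulf_eq0 (negbTE u00) (negbTE k0).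
have u'10 : W u' 1 0 = 0.
  apply/eqP; move/eqP: h00; rewrite u'11 !mulr0.
  by rewrite !mulf_eq0 (negbTE u00) (negbTE k0).
by move: du'; rewrite /det2 u'10 u'11 !mulr0 subrr eqxx.
Qed.

Variables (S : Type) (act : bool -> letter -> S -> S).
Hypothesis actK : forall s x, cancel (act s x) (act s (linv x)).
Hypothesis act_comm : forall z,
  run (act false) (comm false) z = run (act true) (comm false) z.

Definition run2 (w : seq (bool * letter)) z := foldr (fun x => act x.1 x.2) z w.
Definition run_syll (L : syllables) z :=
  foldr (fun vu y => run (act true) vu.1 (run (act false) vu.2 y)) z L.

(** Words with a vanishing off-diagonal entry are powers of the commutator; hence
    they may be moved from one copy to the other. *)
Lemma act_fixes v : fixes_e1 F v \/ fixes_e2 F v ->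
  (forall z, run (act false) v z = run (act true) v z) /\
  propto (conjT (W v)) (liftT (W v)).
Proof.
pose Q v := forall z, run (act false) v z = run (act true) v z.
have sQ : word_subgroup Q.
  split=> [w|u w Qu Qw z|u Qu z].
  - by split=> Qw z; have := Qw z; rewrite !run_red.
  - by rewrite !run_cat Qw Qu.
  - rewrite -{1}[z](run_winvr (actK true) u) -Qu (run_winvl (actK false)) //.
have [c1 c2] := comm_diag F.
move=> vP.
have v1 : fixes_e1 F v.
  by case: vP => //; apply: (fixes_e2_comm two_neq0 (subgroup_fixes_e1 F)).
have v2 : fixes_e2 F v.
  by case: vP => //; apply: (fixes_e1_comm two_neq0 (subgroup_fixes_e2 F)).
split; last exact: propto_conjT_lift.
exact: (fixes_e1_comm two_neq0 sQ act_comm).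
Qed.

(** Letters are added on the left.  A letter of the first copy is absorbed by the
    leading syllable u; one of the second copy begins a new syllable if u is not
    a power of the commutator, and otherwise merges with u and the syllable
    after it; if the result is a power of the commutator, it is moved to the
    first copy. *)
Lemma syllable_form w : exists u L, [/\ alternating L,
  propto (word2mx w) (liftT (W u) *m syllmx L) &
  forall z, run2 w z = run (act false) u (run_syll L z)].
Proof.
elim: w => [|[s x] w [u [L [altL pL rL]]]].
  by exists [::], [::]; split => //=; rewrite mulmx1 [liftT _]map_mx1; exact: propto_refl.
case: s => /=; last first.
  exists (x :: u), L; split; [exact: altL| |by move=> z /=; rewrite rL].
  by rewrite wordmx_cons liftTM -mulmxA; apply: proptoM => //; exact: propto_refl.
have Wx : lettermx F x = W [:: x] by rewrite wordmx_cons mulmx1.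
have px : propto (conjT (lettermx F x) *m word2mx w)
     (conjT (W [:: x]) *m (liftT (W u) *m syllmx L)).
  by rewrite -Wx; apply: proptoM => //; exact: propto_refl.
have x2 : ~ fixes_e2 F [:: x].
  have sX : ('X : {poly F}) != 0 by exact: polyX_neq0.
  rewrite /fixes_e2 -Wx /lettermx; case: x {Wx px} => [[] []] /eqP;
  by rewrite !mxE /= ?oppr_eq0 ?expf_eq0 ?(negbTE (polyX_neq0 _)).
have pI N : propto (liftT (W [::]) *m N) N.
  by rewrite [liftT _]map_mx1 mul1mx; exact: propto_refl.
have [u1|u1] := eqVneq (W u 1 0) 0; last first.
  exists [::], (([:: x], u) :: L); split => //=.
  - by split => // _; apply/eqP.
  - apply: propto_trans px _; rewrite mulmxA; apply: propto_sym; exact: pI.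
  - by move=> z; rewrite rL.
case: L altL pL rL px => [|[v u'] L] altL pL rL px.
  exists [::], [:: ([:: x], u)]; split => //=.
  - apply: propto_trans px _; rewrite mulmxA; apply: propto_sym; exact: pI.
  - by move=> z; rewrite rL.
have [ru pu] := act_fixes (or_introl u1).
have [v' v'E] : exists v', v' = [:: x] ++ u ++ v by eexists.
have pv' : propto (conjT (W [:: x]) *m (liftT (W u) *m syllmx ((v, u') :: L)))
     (conjT (W v') *m liftT (W u') *m syllmx L).
  rewrite /= !mulmxA; apply: proptoM; last exact: propto_refl.
  apply: proptoM; last exact: propto_refl.
  rewrite v'E 2!wordmx_cat mulmxA.
  apply: propto_sym; apply: propto_trans (propto_conjTM _ _) _.
  apply: proptoM; last exact: propto_refl.
  apply: propto_trans (propto_conjTM _ _) _.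
  by apply: proptoM; first exact: propto_refl.
have rv' z : act true x (run2 w z) =
    run (act true) v' (run (act false) u' (run_syll L z)).
  by rewrite rL v'E !run_cat /= ru.
case: altL => _ u'P altL.
have [v1|v1] := eqVneq (W v' 0 1) 0; last first.
  exists [::], ((v', u') :: L); split; last exact: rv'.
  - by split; [apply/eqP|exact: u'P|exact: altL].
  - apply: propto_trans px _; apply: propto_trans pv' _; apply: propto_sym; exact: pI.
have [rv pv] := act_fixes (or_intror v1).
exists (v' ++ u'), L; split => //=; last by move=> z; rewrite rv' run_cat rv.
apply: propto_trans px _; apply: propto_trans pv' _; rewrite wordmx_cat liftTM.
by apply: proptoM; [apply: proptoM => //|]; exact: propto_refl.
Qed.

(** The group of genus two is present only through its actions: any set on which
    the letters of both copies act in such a way that the two commutators act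
    alike. *)
Theorem genus2_faithful w a : word2mx w = a%:M -> forall z, run2 w z = z.
Proof.
have [u [L [altL pL rL]]] := syllable_form w; move=> wa z.
have := propto_sym pL; rewrite wa; case: L altL pL rL => [|x L] altL pL rL pa; last first.
  by case: (syllmx_not_scalar altL _ pa).
rewrite rL /=; move: pa; rewrite /= mulmx1 => /propto_scalar[e1 e2 e3].
rewrite -(run_red (actK false)) (@wordmx_scalar _ two_neq0 u (W u 0 0)) //.
have inj (p q : {poly F}) : p%:P = q%:P -> p = q by exact: polyC_inj.
apply: mx2P; rewrite [RHS]mxE ?mulr1n ?mulr0n //; apply: inj.
- by move: e1; rewrite mxE => ->.
- by move: e2; rewrite mxE => ->.
- by move: e3; rewrite !mxE => ->.
Qed.

End GenusTwo.

End GenusTwoRepresentation.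
Export GenusTwoRepresentation.

(** * Cyclic covers and higher genus *)

Module HigherGenus.
Set Implicit Arguments.
Unset Strict Implicit.
Unset Printing Implicit Defensive.
Import GRing.Theory.
Local Open Scope group_scope.

Definition comm_g (G : groupType) (x y : G) : G := x * y * x^-1 * y^-1.

Lemma comm_gV (G : groupType) (x y : G) : (comm_g x y)^-1 = comm_g y x.
Proof. by rewrite /comm_g !invgM !invgK !mulgA. Qed.

(** With the orientation of the side pairings, the k-th four sides of the polygon
    read X k (Y k)^-1 (X k)^-1 Y k around a vertex. *)
Definition surface_relator (G : groupType) (g : nat) (X Y : nat -> G) : G :=
  \prod_(0 <= k < g) comm_g (X k) (Y k)^-1.

Section CyclicCover.
Variables (G : groupType) (a b d : G).
Hypothesis d_comm : d * comm_g a b = comm_g a b * d.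

Let bT := d * b * d^-1.
Let aT := d * a * d^-1.

Lemma comm_conj_d : comm_g aT bT = comm_g a b.
Proof.
rewrite -[RHS](mulgK d) -d_comm /comm_g /aT /bT !invgM !invgK !mulgA.
by rewrite !mulgVK.
Qed.

(** The standard generators of the kernel of the map to the cyclic group of order
    m + 1, in the group generated by a, b and their conjugates by d. *)
Definition coverX m k : G := if k is i.+1 then a ^+ i * bT * a ^- i else a ^+ m.+1.
Definition coverY k : G := if k is i.+1 then (a ^+ i * aT * a ^- i)^-1 else b^-1.

Lemma comm_g_conj (x y z : G) : comm_g (z * x * z^-1) (z * y * z^-1) = z * comm_g x y * z^-1.
Proof. by rewrite /comm_g !invgM !invgK !mulgA !mulgVK. Qed.

(** The commutators of the conjugated generators are
    (a ^ i b a ^ -i) (a ^ i.+1 b a ^ -i.+1)^-1, and their product telescopes. *)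
Lemma cover_relator m : surface_relator m.+2 (coverX m) coverY = 1.
Proof.
rewrite /surface_relator big_nat_recl //= invgK.
have step n : \prod_(0 <= k < n) comm_g (coverX m k.+1) (coverY k.+1)^-1 =
    b * (a ^+ n * b * a ^- n)^-1.
  elim: n => [|n IH]; first by rewrite big_nil expg0 invg1 mulg1 mul1g mulgV.
  rewrite big_nat_recr //= IH invgK comm_g_conj -[comm_g bT aT]comm_gV comm_conj_d comm_gV.
  rewrite /comm_g !invgM !invgK !mulgA !mulgVK expgSr !invgM.
  by rewrite !mulgA.
by rewrite step /comm_g !invgM invgK !mulgA !mulgVK mulgK mulgV.
Qed.

End CyclicCover.

Section Faithful.
Variables (F K : fieldType) (phi : {rmorphism {poly {poly F}} -> K}).
Hypotheses (two_neq0 : (2 != 0 :> F)%R) (phi_inj : injective phi).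
Variables (G : groupType) (mu : G -> 'M[K]_2).
Hypotheses (mu1 : mu 1 = (1%:M)%R) (muM : forall x y, mu (x * y) = (mu x *m mu y)%R).
Variables (a b d : G).
Hypotheses (mu_a : mu a = map_mx phi (liftT (mxa F)))
           (mu_b : mu b = map_mx phi (liftT (mxb F)))
           (mu_d : mu d = (mx2 (phi 'X) 0 0 1)%R).
Hypothesis mu_inj : injective mu.

Definition sgn_inv (T : groupType) (s : bool) (x : T) : T := if s then x^-1 else x.

Definition letter_g (s : bool) (l : letter) : G :=
  let x := if l.1 then b else a in
  sgn_inv l.2 (if s then d * x * d^-1 else x).

Definition word_g (w : seq (bool * letter)) : G :=
  foldr (fun x => *%g (letter_g x.1 x.2)) 1 w.

Lemma muV x : (mu x *m mu x^-1 = 1%:M)%R.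
Proof. by rewrite -muM mulgV mu1. Qed.

Lemma det2_mu x : det2 (mu x) != 0%R.
Proof.
apply/eqP => x0; have /eqP := congr1 (@det2 _) (muV x).
by rewrite det2M x0 mul0r det2_scalar expr1n eq_sym oner_eq0.
Qed.

Lemma propto_mu_inv x : propto (mu x^-1) (adj2 (mu x)).
Proof.
exists (det2 (mu x)), 1%R; split; rewrite ?det2_mu ?oner_neq0 // scale1r.
rewrite -mul_scalar_mx -det2_adj -mulmx_adj2 adj2K -mulmxA muV mulmx1.
by [].
Qed.

Local Notation Phi := (map_mx phi).

Lemma map_adj2 (M : 'M[{poly {poly F}}]_2) : Phi (adj2 M) = adj2 (Phi M).
Proof. by apply: mx2P; rewrite !mxE //= rmorphN. Qed.

Lemma propto_letter s l : propto (mu (letter_g s l)) (Phi (sidemx s (lettermx F l))).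
Proof.
have base e (x : G) (M : 'M[{poly F}]_2) : mu x = Phi (liftT M) ->
    propto (mu (sgn_inv e x)) (Phi (liftT (if e then adj2 M else M))).
  case: e => /= xM; last by rewrite xM; exact: propto_refl.
  apply: propto_trans (propto_mu_inv _) _; rewrite xM -map_adj2.
  rewrite (_ : adj2 (liftT M) = liftT (adj2 M)); first exact: propto_refl.
  by apply: mx2P; rewrite !mxE //= rmorphN.
have b0 : propto (mu (sgn_inv l.2 (if l.1 then b else a))) (Phi (liftT (lettermx F l))).
  rewrite /lettermx; case: l.1; [exact: base mu_b|exact: base mu_a].
rewrite /letter_g; case: s; last exact: b0.
have -> : sgn_inv l.2 (d * (if l.1 then b else a) * d^-1) =
    d * sgn_inv l.2 (if l.1 then b else a) * d^-1.
  by case: l.2; rewrite //= !invgM invgK !mulgA.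
rewrite !muM; set N := lettermx F l in b0 *.
pose D : 'M[{poly {poly F}}]_2 := mx2 'X 0 0 1.
have -> : sidemx true N = (D *m liftT N *m adj2 D)%R.
  by apply: mx2P; rewrite !(mulmx2E, mxE) /=; ring.
have muD : mu d = Phi D.
  by rewrite mu_d; apply: mx2P; rewrite !mxE /= ?rmorph0 ?rmorph1.
rewrite !map_mxM; apply: proptoM; first by apply: proptoM; rewrite // -muD; exact: propto_refl.
by rewrite map_adj2 -muD; exact: propto_mu_inv.
Qed.

Lemma propto_word w : propto (mu (word_g w)) (Phi (word2mx F w)).
Proof.
elim: w => [|[s l] w IH] /=; first by rewrite mu1 map_mx1; exact: propto_refl.
by rewrite muM map_mxM; apply: proptoM => //; exact: propto_letter.
Qed.

(** d is diagonal, and so is the commutator of a and b. *)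
Lemma d_comm : d * comm_g a b = comm_g a b * d.
Proof.
have := propto_word [seq (false, l) | l <- comm false].
have -> : word_g [seq (false, l) | l <- comm false] = comm_g a b.
  by rewrite /word_g /letter_g /comm_g /= mulg1 !mulgA.
have -> : word2mx F [seq (false, l) | l <- comm false] = liftT (wordmx F (comm false)).
  by rewrite /word2mx /wordmx /= !liftTM [liftT 1%:M]map_mx1.
move=> [k [l [k0 l0 /matrixP e]]]; have [e1 e2] := comm_diag F.
have c01 : mu (comm_g a b) 0%R 1%R = 0%R.
  apply: (mulfI k0); have := e 0%R 1%R; rewrite mxE [RHS]mxE => ->.
  rewrite [map_mx _ _ _ _]mxE [liftT _ _ _]mxE.
  by move: e2; rewrite /fixes_e2 => ->; rewrite !rmorph0 !mulr0.
have c10 : mu (comm_g a b) 1%R 0%R = 0%R.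
  apply: (mulfI k0); have := e 1%R 0%R; rewrite mxE [RHS]mxE => ->.
  rewrite [map_mx _ _ _ _]mxE [liftT _ _ _]mxE.
  by move: e1; rewrite /fixes_e1 => ->; rewrite !rmorph0 !mulr0.
apply: mu_inj; rewrite muM [RHS]muM mu_d; apply: mx2P; rewrite !mulmx2E ?c01 ?c10 !mxE /=; ring.
Qed.

Variables (m : nat) (Gam : groupType) (X Y : nat -> Gam).
Hypothesis relX : surface_relator m.+2 X Y = 1.
Hypothesis genX : forall P : Gam -> Prop, P 1 ->
  (forall x y, P x -> P y -> P (x * y)) -> (forall x, P x -> P x^-1) ->
  (forall k, (k < m.+2)%N -> P (X k) /\ P (Y k)) -> forall x, P x.
Variable rho : Gam -> G.
Hypothesis rhoM : {morph rho : x y / x * y}.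
Hypothesis rhoX : forall k, (k < m.+2)%N -> rho (X k) = coverX a b d m k.
Hypothesis rhoY : forall k, (k < m.+2)%N -> rho (Y k) = coverY a b d k.

Lemma rho1 : rho 1 = 1.
Proof. by apply: (mulIg (rho 1)); rewrite -rhoM !mul1g. Qed.

Lemma rhoV x : rho x^-1 = (rho x)^-1.
Proof. by apply/esym/mulg1_eq; rewrite -rhoM mulgV rho1. Qed.

(** The element of Gam that stands for a ^ i b a ^ -i. *)
Fixpoint sheetY i : Gam :=
  if i is j.+1 then comm_g (Y j.+1)^-1 (X j.+1) * sheetY j else (Y 0)^-1.

(** This is where the relation of Gam is used: going once around the cover amounts
    to conjugation by X 0, which stands for a ^ m.+1. *)
Lemma sheetY_wrap : sheetY m.+1 = X 0 * sheetY 0 * (X 0)^-1.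
Proof.
have E n : \prod_(0 <= k < n) comm_g (X k.+1) (Y k.+1)^-1 = (sheetY 0) * (sheetY n)^-1.
  elim: n => [|n IH]; first by rewrite big_nil mulgV.
  by rewrite big_nat_recr //= IH invgM comm_gV !mulgA.
move: relX; rewrite /surface_relator big_nat_recl // E /comm_g [sheetY 0]/= !mulgA.
by rewrite mulgVK => /divg1_eq.
Qed.

Lemma rho_sheetY i : (i <= m.+1)%N -> rho (sheetY i) = a ^+ i * b * a ^- i.
Proof.
elim: i => [|i IH] im /=.
  by rewrite rhoV rhoY // /coverY invgK expg0 invg1 mulg1 mul1g.
rewrite rhoM IH; last exact: ltnW.
have -> : rho (comm_g (Y i.+1)^-1 (X i.+1)) = a ^+ i * comm_g a b * a ^- i.
  rewrite /comm_g !rhoM !rhoV rhoX // rhoY // -/(comm_g _ _) /= invgK.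
  by rewrite -/(comm_g _ _) comm_g_conj (comm_conj_d d_comm).
by rewrite /comm_g !mulgA !mulgVK expgSr invgM !mulgA.
Qed.

(** The pair (x, i) stands for the element a ^ -i x; the letters act by
    multiplication on the left, the first component changing by a Schreier
    generator of the kernel. *)
Definition cover_act (s : bool) (l : letter) (z : Gam * 'I_m.+1) : Gam * 'I_m.+1 :=
  match s, l with
  | true, (h, e) => (sgn_inv e (if h then X z.2.+1 else (Y z.2.+1)^-1) * z.1, z.2)
  | false, (true, e) => (sgn_inv e (sheetY z.2) * z.1, z.2)
  | false, (false, false) => (if z.2 == ord0 then X 0 * z.1 else z.1, ord_pred z.2)
  | false, (false, true) =>
      (if ordS z.2 == ord0 then (X 0)^-1 * z.1 else z.1, ordS z.2)
  end.

Lemma cover_actK s l : cancel (cover_act s l) (cover_act s (linv l)).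
Proof.
  have sK (T : groupType) e (x : T) : cancel ( *%g (sgn_inv e x)) ( *%g (sgn_inv (~~ e) x)).
  by case: e => y /=; rewrite (mulKg, mulVKg).
move=> [x i]; case: s l => [] [[] e] /=; rewrite ?sK //.
case: e => /=; rewrite ?ordSK ?ord_predK.
  by case: eqP => _; rewrite ?mulVKg.
by case: eqP => _; rewrite ?mulKg.
Qed.

Lemma ordS_val (i : 'I_m.+1) : ordS i = (if i == m :> nat then 0 else i.+1) :> nat.
Proof.
rewrite /=; case: eqP => [->|im]; first by rewrite modnn.
by rewrite modn_small // ltnS ltn_neqAle -ltnS ltn_ord andbT; apply/eqP.
Qed.

Lemma cover_act_comm z : run (cover_act false) (comm false) z =
  run (cover_act true) (comm false) z.
Proof.
case: z => x i; rewrite /= ordSK; congr (_, _).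
have := ordS_val i; case: eqP => [im|_] iS.
  have -> : ordS i == ord0 by apply/eqP/val_inj.
  rewrite [_ %% _]iS im; have := congr1 (fun y => y * ((sheetY m)^-1 * x)) sheetY_wrap.
  by rewrite [sheetY m.+1]/= /comm_g -!mulgA mulVKg.
have -> : (ordS i == ord0) = false by apply/eqP => i0; move: iS; rewrite i0.
by rewrite [_ %% _]iS /= /comm_g -!mulgA mulVKg.
Qed.

(** The matrix of the element that a pair stands for. *)
Definition frame (z : Gam * 'I_m.+1) : G := a ^- z.2 * rho z.1.

Lemma frame_act s l z : frame (cover_act s l z) = letter_g s l * frame z.
Proof.
have K1 i (x : G) e : sgn_inv e (a ^+ i * x * a ^- i) = a ^+ i * sgn_inv e x * a ^- i.
  by case: e; rewrite //= !invgM invgK !mulgA.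
have rs e (x : Gam) : rho (sgn_inv e x) = sgn_inv e (rho x).
  by case: e => //=; rewrite rhoV.
case: z => x i; rewrite /frame /letter_g.
case: s l => [] [h e] /=.
  rewrite rhoM rs; have -> : rho (if h then X i.+1 else (Y i.+1)^-1) =
      a ^+ i * (d * (if h then b else a) * d^-1) * a ^- i.
    by case: h; rewrite ?rhoV ?rhoX ?rhoY ?ltnS ?leq_ord //= ?invgK.
  by rewrite K1 !mulgA mulVg mul1g.
case: h => /=.
  rewrite rhoM rs rho_sheetY; last exact: ltnW.
  by rewrite K1 !mulgA mulVg mul1g.
have step (u : Gam * 'I_m.+1) : frame (cover_act false (false, true) u) = a^-1 * frame u.
  case: u => {}x {}i; rewrite /frame /=.
  have := ordS_val i; case: eqP => [im|_] iS.
    have -> : ordS i == ord0 by apply/eqP/val_inj.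
    rewrite [_ %% _]iS im rhoM rhoV rhoX //= invg1 mul1g.
    by rewrite expgSr !invgM !mulgA.
  have -> : (ordS i == ord0) = false by apply/eqP => i0; move: iS; rewrite i0.
  by rewrite [_ %% _]iS expgSr invgM mulgA.
case: e; first exact: (step (x, i)).
change (frame (cover_act false (false, false) (x, i)) = a * frame (x, i)).
have := step (cover_act false (false, false) (x, i)).
have := cover_actK false (false, false) (x, i); rewrite [linv _]/= => -> ->.
by rewrite mulVKg.
Qed.

Lemma frame_run w z : frame (run2 cover_act w z) = word_g w * frame z.
Proof.
elim: w => [|[s l] w IH] /=; first by rewrite mul1g.
by rewrite frame_act IH mulgA.
Qed.

Lemma run2_cat u v z : run2 cover_act (u ++ v) z = run2 cover_act u (run2 cover_act v z).
Proof. by rewrite /run2 foldr_cat. Qed.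

Definition winv2 (w : seq (bool * letter)) := rev [seq (x.1, linv x.2) | x <- w].

Lemma run2_winv w z : run2 cover_act (winv2 w) (run2 cover_act w z) = z.
Proof.
elim: w z => //= -[s l] w IH z.
by rewrite /winv2 /= rev_cons -cats1 run2_cat /= cover_actK IH.
Qed.

Lemma run2_nseq_up i x : (i <= m)%N ->
  run2 cover_act (nseq i (false, (false, true))) (x, ord0) = (x, inord i).
Proof.
elim: i => [|i IH] im /=; first by congr (_, _); apply: val_inj; rewrite /= inordK.
have iS : ordS (inord i : 'I_m.+1) = inord i.+1.
  by apply: val_inj; rewrite /= !inordK ?modn_small // ltnW.
rewrite IH ?(ltnW im) //= iS ifF //.
by apply/eqP => /(congr1 val); rewrite /= inordK.
Qed.

Lemma run2_nseq_down i x : (i <= m)%N ->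
  run2 cover_act (nseq i (false, (false, false))) (x, inord i) = (x, ord0).
Proof.
move=> im; rewrite -(run2_nseq_up x im) -[RHS](run2_winv (nseq i (false, (false, true)))).
by congr (run2 _ _ _); rewrite /winv2 map_nseq rev_nseq.
Qed.

Lemma word_of_element x : exists w, forall y, run2 cover_act w (y, ord0) = (x * y, ord0).
Proof.
move: x; apply: genX.
- by exists [::] => y; rewrite mul1g.
- by move=> x x' [w wE] [w' wE']; exists (w ++ w') => y; rewrite run2_cat wE' wE mulgA.
- move=> x [w wE]; exists (winv2 w) => y.
  by have := run2_winv w (x^-1 * y, ord0); rewrite wE mulVKg.
have leaf k (h : bool) : (k <= m)%N -> exists w, forall y,
    run2 cover_act w (y, ord0) = ((if h then X k.+1 else (Y k.+1)^-1) * y, ord0).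
  move=> km; exists (nseq k (false, (false, false)) ++ (true, (h, false)) ::
      nseq k (false, (false, true))) => y.
  by rewrite run2_cat /= run2_nseq_up //= run2_nseq_down // inordK.
move=> [|k] km; split.
- exists (nseq m.+1 (false, (false, false))) => y.
  rewrite (_ : nseq _ _ = nseq m (false, (false, false)) ++ [:: (false, (false, false))]);
    last by rewrite -(nseqD m 1) addn1.
  rewrite run2_cat /=.
  have -> : ord_pred ord0 = inord m :> 'I_m.+1.
    by apply: val_inj; rewrite /= inordK // modn_small.
  exact: run2_nseq_down.
- by exists [:: (false, (true, true))] => y /=; rewrite invgK.
- exact: (leaf k true).
- have [w wE] := leaf k false km; exists (winv2 w) => y.
  by have := run2_winv w (Y k.+1 * y, ord0); rewrite wE mulKg.
Qed.

(** Some word multiplies the sheet 0 by x; if rho x = 1, the matrix of this word is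
    scalar, and the word acts trivially. *)
Theorem rho_faithful x : rho x = 1 -> x = 1.
Proof.
move=> x1; have [w wE] := word_of_element x.
have wg : word_g w = 1.
  have := frame_run w (1, ord0); rewrite wE /frame /= invg1 !mul1g mulg1 x1 rho1.
  by rewrite mulg1.
have := propto_sym (propto_word w); rewrite wg mu1 => /propto_scalar.
rewrite !mxE => -[e01 e10 e00].
have wE' : word2mx F w = ((word2mx F w 0 0)%:M)%R.
  have z q : phi q = 0%R -> q = 0%R by move=> q0; apply: phi_inj; rewrite q0 rmorph0.
  by apply: mx2P; rewrite [RHS]mxE ?mulr1n ?mulr0n //; [exact: z|exact: z|apply/esym/phi_inj].
have := genus2_faithful two_neq0 cover_actK cover_act_comm wE' (1, ord0).
by rewrite wE mulg1 => -[].
Qed.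

End Faithful.

End HigherGenus.
Export HigherGenus.

(** * Polynomials in two algebraically independent elements *)

Module TwoVariables.
From mathcomp Require Import mpoly.
From mathcomp Require Import classical_sets.
Import GRing.Theory.
Local Open Scope ring_scope.
Set Implicit Arguments. Unset Strict Implicit. Unset Printing Implicit Defensive.

Section PrimeField.
Variables (p : nat) (K : fieldType) (p_prime : prime p) (K_char : p \in [pchar K]).

Lemma Fp_natr_zmod : zmod_morphism (fun c : 'F_p => (c : nat)%:R : K).
Proof.
have D (x y : 'F_p) : ((x + y)%R : nat)%:R = (x : nat)%:R + (y : nat)%:R :> K.
  by rewrite /= [X in (_ %% X)%N]Fp_cast // GRing.natr_mod_pchar // natrD.
by move=> x y; apply/eqP; rewrite eq_sym subr_eq -D subrK.
Qed.

Lemma Fp_natr_monoid : monoid_morphism (fun c : 'F_p => (c : nat)%:R : K).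
Proof.
split=> [|x y].
  by have := GRing.natr_mod_pchar K_char 1; rewrite -{1}(Fp_cast p_prime).
by rewrite /= [X in (_ %% X)%N]Fp_cast // GRing.natr_mod_pchar // natrM.
Qed.

Lemma Fp_rmorphism : exists iota : {rmorphism 'F_p -> K}, forall c, iota c = (c : nat)%:R.
Proof.
pose f := fun c : 'F_p => (c : nat)%:R : K.
pose f1 := GRing.isZmodMorphism.Build _ _ f Fp_natr_zmod.
pose f2 := GRing.isMonoidMorphism.Build _ _ f Fp_natr_monoid.
pose iota : {rmorphism 'F_p -> K} := HB.pack f f1 f2.
by exists iota.
Qed.

End PrimeField.

Section Embedding.
Variables (p : nat) (K : fieldType) (p_prime : prime p) (K_char : p \in [pchar K]).
Variables (B : set K) (B_indep : alg_indep p B).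
Variable b : 'I_2 -> K.
Hypotheses (b_inj : injective b) (bB : forall i, B (b i)).

Definition bidegree (i j : nat) : 'X_{1..2} := [multinom if (k : nat) == 0%N then i else j | k < 2].

Definition flatten_poly (P : {poly {poly 'F_p}}) : {mpoly 'F_p[2]} :=
  \sum_(j < size P) \sum_(i < size P`_j) P`_j`_i *: 'X_[bidegree i j].

Lemma bidegree_inj i j k l : (bidegree i j == bidegree k l) = ((i == k) && (j == l)).
Proof.
apply/eqP/andP => [/mnmP e|[/eqP -> /eqP ->] //].
by have := e 0; have := e 1; rewrite !mnmE /= => -> ->.
Qed.

Lemma coef_flatten_poly P i j : (flatten_poly P)@_(bidegree i j) = P`_j`_i.
Proof.
rewrite linear_sum /=; have [jP|jP] := ltnP j (size P); last first.
  rewrite big1 => [|k _]; first by rewrite (nth_default _ jP) coef0.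
  rewrite linear_sum big1 //= => l _; rewrite mcoeffZ mcoeffX bidegree_inj.
  rewrite [(k : nat) == j]ltn_eqF ?andbF ?mulr0 //; exact: leq_trans (ltn_ord k) jP.
rewrite (bigD1 (Ordinal jP)) //= [X in _ + X]big1 ?addr0 => [|k kj]; last first.
  rewrite linear_sum big1 //= => l _; rewrite mcoeffZ mcoeffX bidegree_inj.
  by rewrite [(k : nat) == j](negbTE kj) andbF mulr0.
rewrite linear_sum /=; have [iP|iP] := ltnP i (size P`_j); last first.
  rewrite big1 => [|k _]; first by rewrite (nth_default _ iP).
  rewrite mcoeffZ mcoeffX bidegree_inj.
  rewrite [(k : nat) == i]ltn_eqF ?andbF ?mulr0 //; exact: leq_trans (ltn_ord k) iP.
rewrite (bigD1 (Ordinal iP)) //= [X in _ + X]big1 ?addr0 => [|k ki].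
  by rewrite mcoeffZ mcoeffX eqxx mulr1.
by rewrite mcoeffZ mcoeffX bidegree_inj [(k : nat) == i](negbTE ki) mulr0.
Qed.

(** The evaluation at b: the polynomial in two variables with the same coefficients
    has the same value, so injectivity is algebraic independence. *)
Lemma polynomial_embedding : exists phi : {rmorphism {poly {poly 'F_p}} -> K}, injective phi.
Proof.
have [iota iotaE] := Fp_rmorphism p_prime K_char.
have c0 : commr_rmorph iota (b 0) by move=> x; exact: mulrC.
pose phi0 : {rmorphism {poly 'F_p} -> K} := horner_morph c0.
have c1 : commr_rmorph phi0 (b 1) by move=> x; exact: mulrC.
pose phi : {rmorphism {poly {poly 'F_p}} -> K} := horner_morph c1.
exists phi; apply/raddf_inj => P P0.
suff Q0 : flatten_poly P = 0.
  by apply/polyP => j; apply/polyP => i; rewrite -coef_flatten_poly Q0 mcoeff0 !coef0.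
apply: (B_indep b_inj bB).
have -> : mmap (fun c : 'F_p => (c : nat)%:R : K) b (flatten_poly P) =
    mmap iota b (flatten_poly P).
  by apply: eq_bigr => m _; rewrite iotaE.
rewrite -P0 /phi /= /horner_morph /map_poly horner_poly raddf_sum /=.
apply: eq_bigr => j _; rewrite /phi0 /= /horner_morph /map_poly horner_poly raddf_sum /=.
rewrite mulr_suml; apply: eq_bigr => i _.
rewrite mmapZ mmapX /mmap1 !big_ord_recl big_ord0 mulr1 -mulrA !mnmE /=.
by rewrite (_ : lift ord0 ord0 = 1) //; apply: val_inj.
Qed.

End Embedding.
End TwoVariables.
Export TwoVariables.

From mathcomp Require Import all_classical all_reals all_analysis.
From mathcomp Require Import homotopy complex lra.
From Stdlib Require Relation_Operators.

Module SurfaceTopology.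
Set Implicit Arguments.
Unset Strict Implicit.
Unset Printing Implicit Defensive.
Import Order.TTheory GRing.Theory Num.Theory numFieldNormedType.Exports.
Local Open Scope classical_set_scope.
Local Open Scope ring_scope.

(** * Paths *)

(** A property of intervals that holds for all small intervals around each point
    and passes to unions of adjacent intervals holds for the whole interval; this
    replaces subdivisions and Lebesgue numbers below. *)
Lemma interval_induction (R : realType) (lo hi : R) (P : R -> R -> Prop) :
  lo <= hi ->
  (forall a b c, lo <= a -> a <= b -> b <= c -> c <= hi -> P a b -> P b c -> P a c) ->
  (forall t, lo <= t <= hi -> exists2 d, 0 < d & forall a b, lo <= a -> a <= t ->
     t <= b -> b <= hi -> t - d < a -> b < t + d -> P a b) ->
  P lo hi.
Proof.
move=> lohi glue local.
pose S := [set t | lo <= t <= hi /\ P lo t].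
have Slo : S lo.
  split; first by rewrite lexx.
  have [|d d0 dP] := local lo; first by rewrite lexx.
  by apply: dP; rewrite ?lexx //; lra.
have Ssup : has_sup S.
  by split; [exists lo|exists hi => t [/andP[]]].
have lo_le : lo <= sup S by exact: (ub_le_sup (proj2 Ssup)).
have le_hi : sup S <= hi by apply: ge_sup; [exists lo|move=> t [/andP[]]].
have [|d d0 dP] := local (sup S); first by rewrite lo_le.
have [t St tS] := sup_adherent d0 Ssup.
have tle : t <= sup S by exact: (ub_le_sup (proj2 Ssup)).
have Pb b : sup S <= b -> b <= hi -> b < sup S + d -> P lo b.
  move=> sb bh bd; case: St => /andP[lt th] Pt.
  apply: (glue _ t) => //; first by lra.
  by apply: dP => //.
have [sh|sh] := ltP (sup S) hi; last by apply: Pb => //; lra.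
pose b := Num.min hi (sup S + d / 2).
have bS : S b.
  rewrite /b; split; first by rewrite ge_min lexx le_min lohi /=; lra.
  apply: Pb; rewrite ?le_min ?ge_min ?gt_min ?lexx //.
    by rewrite (ltW sh) /=; lra.
  by apply/orP; right; lra.
have := ub_le_sup (proj2 Ssup) bS; rewrite /b ge_min leNgt sh /=; lra.
Qed.

Section Paths.
Context (R : realType) (X : topologicalType).
Local Notation I := (unitI R).

Section PathOf.
Context (x y : X) (f : I -> X).

(** The proofs are arguments so that they can be attached to f as structures. *)
Definition path_of (cf : continuous f) (f0 : f zero = x) (f1 : f one = y) : I -> X := f.

HB.instance Definition _ cf f0 f1 :=
  isContinuous.Build I X (@path_of cf f0 f1) cf.
HB.instance Definition _ cf f0 f1 :=
  isPath.Build I X x y (@path_of cf f0 f1) f0 f1.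
End PathOf.

Lemma continuous_within_comp (E Y : topologicalType) (D : set E) (psi : E -> X) (w : Y -> E) :
  {within D, continuous psi} -> continuous w -> (forall y, D (w y)) ->
  continuous (psi \o w).
Proof.
move=> cpsi cw Dw y; move/subspace_continuousP : cpsi => /(_ _ (Dw y)) cy.
apply: cvg_trans cy => A /= A1.
have := cw y _ A1; rewrite /nbhs /=; apply: filterS => z /=.
by apply; exact: Dw.
Qed.

(** The linear homotopy, with the convex combinations given by [mix], so that it
    applies to the plane as well as to the complex numbers. *)
Lemma convex_homotopic (E : topologicalType) (D : set E) (psi : E -> X)
    (mix : E -> E -> R -> E) (x y : X) (p1 p2 : {path I from x to y in X})
    (w1 w2 : I -> E) :
  {within D, continuous psi} ->
  continuous (fun z : (E * E) * R => mix z.1.1 z.1.2 z.2) ->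
  (forall u v, mix u v 0 = u) -> (forall u v, mix u v 1 = v) ->
  (forall u s, mix u u s = u) ->
  (forall u v s, D u -> D v -> 0 <= s <= 1 -> D (mix u v s)) ->
  continuous w1 -> continuous w2 -> (forall t, D (w1 t)) -> (forall t, D (w2 t)) ->
  w1 zero = w2 zero -> w1 one = w2 one ->
  (forall t, p1 t = psi (w1 t)) -> (forall t, p2 t = psi (w2 t)) ->
  path_homotopic p1 p2.
Proof.
move=> cpsi cmix mix0 mix1 mixx Dmix c1 c2 D1 D2 e0 e1 p1E p2E.
exists (fun z => psi (mix (w1 z.1) (w2 z.1) (uval z.2))); split.
- apply: (@continuous_within_comp _ _ D) => //; last first.
    by move=> z; apply: Dmix => //; rewrite uval_ge0 uval_le1.
  move=> z; apply: (@continuous_comp _ _ _ (fun z : I * I => ((w1 z.1, w2 z.1), uval z.2))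
     (fun z : (E * E) * R => mix z.1.1 z.1.2 z.2)); last exact: cmix.
  move: z; apply: continuous_pair_with; last exact: continuous_uval_snd.
  by apply: continuous_pair_with => z; apply: continuous_comp;
    try exact: cvg_fst; [exact: c1|exact: c2].
- by move=> t; rewrite uval0 mix0 p1E.
- by move=> t; rewrite uval1 mix1 p2E.
- by move=> s; rewrite e0 mixx -e0 -p1E path_zero.
- by move=> s; rewrite e1 mixx -e1 -p1E path_one.
Qed.

End Paths.

(** * Holonomy of a locally defined cocycle *)

Section Holonomy.
Context (R : realType) (X : topologicalType) (G : groupType).
Variables (tau : X -> X -> G) (N : X -> set X).
Hypothesis nbhsN : forall x, nbhs x (N x).
Hypothesis tau1 : forall x, tau x x = 1%g.
Hypothesis tauM : forall x u, N x u -> \forall v \near u, tau x v = (tau x u * tau u v)%g.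

(** [tau x u] is the transport from x to a nearby point u in coordinates attached
    to x.  A flat section A over the map h is a lift of h to the covering of X
    with group G defined by tau; it is determined by one of its values on each
    path, and transport along a path is the change of A. *)
Definition flat_on (E : topologicalType) (S : set E) (h : E -> X) (A : E -> G) :=
  forall y, S y -> \forall y' \near y, S y' -> A y' = (A y * tau (h y) (h y'))%g.

Lemma flat_on_comp (E E' : topologicalType) (S : set E) (S' : set E') h A (k : E' -> E) :
  continuous k -> (forall y, S' y -> S (k y)) -> flat_on S h A ->
  flat_on S' (h \o k) (A \o k).
Proof.
move=> ck kS fA y Sy; have := ck y _ (fA _ (kS _ Sy)).
rewrite /nbhs /=; apply: filterS => y' /= AE Sy'; apply: AE; exact: kS.
Qed.

Lemma eq_flat_on (E : topologicalType) (S : set E) h h' A : (forall y, S y -> h y = h' y) ->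
  flat_on S h A -> flat_on S h' A.
Proof.
move=> hh' fA y Sy; apply: filterS (fA _ Sy) => y' Ey Sy'.
by rewrite -!hh' //; exact: Ey.
Qed.

Lemma flat_on_mul (E : topologicalType) (S : set E) h A c : flat_on S h A ->
  flat_on S h (fun y => c * A y)%g.
Proof.
move=> fA y Sy; apply: filterS (fA _ Sy) => y' Ey Sy'.
by rewrite -mulgA -Ey.
Qed.

Lemma flat_on_local (E : topologicalType) (S : set E) h x : continuous h ->
  (forall y, S y -> N x (h y)) -> flat_on S h (tau x \o h).
Proof.
move=> ch SN y Sy; have := ch y _ (tauM (SN _ Sy)).
by rewrite /nbhs /=; apply: filterS => y' /= -> _.
Qed.

Lemma flat_on_glue (E : topologicalType) (S1 S2 : set E) h A1 A2 :
  closed S1 -> closed S2 -> flat_on S1 h A1 -> flat_on S2 h A2 ->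
  (forall y, S1 y -> S2 y -> A1 y = A2 y) ->
  flat_on (S1 `|` S2) h (fun y => if pselect (S1 y) then A1 y else A2 y).
Proof.
move=> cl1 cl2 f1 f2 e12 y Sy.
have out (S : set E) : closed S -> ~ S y -> \forall y' \near y, ~ S y'.
  by move=> clS nS; apply: open_nbhs_nbhs; split => //; exact: closed_openC.
have in1 : S1 y -> \forall y' \near y, S1 y' -> A1 y' = (A1 y * tau (h y) (h y'))%g.
  exact: f1.
have in2 : S2 y -> \forall y' \near y, S2 y' -> A2 y' = (A2 y * tau (h y) (h y'))%g.
  exact: f2.
case: pselect => /= [S1y|nS1y].
  have [S2y|nS2y] := pselect (S2 y).
    apply: filterS2 (in1 S1y) (in2 S2y) => y' E1 E2 Sy'.
    case: pselect => /= [|nS1y']; first exact: E1.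
    by case: Sy' => [/nS1y' []|/E2 ->]; rewrite e12.
  apply: filterS2 (in1 S1y) (out _ cl2 nS2y) => y' E1 nS2y' Sy'.
  have S1y' : S1 y' by case: Sy'.
  by case: pselect => //= _; exact: E1.
have S2y : S2 y by case: Sy.
apply: filterS2 (in2 S2y) (out _ cl1 nS1y) => y' E2 nS1y' Sy'.
case: pselect => //= _; apply: E2; by case: Sy'.
Qed.

(** The quotient of two flat sections is locally constant. *)
Lemma flat_on_unique (lo hi : R) h A1 A2 : lo <= hi ->
  flat_on [set r : R | lo <= r <= hi] h A1 -> flat_on [set r : R | lo <= r <= hi] h A2 ->
  (A1 lo * (A2 lo)^-1 = A1 hi * (A2 hi)^-1)%g.
Proof.
move=> lohi f1 f2.
apply: (@interval_induction _ lo hi (fun a b =>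
  A1 a * (A2 a)^-1 = A1 b * (A2 b)^-1)%g) => // [a b c _ _ _ _ -> -> //|t tI].
have [/= d d0 dP] : nbhs t [set r | lo <= r <= hi ->
    (A1 r * (A2 r)^-1 = A1 t * (A2 t)^-1)%g].
  apply: filterS2 (f1 _ tI) (f2 _ tI) => r E1 E2 rI.
  by rewrite E1 // E2 // invgM mulgA mulgK.
exists d => // a b la at_ tb bh ad bd.
rewrite (dP a) ?(dP b) //=; rewrite ?ltr_norml; lra.
Qed.

Definition rect (a b c d : R) : set (R * R) :=
  [set y | (a <= y.1 <= b) /\ (c <= y.2 <= d)].

Lemma closed_rect a b c d : closed (rect a b c d).
Proof.
have c1 : continuous (fun y : R * R => y.1) by move=> y; exact: cvg_fst.
have c2 : continuous (fun y : R * R => y.2) by move=> y; exact: cvg_snd.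
rewrite (_ : rect a b c d = fst @^-1` `[a, b] `&` snd @^-1` `[c, d]).
  by apply: closedI; apply: preimage_closed => //; exact: itv_closed.
by apply/seteqP; split => y; rewrite /rect /= !in_itv /=.
Qed.

Definition has_flat h a b c d := exists A, flat_on (rect a b c d) h A.

(** The section on the right is translated so as to agree with the left one at an
    end of the common edge; then they agree on the edge by uniqueness. *)
Lemma has_flat_glue1 h a b b' c d : a <= b -> b <= b' -> c <= d ->
  has_flat h a b c d -> has_flat h b b' c d -> has_flat h a b' c d.
Proof.
move=> ab bb' cd [A1 f1] [A2 f2].
pose A2' y := (A1 (b, c) * (A2 (b, c))^-1 * A2 y)%g.
have f2' : flat_on (rect b b' c d) h A2' by exact: flat_on_mul.
have agree y : rect a b c d y -> rect b b' c d y -> A1 y = A2' y.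
  case: y => y1 y2; rewrite /rect /= => -[/andP[ay yb] /andP[cy yd]] [/andP[by_ yb'] _].
  have {ay yb by_ yb'} -> : y1 = b by lra.
  have ck : continuous (fun s : R => (b, s)).
    by apply: continuous_pair_with => s; [exact: cvg_cst|exact: cvg_id].
  have g1 : flat_on [set s | c <= s <= y2] (h \o (fun s : R => (b, s))) (A1 \o (fun s : R => (b, s))).
    by apply: flat_on_comp f1 => // s /= sI; rewrite /rect /=; split; lra.
  have g2 : flat_on [set s | c <= s <= y2] (h \o (fun s : R => (b, s))) (A2' \o (fun s : R => (b, s))).
    by apply: flat_on_comp f2' => // s /= sI; rewrite /rect /=; split; lra.
  have /= := flat_on_unique cy g1 g2.
  by rewrite {1}/A2' mulgVK mulgV => /esym/divg1_eq.
have := flat_on_glue (@closed_rect a b c d) (@closed_rect b b' c d) f1 f2' agree.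
set A := fun _ => _ => fA; exists A => y Sy.
have inU z : rect a b' c d z -> (rect a b c d `|` rect b b' c d) z.
  rewrite /rect /= => -[/andP[az zb] zc]; have [zb'|zb'] := leP z.1 b; [left|right];
  by split => //; lra.
by apply: filterS (fA _ (inU _ Sy)) => y' Ey Sy'; apply: Ey; exact: inU.
Qed.

Definition swap_pair (y : R * R) : R * R := (y.2, y.1).

Lemma continuous_swap_pair : continuous swap_pair.
Proof. by apply: continuous_pair_with => y; [exact: cvg_snd|exact: cvg_fst]. Qed.

Lemma has_flat_swap h a b c d : has_flat h a b c d -> has_flat (h \o swap_pair) c d a b.
Proof.
move=> [A fA]; exists (A \o swap_pair); apply: flat_on_comp fA.
  exact: continuous_swap_pair.
by move=> [y1 y2]; rewrite /rect /= => -[].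
Qed.

Lemma has_flat_glue2 h a b c d d' : a <= b -> c <= d -> d <= d' ->
  has_flat h a b c d -> has_flat h a b d d' -> has_flat h a b c d'.
Proof.
move=> ab cd dd' /has_flat_swap f1 /has_flat_swap f2.
have /has_flat_swap := has_flat_glue1 cd dd' ab f1 f2.
by rewrite (_ : (_ \o _) \o _ = h) //; apply/funext => -[].
Qed.

(** Squares are built from small rectangles, first into strips, then into the
    whole. *)
Lemma flat_exists (h : R * R -> X) a b c d : a <= b -> c <= d -> continuous h ->
  has_flat h a b c d.
Proof.
move=> ab cd ch.
apply: (@interval_induction _ a b (fun a' b' => has_flat h a' b' c d)) => //.
  by move=> a' b' c' _ ? ? _; exact: has_flat_glue1.
move=> t tI.
pose strip c' d' := exists2 e, 0 < e & forall a' b', a' <= b' -> t - e < a' -> b' < t + e ->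
  has_flat h a' b' c' d'.
suff [e e0 eP] : strip c d.
  by exists e => // a' b' *; apply: eP => //; lra.
apply: (@interval_induction _ c d strip) => //.
  move=> c' d' d'' _ cd' dd' _ [e e0 eP] [e' e'0 e'P].
  exists (Num.min e e'); first by rewrite lt_min e0.
  move=> a' b' ab' lt_a lt_b.
  have mle : Num.min e e' <= e /\ Num.min e e' <= e'.
    by rewrite !ge_min !lexx orbT.
  by apply: (@has_flat_glue2 _ _ _ _ d') => //; [apply: eP|apply: e'P] => //; lra.
move=> s sI.
have [[/= U V] [/= [e1 e10 e1U] [e2 e20 e2V]] UV] : nbhs (t, s) (h @^-1` N (h (t, s))).
  exact: ch.
have e12 : Num.min e1 e2 <= e1 /\ Num.min e1 e2 <= e2 by rewrite !ge_min !lexx orbT.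
have e0 : 0 < Num.min e1 e2 by rewrite lt_min e10.
exists e2 => // c' d' _ cs sd _ lt_c lt_d; exists e1 => // a' b' ab' lt_a lt_b.
exists (tau (h (t, s)) \o h); apply: flat_on_local => // y.
rewrite /rect /= => -[/andP[? ?] /andP[? ?]].
apply: UV; split => /=; [apply: e1U|apply: e2V]; rewrite /= ltr_norml; lra.
Qed.

Local Notation I := (unitI R).

Definition flat_along (x y : X) (f : {path I from x to y in X}) (A : R -> G) :=
  flat_on [set r : R | 0 <= r <= 1] (f \o @clamp R) A.

Lemma flat_along_exists x y (f : {path I from x to y in X}) : exists A, flat_along f A.
Proof.
have [||//|A fA] := @flat_exists (fun z => f (clamp z.1)) 0 1 0 1.
- exact: ler01.
- exact: ler01.
- by apply: continuous_path_clamp => z; exact: cvg_fst.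
exists (A \o (fun t : R => (t, 0))).
have ck : continuous (fun t : R => (t, 0 : R)).
  by apply: continuous_pair_with => s; [exact: cvg_id|exact: cvg_cst].
apply: (flat_on_comp ck _ fA) => t /= tI.
by rewrite /rect /= tI lexx ler01.
Qed.

Definition hol x y (f : {path I from x to y in X}) : G :=
  let A := projT1 (cid (flat_along_exists f)) in ((A 0%R)^-1 * A 1%R)%g.

Lemma holE x y (f : {path I from x to y in X}) A :
  flat_along f A -> hol f = ((A 0%R)^-1 * A 1%R)%g.
Proof.
rewrite /hol; case: cid => /= A' fA' fA.
have := flat_on_unique ler01 fA' fA => e.
by rewrite -[A' 1%R](mulgVK (A 1)) -e !mulgA mulVg mul1g.
Qed.

Lemma hol_cat x y z (f : {path I from x to y in X}) (f' : {path I from y to z in X}) :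
  hol (path_cat f f') = (hol f * hol f')%g.
Proof.
have [A fA] := flat_along_exists (path_cat f f').
have half : continuous (fun r : R => 2^-1 * r + 0) by exact: continuous_affineR.
have half' : continuous (fun r : R => 2^-1 * r + 2^-1) by exact: continuous_affineR.
have f1 : flat_along f (A \o (fun r : R => 2^-1 * r + 0)).
  apply: eq_flat_on (flat_on_comp half _ fA) => r /= rI; last by lra.
  rewrite /path_cat clampK; last by lra.
  by rewrite ifT; [congr (f (clamp _)); lra|lra].
have f2 : flat_along f' (A \o (fun r : R => 2^-1 * r + 2^-1)).
  apply: eq_flat_on (flat_on_comp half' _ fA) => r /= rI; last by lra.
  rewrite /path_cat clampK; last by lra.
  case: ifPn => rle; last by congr (f' (clamp _)); lra.
  have -> : r = 0 by lra.
  rewrite mulr0 add0r divff ?pnatr_eq0 // clamp0 clamp1 path_one path_zero //.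
rewrite (holE fA) (holE f1) (holE f2) /= !mulr0 addr0 add0r mulr1 addr0.
have -> : 2^-1 + 2^-1 = 1 :> R by lra.
by rewrite !mulgA mulgK.
Qed.

Lemma hol_cst x : hol (cst x : {path I from x to x in X}) = 1%g.
Proof.
rewrite (@holE _ _ _ (fun=> 1%g)) ?mulVg //.
by move=> r _; near=> r' => _; rewrite /= tau1 mulg1.
Unshelve. all: by end_near. Qed.

(** A flat section over the homotopy is constant along the two sides on which the
    homotopy is constant, and restricts to flat sections over both paths. *)
Lemma hol_homotopic x y (f f' : {path I from x to y in X}) :
  path_homotopic f f' -> hol f = hol f'.
Proof.
move=> [H [cH H0 H1 Hx Hy]].
pose h (z : R * R) := H (clamp z.1, clamp z.2).
have ch : continuous h.
  move=> z; apply: (@continuous_comp _ _ _ (fun z : R * R => (clamp z.1, clamp z.2)) H); last exact: cH.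
  apply: continuous_pair_with => z'; apply: continuous_clamp_comp => z''.
    exact: cvg_fst.
  exact: cvg_snd.
have [A fA] := flat_exists ler01 ler01 ch.
have horizontal s : 0 <= s <= 1 -> flat_on [set r : R | 0 <= r <= 1]
    (fun r => H (clamp r, clamp s)) (fun r => A (r, s)).
  have ck : continuous (fun r : R => (r, s)).
    by apply: continuous_pair_with => r; [exact: cvg_id|exact: cvg_cst].
  move=> sI; apply: (flat_on_comp ck _ fA).
  by move=> r /= rI; rewrite /rect /= rI sI.
have vertical r : 0 <= r <= 1 -> flat_on [set s : R | 0 <= s <= 1]
    (fun s => H (clamp r, clamp s)) (fun s => A (r, s)).
  have ck : continuous (fun s : R => (r, s)).
    by apply: continuous_pair_with => s; [exact: cvg_cst|exact: cvg_id].
  move=> rI; apply: (flat_on_comp ck _ fA).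
  by move=> s /= sI; rewrite /rect /= rI sI.
have side r : 0 <= r <= 1 -> (exists x0, forall s, H (clamp r, s) = x0) -> A (r, 0) = A (r, 1).
  move=> rI [x0 Hr].
  have fc : flat_on [set s : R | 0 <= s <= 1] (fun s => H (clamp r, clamp s)) (fun=> 1%g).
    by move=> s _; near=> s' => _; rewrite !Hr tau1 mulg1.
  by have := flat_on_unique ler01 (vertical _ rI) fc; rewrite invg1 !mulg1.
have e0 : A (0, 0) = A (0, 1).
  by apply: side; rewrite ?lexx ?ler01 //; exists x => s; rewrite clamp0 Hx.
have e1 : A (1, 0) = A (1, 1).
  by apply: side; rewrite ?lexx ?ler01 //; exists y => s; rewrite clamp1 Hy.
rewrite (@holE _ _ f (fun r => A (r, 0))); last first.
  have := horizontal 0; rewrite lexx ler01 => /(_ isT).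
  by apply: eq_flat_on => r _ /=; rewrite clamp0 H0.
rewrite (@holE _ _ f' (fun r => A (r, 1))); last first.
  have := horizontal 1; rewrite lexx ler01 => /(_ isT).
  by apply: eq_flat_on => r _ /=; rewrite clamp1 H1.
by rewrite e0 e1.
Unshelve. all: by end_near. Qed.

Lemma hol_rev x y (f : {path I from x to y in X}) : hol (path_rev f) = ((hol f)^-1)%g.
Proof.
have := hol_homotopic (path_catpV f); rewrite hol_cat hol_cst => e.
by apply/esym; exact: mulg1_eq.
Qed.

Definition pi1_hol (x : X) (c : pi1 R x) : G := hol (repr c).

Lemma pi1_holE x (f : {path I from x to x in X}) : pi1_hol (\pi_(pi1 R x)%qT f) = hol f.
Proof. by apply: hol_homotopic; exact: repr_pi1. Qed.

Lemma pi1_holM x : {morph @pi1_hol x : c c' / (c * c')%g}.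
Proof.
by move=> c c'; rewrite /GRing.mul /= -hol_cat -pi1_holE.
Qed.

End Holonomy.

(** * The boundary of the polygon *)

Section Polygon.
Context (R : realType).
Implicit Types (z w : R * R) (e t u : R).

Definition sup_close e z w := `|z.1 - w.1| < e /\ `|z.2 - w.2| < e.

Lemma sup_close_nbhs z (A : set (R * R)) :
  nbhs z A <-> exists2 e, 0 < e & forall w, sup_close e z w -> A w.
Proof.
split.
  move=> [[/= U V] [/= [e1 e10 e1U] [e2 e20 e2V]] UV].
  exists (Num.min e1 e2); first by rewrite lt_min e10.
  move=> w; rewrite /sup_close !lt_min => -[/andP[w1 _] /andP[_ w2]].
  by apply: UV; split => /=; [exact: e1U|exact: e2V].
move=> [e e0 eA]; exists (ball z.1 e, ball z.2 e); first by split; exact: nbhsx_ballx.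
by move=> w [/= w1 w2]; apply: eA; split.
Qed.

Lemma sup_close_refl e z : 0 < e -> sup_close e z z.
Proof. by rewrite /sup_close !subrr normr0. Qed.

Lemma sup_close_sym e z w : sup_close e z w -> sup_close e w z.
Proof. by rewrite /sup_close distrC [`|w.2 - _|]distrC. Qed.

Lemma sup_close_trans d e z w v : sup_close d z w -> sup_close e w v -> sup_close (d + e) z v.
Proof.
move=> [a1 a2] [b1 b2]; split; [rewrite -(subrK w.1 z.1)|rewrite -(subrK w.2 z.2)];
rewrite -addrA; apply: le_lt_trans (ler_normD _ _) _; exact: ltrD.
Qed.

Lemma sup_close_le d e z w : d <= e -> sup_close d z w -> sup_close e z w.
Proof. by move=> de [? ?]; split; apply: lt_le_trans de. Qed.

Lemma open_sup_close e z : open [set w | sup_close e z w].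
Proof.
rewrite openE => w [w1 w2]; apply/sup_close_nbhs.
pose d := Num.min (e - `|z.1 - w.1|) (e - `|z.2 - w.2|).
exists d; first by rewrite lt_min !subr_gt0 w1.
move=> v [v1 v2]; split.
  rewrite -(subrK w.1 z.1) -addrA; apply: le_lt_trans (ler_normD _ _) _.
  by rewrite -ltrBrDl; apply: lt_le_trans v1 _; rewrite ge_min lexx.
rewrite -(subrK w.2 z.2) -addrA; apply: le_lt_trans (ler_normD _ _) _.
by rewrite -ltrBrDl; apply: lt_le_trans v2 _; rewrite ge_min lexx orbT.
Qed.

Lemma prod_hausdorffR : hausdorff_space (R * R)%type.
Proof. exact: (@norm_hausdorff R (R * R)%type). Qed.

Lemma compact_closed_disc : compact (@closed_disc R).
Proof.
have cl : closed (@closed_disc R).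
  rewrite (_ : @closed_disc R = (fun z : R * R => z.1 ^+ 2 + z.2 ^+ 2) @^-1` [set x | x <= 1]) //.
  apply: preimage_closed; last exact: closed_le.
  have sq (f : R * R -> R) : continuous f -> continuous (fun z => f z ^+ 2).
    by move=> cf z; rewrite /=; under eq_fun do rewrite expr2; apply: (@cvgM R); exact: cf.
  have s1 : continuous (fun z : R * R => z.1 ^+ 2) by apply: sq => z; exact: cvg_fst.
  have s2 : continuous (fun z : R * R => z.2 ^+ 2) by apply: sq => z; exact: cvg_snd.
  by move=> z _; exact: (cvgD (s1 z) (s2 z)).
apply: (subclosed_compact cl (compact_setX (@segment_compact R (-1) 1) (@segment_compact R (-1) 1))).
move=> [x y]; rewrite /closed_disc /= => xy.
have x0 := sqr_ge0 x; have y0 := sqr_ge0 y.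
rewrite !in_itv /= -!ler_norml; split; rewrite -(@expr_le1 _ 2) ?normr_ge0 // real_normK ?num_real //; lra.
Qed.

Variable g : nat.
Hypothesis g_gt0 : (0 < g)%N.
Local Notation circ := (@circle_pt R g).

Lemma circ_in_disc t : closed_disc (circ t).
Proof. by rewrite /closed_disc /circle_pt /= cos2Dsin2. Qed.

Lemma circ_continuous : continuous circ.
Proof.
have cl : continuous (fun t : R => 2 * pi * t / (4 * g)%:R).
  move=> t; apply: (@cvgM R); last exact: cvg_cst.
  by apply: (@cvgM R); [exact: cvg_cst|exact: cvg_id].
apply: continuous_pair_with => t.
  by apply: continuous_comp; [exact: cl|exact: continuous_cos].
by apply: continuous_comp; [exact: cl|exact: continuous_sin].
Qed.

Lemma four_g_gt0 : 0 < (4 * g)%:R :> R.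
Proof. by rewrite ltr0n muln_gt0. Qed.

Lemma circ_period : circ (4 * g)%:R = circ 0.
Proof.
have g0 : (4 * g)%:R != 0 :> R by rewrite gt_eqF // four_g_gt0.
rewrite /circle_pt mulr0 mul0r mulfK // cos0 sin0.
by rewrite [2 * pi]mulr_natl cos2pi sin2pi.
Qed.

(** The points at angles that differ by 2 x have cos (2 x) = 1 as inner product, so
    sin x = 0. *)
Lemma circ_inj t u : 0 <= t < (4 * g)%:R -> 0 <= u < (4 * g)%:R -> circ t = circ u -> t = u.
Proof.
wlog tu : t u / t <= u.
  move=> H tI uI e; have [tu|ut] := leP t u; first exact: H.
  by apply/esym; apply: H => //; exact: ltW.
move=> tI uI [ec es]; apply/eqP; rewrite eq_le tu leNgt; apply/negP => lt_tu.
have g0 := four_g_gt0.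
pose x := pi * (u - t) / (4 * g)%:R.
have x2 : 2 * pi * u / (4 * g)%:R - 2 * pi * t / (4 * g)%:R = x *+ 2.
  by rewrite /x -[RHS]mulr_natl; ring.
have : cos (x *+ 2) = 1 by rewrite -x2 cosB -ec -es -!expr2 cos2Dsin2.
have xI : 0 < x < pi.
  rewrite /x; apply/andP; split.
    by rewrite divr_gt0 // mulr_gt0 ?pi_gt0 // subr_gt0.
  rewrite -mulrA gtr_pMr ?pi_gt0 // ltr_pdivrMr // mul1r; lra.
have := sin_gt0_pi xI; rewrite cos_mulr2n cos2sin2 => s0 e.
have : sin x ^+ 2 = 0 by rewrite !mulr2n in e; lra.
by move=> /eqP; rewrite sqrf_eq0 gt_eqF.
Qed.

(** The reflection of the plane that reverses the boundary circle so that the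
    parameters t and c - t are exchanged; each side pairing is the restriction
    of one. *)
Definition reflect_pt c z : R * R :=
  ((circ c).1 * z.1 + (circ c).2 * z.2, (circ c).2 * z.1 - (circ c).1 * z.2).

Lemma circ_reflect c t : circ (c - t) = reflect_pt c (circ t).
Proof.
by rewrite /reflect_pt /circle_pt /= mulrBr mulrBl cosB sinB.
Qed.

Lemma sup_close_reflect c e z w : sup_close e z w -> sup_close (e + e) (reflect_pt c z) (reflect_pt c w).
Proof.
move=> [e1 e2].
have c1 : `|(circ c).1| <= 1 by exact: cos_max.
have c2 : `|(circ c).2| <= 1 by exact: sin_max.
have b (x y : R) : `|x| <= 1 -> `|y| < e -> `|x * y| < e.
  by move=> x1 ye; rewrite normrM; apply: le_lt_trans ye; rewrite ler_piMl.
rewrite /reflect_pt; move: (circ c).1 (circ c).2 c1 c2 => C S c1 c2; split=> /=.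
  rewrite opprD addrACA -!mulrBr; apply: le_lt_trans (ler_normD _ _) _.
  by apply: ltrD; exact: b.
rewrite [X in `|X|](_ : _ = S * (z.1 - w.1) + C * (w.2 - z.2)); last by ring.
apply: le_lt_trans (ler_normD _ _) _.
by apply: ltrD; apply: b => //; rewrite distrC.
Qed.

(** The k-th commutator contributes two side pairings, told apart by b. *)
Definition side_src (k : nat) (b : bool) u := circ ((4 * k + b)%:R + u).
Definition side_tgt (k : nat) (b : bool) u := circ ((4 * k + 3 + b)%:R - u).

Lemma side_pairingE z w : side_pairing g z w <->
  exists k b u, [/\ (k < g)%N, 0 <= u <= 1, z = side_src k b u & w = side_tgt k b u].
Proof.
split.
  move=> [k [u [kg uI [[-> ->]|[-> ->]]]]].
    by exists k, false, u; split => //; rewrite /side_src /side_tgt !addn0.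
  by exists k, true, u; split => //; rewrite /side_src /side_tgt -addnA.
move=> [k [b [u [kg uI -> ->]]]]; exists k, u; split => //.
case: b; [right|left]; rewrite /side_src /side_tgt ?addn0 //.
by rewrite -addnA.
Qed.

Lemma side_tgt_reflect k b u :
  side_tgt k b u = reflect_pt ((4 * k + b)%:R + (4 * k + 3 + b)%:R) (side_src k b u).
Proof.
rewrite /side_src -circ_reflect /side_tgt; congr (circ _); ring.
Qed.

Lemma side_param k (b : bool) u : (k < g)%N -> 0 <= u <= 1 ->
  0 <= (4 * k + b)%:R + u <= (4 * g)%:R /\ 0 <= (4 * k + 3 + b)%:R - u <= (4 * g)%:R.
Proof.
move=> kg uI; have b1 : (b <= 1)%N by case: b.
have h1 : (4 * k + b)%:R + 1 <= (4 * g)%:R :> R.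
  by rewrite natr1 ler_nat; lia.
have h2 : (4 * k + 3 + b)%:R <= (4 * g)%:R :> R by rewrite ler_nat; lia.
have h3 : 1 <= (4 * k + 3 + b)%:R :> R by rewrite ler1n; lia.
have h4 : 0 <= (4 * k + b)%:R :> R by [].
split; lra.
Qed.

(** Closed sides are compact. *)
Lemma side_src_apart k b z : (forall u, 0 <= u <= 1 -> z <> side_src k b u) ->
  exists2 e, 0 < e & forall u, 0 <= u <= 1 -> ~ sup_close e z (side_src k b u).
Proof.
move=> zP.
have cs : continuous (side_src k b).
  have ca : continuous (fun u : R => (4 * k + b)%:R + u).
    by move=> u; apply: (@cvgD R R^o); [exact: cvg_cst|exact: cvg_id].
  by move=> u; apply: (@continuous_comp _ _ _ (fun u : R => (4 * k + b)%:R + u) circ);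
    [exact: ca|exact: circ_continuous].
have cC : closed (side_src k b @` `[0, 1]).
  apply: compact_closed; first exact: prod_hausdorffR.
  apply: continuous_compact; last exact: segment_compact.
  exact: continuous_subspaceT.
have nz : (~` (side_src k b @` `[0, 1])) z.
  by move=> [u /=]; rewrite in_itv /= => uI /esym; exact: zP.
have /sup_close_nbhs[e e0 eP] : nbhs z (~` (side_src k b @` `[0, 1])).
  by apply: open_nbhs_nbhs; split => //; exact: closed_openC.
by exists e => // u uI cl; apply: (eP _ cl); exists u => //=; rewrite in_itv.
Qed.

End Polygon.

Section FiniteFibres.
Context (R : realType) (g : nat).
Hypothesis g_gt0 : (0 < g)%N.
Local Notation circ := (@circle_pt R g).
Local Notation side_eq := (Relation_Operators.clos_refl_sym_trans _ (@side_pairing R g)).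

Lemma circ_inj_closed (t u : R) : 0 <= t <= (4 * g)%:R -> 0 <= u <= (4 * g)%:R ->
  circ t = circ u -> t - u \is a Num.int.
Proof.
have per (x : R) : 0 <= x <= (4 * g)%:R -> exists y, [/\ 0 <= y < (4 * g)%:R,
    circ y = circ x & x - y \is a Num.int].
  move=> xI; have [xg|xg] := ltP x (4 * g)%:R.
    by exists x; split => //; [lra|rewrite subrr rpred0].
  have -> : x = (4 * g)%:R by lra.
  exists 0; split; rewrite ?circ_period // ?subr0 ?natr_int //.
  by rewrite lexx four_g_gt0.
move=> /per[t' [t'I ct tt']] /per[u' [u'I cu uu']] e.
have e' : t' = u' by apply: (circ_inj g_gt0) => //; rewrite ct cu.
by rewrite (_ : t - u = (t - t') - (u - u')); [exact: rpredB|rewrite e'; ring].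
Qed.

(** The identifications are of the form t |-> n - t for integers n, up to the
    period: they preserve the class of the parameter modulo 1, up to sign. *)
Definition congruent (t0 t : R) := t - t0 \is a Num.int \/ t + t0 \is a Num.int.

Lemma side_class_invariant (t0 : R) z w : side_pairing g z w ->
  (exists2 t, 0 <= t <= (4 * g)%:R & z = circ t /\ congruent t0 t) <->
  (exists2 t, 0 <= t <= (4 * g)%:R & w = circ t /\ congruent t0 t).
Proof.
move=> /side_pairingE[k [b [u [kg uI -> ->]]]].
have [sI tI] := side_param g_gt0 b kg uI.
have flip (a c x y : R) : a \is a Num.int -> c \is a Num.int -> x = c - y ->
    congruent t0 y -> congruent t0 x.
  move=> aZ cZ ->.
  case=> h; [right|left].
    by rewrite (_ : c - y + t0 = c - (y - t0)); [exact: rpredB|ring].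
  by rewrite (_ : c - y - t0 = c - (y + t0)); [exact: rpredB|ring].
have shift (x y : R) : x - y \is a Num.int -> congruent t0 x -> congruent t0 y.
  move=> xy [h|h]; [left|right].
    by rewrite (_ : y - t0 = (x - t0) - (x - y)); [exact: rpredB|ring].
  by rewrite (_ : y + t0 = (x + t0) - (x - y)); [exact: rpredB|ring].
split=> -[t tI' [e tc]].
  exists ((4 * k + 3 + b)%:R - u) => //; split => //.
  have := shift _ _ (circ_inj_closed tI' sI (esym e)) tc.
  apply: (flip 0 ((4 * k + 3 + b)%:R + (4 * k + b)%:R)); rewrite ?rpred0 ?rpredD ?natr_int //.
  ring.
exists ((4 * k + b)%:R + u) => //; split => //.
have := shift _ _ (circ_inj_closed tI' tI (esym e)) tc.
apply: (flip 0 ((4 * k + 3 + b)%:R + (4 * k + b)%:R)); rewrite ?rpred0 ?rpredD ?natr_int //.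
ring.
Qed.

Lemma side_eq_invariant (C : R * R -> Prop) :
  (forall z w, side_pairing g z w -> (C z <-> C w)) ->
  forall z w, side_eq z w -> (C z <-> C w).
Proof.
move=> Cp z w; elim=> [x y /Cp //|x //|x y _ IH|x y v _ IH1 _ IH2]; first by symmetry.
by rewrite IH1.
Qed.

Lemma side_class_finite z0 : exists s : seq (R * R), forall z, side_eq z0 z -> z \in s.
Proof.
have [[t0 t0I z0E]|nz0] := pselect (exists2 t, 0 <= t <= (4 * g)%:R & z0 = circ t).
  exists ([seq circ (n%:R + t0 - (4 * g)%:R) | n <- iota 0 (8 * g).+1] ++
          [seq circ (n%:R - t0) | n <- iota 0 (8 * g).+1]) => z zz.
  have [t tI [-> tc]] : exists2 t, 0 <= t <= (4 * g)%:R & z = circ t /\ congruent t0 t.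
    apply/(side_eq_invariant (@side_class_invariant t0) zz).
    by exists t0 => //; split => //; left; rewrite subrr rpred0.
  rewrite mem_cat; apply/orP.
  have bnd (n : nat) : n%:R <= (8 * g)%:R :> R -> n \in iota 0 (8 * g).+1.
    by rewrite ler_nat mem_iota add0n ltnS.
  have e8 : (8 * g)%:R = (4 * g)%:R + (4 * g)%:R :> R by rewrite -natrD -mulnDl.
  case: tc => h; [left|right]; apply/mapP.
    have : t - t0 + (4 * g)%:R \is a Num.nat.
      by rewrite Num.Theory.natrEint rpredD ?natr_int //=; lra.
    move=> /Num.Theory.natrP[n nE]; exists n; first by apply: bnd; rewrite -nE e8; lra.
    by congr circ; rewrite -nE; ring.
  have : t + t0 \is a Num.nat by rewrite Num.Theory.natrEint h /=; lra.
  move=> /Num.Theory.natrP[n nE]; exists n; first by apply: bnd; rewrite -nE e8; lra.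
  by congr circ; rewrite -nE; ring.
exists [:: z0] => z zz; rewrite inE; apply/eqP.
have off x y : side_pairing g x y -> x <> z0 /\ y <> z0.
  move=> /side_pairingE[k [b [u [kg uI -> ->]]]].
  have [sI tI] := side_param g_gt0 b kg uI.
  by split=> e; apply: nz0;
    [exists ((4 * k + b)%:R + u)|exists ((4 * k + 3 + b)%:R - u)].
by apply/(side_eq_invariant (C := fun z => z = z0) _ zz) => // x y /off[].
Qed.

End FiniteFibres.

Section Potential.
Context (R : realType) (g : nat) (G : groupType) (A B : nat -> G).
Hypothesis g_gt0 : (0 < g)%N.
Hypothesis relAB : surface_relator g A B = 1%g.
Local Notation circ := (@circle_pt R g).

(** All vertices are identified; the value at the m-th vertex is the product of
    the generators met when passing from the vertex 0 to it across sides.  On the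
    interiors of the sides it is enough to put the generator on the target of
    each pairing.  The function is discontinuous: only its ratios at identified
    points matter. *)
Definition vertex_val (m : nat) : G :=
  let k := (m %/ 4)%N in
  (surface_relator k A B *
   match (m %% 4)%N with
   | 0 => 1 | 1 => A k * (B k)^-1 * (A k)^-1 | 2 => A k * (B k)^-1 | _ => A k
   end)%g.

Definition edge_val (m : nat) : G :=
  let k := (m %/ 4)%N in match (m %% 4)%N with 2 => A k | 3 => B k | _ => 1%g end.

Definition arc_val (t : R) : G :=
  let m := Num.truncn t in if t == m%:R then vertex_val m else edge_val m.

Definition potential (z : R * R) : G :=
  if pselect (exists2 t, 0 <= t < (4 * g)%:R & circ t = z) is left h
  then arc_val (projT1 (cid2 h)) else 1%g.

Lemma arc_val_nat m : arc_val m%:R = vertex_val m.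
Proof. by rewrite /arc_val natrK eqxx. Qed.

Lemma arc_val_edge m u : 0 < u < 1 -> arc_val (m%:R + u) = edge_val m.
Proof.
move=> uI; have tE : Num.truncn (m%:R + u) = m.
  by apply/truncn_def; rewrite -natr1; lra.
by rewrite /arc_val tE ifF //; apply/eqP; lra.
Qed.

(** The vertex 4 g is the vertex 0, and the values there agree by the surface
    relation. *)
Lemma vertex_val_period : vertex_val (4 * g) = vertex_val 0.
Proof.
rewrite /vertex_val mulKn // modnMr mod0n div0n relAB.
by rewrite /surface_relator big_nil.
Qed.

Lemma potential_circ t : 0 <= t <= (4 * g)%:R -> potential (circ t) = arc_val t.
Proof.
move=> tI; rewrite /potential; case: pselect => [h|]; last first.
  have [tg|tg] := ltP t (4 * g)%:R; first by case; exists t => //; lra.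
  case; exists 0; first by rewrite lexx four_g_gt0.
  by rewrite (_ : t = (4 * g)%:R) ?circ_period //; lra.
case: cid2 => /= u uI cu; have [tg|tg] := ltP t (4 * g)%:R.
  by rewrite (circ_inj g_gt0 uI _ cu) //; lra.
have tE : t = (4 * g)%:R by lra.
rewrite tE arc_val_nat vertex_val_period -arc_val_nat.
congr arc_val; apply: (circ_inj g_gt0 uI); first by rewrite lexx four_g_gt0.
by rewrite cu tE circ_period.
Qed.

Lemma vertex_valE k j : (j < 4)%N -> vertex_val (4 * k + j) = (surface_relator k A B *
   match j with
   | 0 => 1 | 1 => A k * (B k)^-1 * (A k)^-1 | 2 => A k * (B k)^-1 | _ => A k
   end)%g.
Proof.
move=> j4; rewrite /vertex_val mulnC divnMDl // divn_small // addn0.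
by rewrite modnMDl modn_small.
Qed.

Lemma edge_valE k j : (j < 4)%N -> edge_val (4 * k + j) =
   match j with 2 => A k | 3 => B k | _ => 1%g end.
Proof.
move=> j4; rewrite /edge_val mulnC divnMDl // divn_small // addn0.
by rewrite modnMDl modn_small.
Qed.

(** The cases u = 0 and u = 1 concern vertices. *)
Lemma potential_side k (b : bool) (u : R) : (k < g)%N -> 0 <= u <= 1 ->
  ((potential (@side_src R g k b u))^-1 * potential (@side_tgt R g k b u))%g =
  if b then B k else A k.
Proof.
move=> kg uI; have [sI tI] := side_param g_gt0 b kg uI.
rewrite /side_src /side_tgt !potential_circ //.
have v4 : vertex_val (4 * k + 4) =
    (surface_relator k A B * (A k * (B k)^-1 * (A k)^-1 * B k))%g.
  have -> : (4 * k + 4 = 4 * k.+1 + 0)%N by lia.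
  rewrite vertex_valE // mulg1 /surface_relator big_nat_recr //=.
  by rewrite /comm_g invgK.
have [->|u0] := eqVneq u 0.
  rewrite subr0 addr0 !arc_val_nat; case: b {sI tI}.
    rewrite -addnA v4 vertex_valE //=;
    by rewrite !invgM !invgK -!mulgA !(mulKg, mulVKg).
  by rewrite !addn0 !vertex_valE // -[(4 * k)%N]addn0 vertex_valE // mulg1 mulKg.
have [->|u1] := eqVneq u 1.
  rewrite (_ : (4 * k + 3 + b)%:R - 1 = (4 * k + (2 + b))%:R :> R); last first.
    by rewrite !natrD; ring.
  rewrite natr1 !arc_val_nat -addn1 -addnA; case: b {sI tI}; rewrite !vertex_valE //=.
    by rewrite !invgM !invgK -!mulgA !(mulKg, mulVKg, mulVg, mulgV, mulg1).
  by rewrite !invgM !invgK -!mulgA !(mulKg, mulVKg, mulVg, mulgV, mulg1).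
have uI' : 0 < u < 1 by rewrite !lt_neqAle eq_sym u0 u1; lra.
rewrite (_ : (4 * k + 3 + b)%:R - u = (4 * k + (2 + b))%:R + (1 - u)); last first.
  by rewrite !natrD; ring.
rewrite !arc_val_edge //; last by lra.
by case: b {sI tI}; rewrite !edge_valE // invg1 mul1g.
Qed.

End Potential.

(** * Sheets of the polygon over the surface *)

Lemma seq_radius (R : realType) (T : eqType) (s : seq T) (P : T -> R -> Prop) :
  (forall z d e, d <= e -> P z e -> P z d) ->
  (forall z, exists2 e, 0 < e & P z e) ->
  exists2 e, 0 < e & forall z, z \in s -> P z e.
Proof.
move=> Pmon Pex; elim: s => [|z s [e e0 eP]]; first by exists 1.
have [d d0 dP] := Pex z; exists (Num.min d e); first by rewrite lt_min d0.
move=> w; rewrite inE => /orP[/eqP ->|ws].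
  by apply: Pmon dP; rewrite ge_min lexx.
by apply: Pmon (eP _ ws); rewrite ge_min lexx orbT.
Qed.

Section Surface.
Context (R : realType) (X : topologicalType) (g : nat) (q : R * R -> X).
Hypotheses (g_gt0 : (0 < g)%N) (X_hausdorff : hausdorff_space X).
Local Notation D := (@closed_disc R).
Local Notation side_eq := (Relation_Operators.clos_refl_sym_trans _ (@side_pairing R g)).
Hypotheses (q_cont : {within D, continuous q}) (q_surj : q @` D = [set: X]).
Hypothesis q_fibre : {in D &, forall z w, q z = q w <-> side_eq z w}.

Lemma q_fibreE z w : D z -> D w -> q z = q w <-> side_eq z w.
Proof. by move=> Dz Dw; apply: q_fibre; rewrite inE. Qed.

Lemma lift_exists x : exists2 z, D z & q z = x.
Proof. by have : [set: X] x by []; rewrite -q_surj => -[z]; exists z. Qed.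

Definition lift_pt x : R * R := projT1 (cid2 (lift_exists x)).

Lemma lift_ptD x : D (lift_pt x).
Proof. by rewrite /lift_pt; case: cid2. Qed.

Lemma lift_ptK x : q (lift_pt x) = x.
Proof. by rewrite /lift_pt; case: cid2. Qed.

Lemma side_src_disc k b u : D (side_src g k b u). Proof. exact: circ_in_disc. Qed.
Lemma side_tgt_disc k b u : D (side_tgt g k b u). Proof. exact: circ_in_disc. Qed.

Lemma q_side k b u : (k < g)%N -> 0 <= u <= 1 -> q (side_src g k b u) = q (side_tgt g k b u).
Proof.
move=> kg uI; apply/q_fibreE; rewrite ?side_src_disc ?side_tgt_disc //;
  [exact: side_src_disc|exact: side_tgt_disc|].
by apply: Relation_Operators.rst_step; apply/side_pairingE; exists k, b, u.
Qed.

(** q is a closed map, as a continuous map from a compact to a Hausdorff space. *)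
Lemma fibre_nbhs x (V : set (R * R)) : open V -> (forall z, D z -> q z = x -> V z) ->
  \forall y \near x, forall z, D z -> q z = y -> V z.
Proof.
move=> oV xV; have cK : compact (D `&` ~` V).
  apply: (subclosed_compact _ (@compact_closed_disc R)); last by move=> z [].
  apply: closedI; last exact: open_closedC.
  by apply: compact_closed; [exact: prod_hausdorffR|exact: compact_closed_disc].
have cqK : closed (q @` (D `&` ~` V)).
  apply: compact_closed => //; apply: continuous_compact cK.
  by apply: continuous_subspaceW q_cont => z [].
have : nbhs x (~` (q @` (D `&` ~` V))).
  apply: open_nbhs_nbhs; split; first exact: closed_openC.
  by move=> [z [Dz nVz] zx]; apply: nVz; exact: xV.
by apply: filterS => y ny z Dz zy; apply: contrapT => nVz; apply: ny; exists z.
Qed.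

Lemma fibre_finite x : exists s : seq (R * R), forall z, D z -> q z = x -> z \in s.
Proof.
have [z0 D0 e0] := lift_exists x; have [s sP] := side_class_finite g_gt0 z0.
by exists s => z Dz zx; apply: sP; apply/q_fibreE; rewrite ?e0.
Qed.

(** The fibre of x is finite, so one radius serves all its points.  The bound 3 e
    in the separation leaves room for a point at distance e, and its mirror
    image, at distance 2 e in the maximum norm. *)
Lemma fibre_radius x : exists2 e, 0 < e &
  (forall z z', D z -> q z = x -> D z' -> q z' = x ->
     sup_close (e + (e + e)) z z' -> z = z') /\
  (forall z k b u, D z -> q z = x -> (k < g)%N -> 0 <= u <= 1 ->
     sup_close e z (side_src g k b u) -> exists2 u0, 0 <= u0 <= 1 & z = side_src g k b u0).
Proof.
have [s sP] := fibre_finite x.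
pose P1 (z : R * R) (e : R) := forall z', z' \in s -> sup_close (e + (e + e)) z z' -> z = z'.
pose P2 (z : R * R) (e : R) := forall kb, kb \in [seq (k, b) | k <- iota 0 g, b <- [:: true; false]] ->
  forall u, 0 <= u <= 1 -> sup_close e z (side_src g kb.1 kb.2 u) ->
    exists2 u0, 0 <= u0 <= 1 & z = side_src g kb.1 kb.2 u0.
have [|z|e1 e10 P1e] := @seq_radius R _ s P1.
- by move=> z d e de Pe z' z's c; apply: Pe => //; apply: sup_close_le c; lra.
- apply: (@seq_radius R _ s (fun z' e => sup_close (e + (e + e)) z z' -> z = z')).
    by move=> z' d e de Pe c; apply: Pe => //; apply: sup_close_le c; lra.
  move=> z'; have [->|zz'] := pselect (z = z'); first by exists 1.
  have : nbhs z (~` [set z']).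
    apply: open_nbhs_nbhs; split => //; apply: closed_openC.
    by apply: compact_closed; [exact: prod_hausdorffR|exact: compact_set1].
  move=> /sup_close_nbhs[e e0 eP]; exists (e / 3); first by rewrite divr_gt0.
  move=> c; exfalso; apply: (eP z') => //.
  by apply: sup_close_le c; lra.
have [|z|e2 e20 P2e] := @seq_radius R _ s P2.
- by move=> z d e de Pe kb kbs u uI c; apply: (Pe kb kbs u uI); exact: sup_close_le c.
- apply: (@seq_radius R _ _ (fun kb e => forall u, 0 <= u <= 1 ->
     sup_close e z (side_src g kb.1 kb.2 u) ->
     exists2 u0, 0 <= u0 <= 1 & z = side_src g kb.1 kb.2 u0)).
    by move=> kb d e de Pe u uI c; apply: (Pe u uI); exact: sup_close_le c.
  move=> [k b] /=; have [h|h] := pselect (exists2 u0, 0 <= u0 <= 1 & z = side_src g k b u0).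
    by exists 1.
  have [u uI zu|e e0 eP] := @side_src_apart R g k b z; first by apply: h; exists u.
  by exists e => // u uI c; case: (eP u uI).
exists (Num.min e1 e2); first by rewrite lt_min e10.
have m1 : Num.min e1 e2 <= e1 by rewrite ge_min lexx.
have m2 : Num.min e1 e2 <= e2 by rewrite ge_min lexx orbT.
split.
  move=> z z' Dz zx Dz' z'x c; apply: (P1e z (sP _ Dz zx) z' (sP _ Dz' z'x)).
  by apply: sup_close_le c; lra.
move=> z k b u Dz zx kg uI c.
apply: (P2e z (sP _ Dz zx) (k, b) _ u uI); last exact: sup_close_le c.
by apply/allpairsP; exists (k, b); split; rewrite ?mem_iota //=; case: b {c}; rewrite !inE.
Qed.

(** A neighbourhood of x whose inverse image under q splits into pieces around the
    points of the fibre of x; [nearest] maps a point to the centre of its piece.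
    The last field says that pieces are glued along sides just as their centres
    are. *)
Record sheet (x : X) := Sheet {
  sheet_dom : set X;
  nearest : R * R -> R * R;
  nbhs_sheet : nbhs x sheet_dom;
  nearest_fibre : forall w, D w -> sheet_dom (q w) -> D (nearest w) /\ q (nearest w) = x;
  nearest_id : forall z, D z -> q z = x -> nearest z = z;
  nearest_near : forall y, D y -> sheet_dom (q y) ->
    exists2 e, 0 < e & forall w, D w -> sup_close e y w -> nearest w = nearest y;
  nearest_side : forall k b u, (k < g)%N -> 0 <= u <= 1 -> sheet_dom (q (side_src g k b u)) ->
    exists u0, [/\ 0 <= u0 <= 1, nearest (side_src g k b u) = side_src g k b u0 &
                   nearest (side_tgt g k b u) = side_tgt g k b u0] }.

Lemma sheet_exists x : exists s : sheet x, True.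
Proof.
have [e e0 [sep sides]] := fibre_radius x.
pose nr w := xget w [set z | [/\ D z, q z = x & sup_close e z w]].
have nrE z w : D z -> q z = x -> sup_close e z w -> nr w = z.
  move=> Dz zx zw; rewrite /nr; case: xgetP => [v _ [Dv vx vw]|/(_ z) []//].
  apply: sep => //; apply: sup_close_le (sup_close_trans vw (sup_close_sym zw)).
  lra.
pose V := \bigcup_(z in [set z | D z /\ q z = x]) [set w | sup_close e z w].
pose N := [set y | forall w, D w -> q w = y -> V w].
have nN : nbhs x N.
  apply: fibre_nbhs; first by apply: bigcup_open => z _; exact: open_sup_close.
  by move=> z Dz zx; exists z => //; exact: sup_close_refl.
have NV w : D w -> N (q w) -> exists z, [/\ D z, q z = x, sup_close e z w & nr w = z].
  by move=> Dw /(_ w Dw erefl)[z [Dz zx] zw]; exists z; split => //; exact: nrE.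
unshelve eexists; first exists N nr; last by [].
- exact: nN.
- by move=> w Dw Nw; have [z [Dz zx _ ->]] := NV w Dw Nw.
- by move=> z Dz zx; apply: nrE => //; exact: sup_close_refl.
- move=> y Dy Ny; have [z [Dz zx zy ->]] := NV y Dy Ny.
  have : nbhs y [set w | sup_close e z w] by apply: open_nbhs_nbhs; split => //; exact: open_sup_close.
  move=> /sup_close_nbhs[d d0 dP]; exists d => // w Dw yw.
  by apply: nrE => //; exact: dP.
- move=> k b u kg uI Ns; have [z [Dz zx zs ->]] := NV _ (side_src_disc k b u) Ns.
  have [u0 u0I zE] := sides _ _ _ _ Dz zx kg uI zs.
  exists u0; split => //.
  have := Ns; rewrite q_side // => Nt.
  have [z' [Dz' z'x z't ->]] := NV _ (side_tgt_disc k b u) Nt.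
  apply: sep => //; [exact: side_tgt_disc|by rewrite -q_side // -zE|].
  apply: sup_close_trans z't _; rewrite !side_tgt_reflect; apply: sup_close_reflect.
  by rewrite -zE; exact: sup_close_sym.
Qed.

Definition sheet_at x : sheet x := projT1 (cid (sheet_exists x)).

Section Developing.
Variables (G : groupType) (A B : nat -> G).
Hypothesis relAB : surface_relator g A B = 1%g.
Local Notation H := (@potential R g G A B).

(** Identified points near the fibre of x jump by the same element as the centres of
    their pieces.  It is enough to check it for two paired points of a side. *)
Lemma potential_nearest x w w' : D w -> q w = q w' -> D w' -> sheet_dom (sheet_at x) (q w) ->
  ((H w)^-1 * H w' = (H (nearest (sheet_at x) w))^-1 * H (nearest (sheet_at x) w'))%g.
Proof.
set s := sheet_at x => Dw e Dw'; move: Dw e.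
have side_q z v : side_pairing g z v -> [/\ D z, D v & q z = q v].
  move=> /side_pairingE[k [b [u [kg uI -> ->]]]]; split; rewrite ?q_side //.
    exact: side_src_disc.
  exact: side_tgt_disc.
pose C z v := (D z <-> D v) /\ (D z -> q z = q v /\ (sheet_dom s (q z) ->
  ((H z)^-1 * H v = (H (nearest s z))^-1 * H (nearest s v))%g)).
move=> Dw e.
suff [_ /(_ Dw)[]] : C w w' by [].
have /q_fibreE : q w = q w' by [].
move=> /(_ Dw Dw').
elim=> [z v zv|z|z v _ [dzv IH]|z v y _ [d1 IH1] _ [d2 IH2]].
- have [Dz Dv qzv] := side_q _ _ zv; split => // _; split => //.
  move: zv => /side_pairingE[k [b [u [kg uI -> ->]]]] Ns.
  have [u0 [u0I -> ->]] := nearest_side kg uI Ns.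
  by rewrite !potential_side.
- by split => // _; split => //; rewrite !mulVg.
- split; first by symmetry.
  move=> /dzv Dz; have [qzv E] := IH Dz; split => // Nv.
  have := congr1 (fun c => c^-1)%g (E _); rewrite qzv => /(_ Nv).
  by rewrite !invgM !invgK.
- split; first by rewrite d1.
  move=> Dz; have [q1 E1] := IH1 Dz; have [q2 E2] := IH2 (proj1 d1 Dz).
  split; first by rewrite q1.
  move=> Nz; rewrite -(mulgK (H v) (H z)^-1%g) -mulgA E2 -?q1 // E1 //.
  by rewrite !mulgA mulgK.
Qed.

(** The transport from x to u in the covering of X with group G that is obtained by
    gluing copies of the polygon along the sides; points of X are represented by
    chosen points of the polygon. *)
Definition develop (x u : X) : G :=
  ((H (lift_pt x))^-1 * H (nearest (sheet_at x) (lift_pt u)))%g.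

Lemma develop1 x : develop x x = 1%g.
Proof. by rewrite /develop nearest_id ?mulVg //; [exact: lift_ptD|exact: lift_ptK]. Qed.

Lemma developM x u : sheet_dom (sheet_at x) u ->
  \forall v \near u, develop x v = (develop x u * develop u v)%g.
Proof.
move=> Nu.
pose V := \bigcup_(z in [set z | D z /\ q z = u]) (\bigcup_(e in [set e | 0 < e /\
   forall w, D w -> sup_close e z w -> nearest (sheet_at x) w = nearest (sheet_at x) z /\
     nearest (sheet_at u) w = z]) [set w | sup_close e z w]).
have : \forall v \near u, forall z, D z -> q z = v -> V z.
  apply: fibre_nbhs; first by do 2!apply: bigcup_open => ? _; exact: open_sup_close.
  move=> z Dz zu; exists z => //.
  have [|e e0 eP] := nearest_near (s := sheet_at x) Dz; first by rewrite zu.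
  have [|d d0 dP] := nearest_near (s := sheet_at u) Dz.
    by rewrite zu; apply: nbhs_singleton; exact: nbhs_sheet.
  exists (Num.min d e); last by apply: sup_close_refl; rewrite lt_min d0.
  split; first by rewrite /= lt_min d0.
  move=> w Dw c; split.
    by apply: eP => //; apply: sup_close_le c; rewrite ge_min lexx orbT.
  rewrite dP //; last by apply: sup_close_le c; rewrite ge_min lexx.
  exact: nearest_id.
apply: filterS => v /(_ _ (lift_ptD v) (lift_ptK v))[z [Dz zu] [e [/= e0 eP] c]].
have [ex eu] := eP _ (lift_ptD v) c.
rewrite /develop eu ex -!mulgA; congr (_ * _)%g.
rewrite (potential_nearest (x := x) (lift_ptD u) _ Dz) ?lift_ptK //.
by rewrite mulVKg.
Qed.

Lemma nbhs_sheet_at x : nbhs x (sheet_dom (sheet_at x)).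
Proof. exact: nbhs_sheet. Qed.

(** A path in the polygon stays in one copy of it; the ratio accounts for the choice
    of the representatives. *)
Lemma flat_lift (W : R -> R * R) : continuous W -> (forall t, D (W t)) ->
  flat_on develop setT (q \o W) (fun t => ((H (W t))^-1 * H (lift_pt (q (W t))))%g).
Proof.
move=> cW DW t _.
set u := q (W t).
have Nu : sheet_dom (sheet_at u) u by apply: nbhs_singleton; exact: nbhs_sheet.
have [e e0 eP] := nearest_near (s := sheet_at u) (DW t) Nu.
have n1 : \forall t' \near t, sup_close e (W t) (W t').
  have : nbhs (W t) [set w | sup_close e (W t) w].
    by apply: open_nbhs_nbhs; split; [exact: open_sup_close|exact: sup_close_refl].
  by move/cW.
have n2 : \forall t' \near t, sheet_dom (sheet_at u) (q (W t')).
  have cq : continuous (q \o W) by exact: continuous_within_comp.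
  exact: (cq t _ (nbhs_sheet (sheet_at u))).
apply: filterS2 n1 n2 => t' c Nt' _.
rewrite /develop /comp -/u -!mulgA mulVKg.
rewrite (potential_nearest (x := u) (DW t')) ?lift_ptK //; last exact: lift_ptD.
by rewrite eP // nearest_id.
Qed.

End Developing.
End Surface.

(** * The fundamental group of the surface *)

Section Segments.
Context (R : realType).
Local Notation I := (unitI R).

Definition mix (z w : R * R) (r : R) : R * R :=
  (z.1 + r * (w.1 - z.1), z.2 + r * (w.2 - z.2)).

Lemma mix0 z w : mix z w 0 = z. Proof. by case: z => a b; rewrite /mix !mul0r !addr0. Qed.
Lemma mix1 z w : mix z w 1 = w.
Proof. by case: w => a b; rewrite /mix /=; congr (_, _); ring. Qed.
Lemma mixx z r : mix z z r = z.
Proof. by case: z => a b; rewrite /mix /= !subrr !mulr0 !addr0. Qed.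

Lemma continuous_mix (Y : topologicalType) (f h : Y -> R * R) (r : Y -> R) :
  continuous f -> continuous h -> continuous r -> continuous (fun y => mix (f y) (h y) (r y)).
Proof.
move=> cf ch cr.
have c1 (k : Y -> R * R) : continuous k -> continuous (fun y => (k y).1).
  by move=> ck y; apply: (@continuous_comp _ _ _ k fst); [exact: ck|exact: cvg_fst].
have c2 (k : Y -> R * R) : continuous k -> continuous (fun y => (k y).2).
  by move=> ck y; apply: (@continuous_comp _ _ _ k snd); [exact: ck|exact: cvg_snd].
have comb (u v : Y -> R) : continuous u -> continuous v ->
    continuous (fun y => u y + r y * (v y - u y)).
  move=> cu cv y; apply: (@cvgD R R^o); first exact: cu.
  by apply: (@cvgM R); [exact: cr|apply: (@cvgB R R^o); [exact: cv|exact: cu]].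
by apply: continuous_pair_with; apply: comb; [exact: c1|exact: c1|exact: c2|exact: c2].
Qed.

Lemma disc_mix z w r : closed_disc z -> closed_disc w -> 0 <= r <= 1 -> closed_disc (mix z w r).
Proof.
rewrite /closed_disc /mix /= => Dz Dw rI.
have convex (a b : R) : (a + r * (b - a)) ^+ 2 <= (1 - r) * a ^+ 2 + r * b ^+ 2.
  rewrite -subr_ge0 (_ : _ - _ = r * (1 - r) * (a - b) ^+ 2); last by ring.
  by rewrite mulr_ge0 ?sqr_ge0 // mulr_ge0 //; lra.
have := lerD (convex z.1 w.1) (convex z.2 w.2).
move/le_trans; apply.
have -> : (1 - r) * z.1 ^+ 2 + r * w.1 ^+ 2 + ((1 - r) * z.2 ^+ 2 + r * w.2 ^+ 2) =
  (1 - r) * (z.1 ^+ 2 + z.2 ^+ 2) + r * (w.1 ^+ 2 + w.2 ^+ 2) by ring.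
have h1 : (1 - r) * (z.1 ^+ 2 + z.2 ^+ 2) <= (1 - r) * 1 by rewrite ler_wpM2l //; lra.
have h2 : r * (w.1 ^+ 2 + w.2 ^+ 2) <= r * 1 by rewrite ler_wpM2l //; lra.
lra.
Qed.

Lemma sup_close_mix e z w r : sup_close e z w -> 0 <= r <= 1 -> sup_close e z (mix w z r).
Proof.
move=> [c1 c2] rI.
have b (a c : R) : `|a - c| < e -> `|a - (c + r * (a - c))| < e.
  move=> ac; rewrite (_ : a - _ = (1 - r) * (a - c)); last by ring.
  rewrite normrM ger0_norm; last by lra.
  by apply: le_lt_trans ac; rewrite ler_piMl //; lra.
by split; exact: b.
Qed.

Lemma sup_close_mixr e z w r : sup_close e z w -> 0 <= r <= 1 -> sup_close e z (mix z w r).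
Proof.
move=> c rI; rewrite (_ : mix z w r = mix w z (1 - r)); last first.
  by rewrite /mix; congr (_, _); ring.
by apply: sup_close_mix => //; lra.
Qed.

Lemma uval_itv (t : I) : 0 <= uval t <= 1.
Proof. by rewrite uval_ge0 uval_le1. Qed.

Section Line.
Variables z w : R * R.
Definition line (t : I) : R * R := mix z w (uval t).

Fact line_continuous : continuous line.
Proof.
have c (p : R * R) : continuous (fun _ : I => p) by exact: cst_continuous.
exact: (continuous_mix (c z) (c w) (@uval_continuous R)).
Qed.
Fact line_zero : line zero = z. Proof. by rewrite /line uval0 mix0. Qed.
Fact line_one : line one = w. Proof. by rewrite /line uval1 mix1. Qed.

HB.instance Definition _ := isContinuous.Build I (R * R)%type line line_continuous.
HB.instance Definition _ := isPath.Build I (R * R)%type z w line line_zero line_one.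
End Line.

End Segments.

Section SurfaceLoops.
Context (R : realType) (X : topologicalType) (g : nat) (q : R * R -> X).
Hypotheses (g_gt0 : (0 < g)%N) (X_hausdorff : hausdorff_space X).
Local Notation I := (unitI R).
Local Notation D := (@closed_disc R).
Local Notation side_eq := (Relation_Operators.clos_refl_sym_trans _ (@side_pairing R g)).
Hypotheses (q_cont : {within D, continuous q}) (q_surj : q @` D = [set: X]).
Hypothesis q_fibre : {in D &, forall z w, q z = q w <-> side_eq z w}.
Hypothesis X_local : forall x : X, exists2 U : set X, nbhs x U &
  forall y y' (p1 p2 : {path I from y to y' in X}),
    (forall t, U (p1 t)) -> (forall t, U (p2 t)) -> path_homotopic p1 p2.

Record lift (x : X) := Lift { lpt : R * R; lptD : D lpt; lptE : q lpt = x }.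

Lemma lift_inj x (a b : lift x) : lpt a = lpt b -> a = b.
Proof.
case: a b => z Dz zx [w Dw wx] /= zw; subst w.
by rewrite (Prop_irrelevance Dz Dw) (Prop_irrelevance zx wx).
Qed.

Section Straight.
Context (x y : X) (a : lift x) (b : lift y).

Definition straight_fun (t : I) : X := q (line (lpt a) (lpt b) t).

Fact straight_continuous : continuous straight_fun.
Proof.
apply: (@continuous_within_comp _ _ _ D q (line (lpt a) (lpt b))) => //.
  exact: line_continuous.
by move=> t; apply: disc_mix; [exact: lptD|exact: lptD|exact: uval_itv].
Qed.

Fact straight_zero : straight_fun zero = x.
Proof. by rewrite /straight_fun line_zero lptE. Qed.
Fact straight_one : straight_fun one = y.
Proof. by rewrite /straight_fun line_one lptE. Qed.

Definition straight : {path I from x to y in X} :=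
  path_of straight_continuous straight_zero straight_one.
End Straight.

Lemma straightE x y (a : lift x) (b : lift y) t :
  straight a b t = q (mix (lpt a) (lpt b) (uval t)).
Proof. by []. Qed.

Lemma disc_homotopic x y (p1 p2 : {path I from x to y in X}) z w
    (w1 w2 : {path I from z to w in (R * R)%type}) :
  (forall t, D (w1 t)) -> (forall t, D (w2 t)) ->
  (forall t, p1 t = q (w1 t)) -> (forall t, p2 t = q (w2 t)) -> path_homotopic p1 p2.
Proof.
move=> D1 D2 e1 e2.
apply: (@convex_homotopic R X _ D q (@mix R) x y p1 p2 w1 w2) => //.
- apply: continuous_mix => v; last exact: cvg_snd.
    by apply: (@continuous_comp _ _ _ fst fst); exact: cvg_fst.
  by apply: (@continuous_comp _ _ _ fst snd); [exact: cvg_fst|exact: cvg_snd].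
- exact: mix0.
- exact: mix1.
- exact: mixx.
- by move=> *; exact: disc_mix.
- exact: cts_fun.
- exact: cts_fun.
- by rewrite !path_zero.
- by rewrite !path_one.
Qed.

Lemma straight_cat x y z (a : lift x) (b : lift y) (c : lift z) :
  path_homotopic (path_cat (straight a b) (straight b c)) (straight a c).
Proof.
apply: (@disc_homotopic _ _ _ _ _ _ (path_cat (line (lpt a) (lpt b)) (line (lpt b) (lpt c)))
  (line (lpt a) (lpt c))) => t //=.
- by rewrite /path_cat; case: ifP => _; apply: disc_mix; rewrite ?uval_itv //; exact: lptD.
- by apply: disc_mix; rewrite ?uval_itv //; exact: lptD.
- by rewrite /path_cat; case: ifP.
Qed.

Variable x0 : X.
Let z0 := lift_pt q_surj x0.
Definition base_lift : lift x0 := Lift (lift_ptD q_surj x0) (lift_ptK q_surj x0).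
Definition base x (a : lift x) : {path I from x0 to x in X} := straight base_lift a.

(** The class of a path, closed up by images of segments from the representative of
    x0 to the chosen lifts of its ends. *)
Definition transport x y (a : lift x) (f : {path I from x to y in X}) (b : lift y) : pi1 R x0 :=
  \pi_(pi1 R x0)%qT (path_cat (path_cat (base a) f) (path_rev (base b))).

Definition fibre_loop x (a b : lift x) : pi1 R x0 :=
  \pi_(pi1 R x0)%qT (path_cat (base a) (path_rev (base b))).

Lemma transport_homotopic x y (a : lift x) (f f' : {path I from x to y in X}) (b : lift y) :
  path_homotopic f f' -> transport a f b = transport a f' b.
Proof.
move=> ff'; apply/pi1_eqP; apply: path_cat_homotopic; last exact: path_homotopic_refl.
by apply: path_cat_homotopic => //; exact: path_homotopic_refl.
Qed.

Lemma transport_cat x y z (a : lift x) (b : lift y) (c : lift z)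
    (f : {path I from x to y in X}) (h : {path I from y to z in X}) :
  transport a (path_cat f h) c = (transport a f b * transport b h c)%g.
Proof.
rewrite /transport [RHS]pi1_mulE; apply/pi1_eqP.
set pa := base a; set pb := base b; set pc := path_rev (base c).
apply: path_homotopic_sym.
apply: path_homotopic_trans (path_homotopic_sym (path_catA _ _ _)) _.
have inner : path_homotopic (path_cat (path_rev pb) (path_cat (path_cat pb h) pc))
    (path_cat h pc).
  apply: path_homotopic_trans (path_catA _ _ _) _.
  apply: path_cat_homotopic; last exact: path_homotopic_refl.
  apply: path_homotopic_trans (path_catA _ _ _) _.
  apply: path_homotopic_trans (path_cat1p _).
  by apply: path_cat_homotopic; [exact: path_catVp|exact: path_homotopic_refl].
apply: path_homotopic_trans (path_cat_homotopic (path_homotopic_refl _) inner) _.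
apply: path_homotopic_trans (path_catA _ _ _) _.
apply: path_cat_homotopic; last exact: path_homotopic_refl.
by apply: path_homotopic_sym; exact: path_catA.
Qed.

Lemma transport_straight x y (a : lift x) (b : lift y) : transport a (straight a b) b = 1%g.
Proof.
apply/pi1_eqP; apply: path_homotopic_trans (path_catpV (base b)).
by apply: path_cat_homotopic; [exact: straight_cat|exact: path_homotopic_refl].
Qed.

Lemma transport_cst x (a b : lift x) : transport a (cst x) b = fibre_loop a b.
Proof.
apply/pi1_eqP; apply: path_cat_homotopic; last exact: path_homotopic_refl.
exact: path_catp1.
Qed.

Lemma fibre_loopM x (a b c : lift x) :
  (fibre_loop a b * fibre_loop b c)%g = fibre_loop a c.
Proof.
rewrite -!transport_cst -transport_cat; apply: transport_homotopic; exact: path_cat1p.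
Qed.

Lemma fibre_loopxx x (a : lift x) : fibre_loop a a = 1%g.
Proof. by apply/pi1_eqP; exact: path_catpV. Qed.

Lemma fibre_loopV x (a b : lift x) : (fibre_loop a b)^-1%g = fibre_loop b a.
Proof. by apply: mulg1_eq; rewrite fibre_loopM fibre_loopxx. Qed.

(** Moving along a side does not change the loop through it: a homotopy is obtained
    by moving the end point of both segments. *)
Lemma side_loop_const k b u v x y (a a' : lift x) (c c' : lift y) :
  (k < g)%N -> 0 <= u <= 1 -> 0 <= v <= 1 ->
  lpt a = side_src g k b u -> lpt a' = side_tgt g k b u ->
  lpt c = side_src g k b v -> lpt c' = side_tgt g k b v ->
  fibre_loop a a' = fibre_loop c c'.
Proof.
move=> kg uI vI aE a'E cE c'E; apply/pi1_eqP.
pose par (s : I) := u + uval s * (v - u).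
have parI s : 0 <= par s <= 1.
  have sI := uval_itv s; rewrite /par.
  have h1 : uval s * (v - u) = uval s * v - uval s * u by ring.
  have h2 : 0 <= uval s * v by rewrite mulr_ge0; lra.
  have h3 : uval s * u <= 1 * u by rewrite ler_wpM2r; lra.
  have h4 : uval s * v <= uval s * 1 by rewrite ler_wpM2l; lra.
  have h5 : (1 - uval s) * u <= (1 - uval s) * 1 by rewrite ler_wpM2l; lra.
  have h6 : (1 - uval s) * u = u - uval s * u by ring.
  lra.
pose r1 (t : I) : R := uval (clamp (2 * uval t)).
pose r2 (t : I) : R := uval (clamp (1 - uval (clamp (2 * uval t - 1)))).
have cpar : continuous (fun w : I * I => par w.2).
  rewrite /par; under eq_fun do rewrite addrC mulrC.
  by apply: continuous_affine; exact: continuous_uval_snd.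
have caff (m d : R) : continuous (fun w : I * I => m * uval w.1 + d).
  by apply: continuous_affine; exact: continuous_uval_fst.
have cuc (Y : topologicalType) (f : Y -> R) : continuous f -> continuous (fun y => uval (clamp (f y))).
  move=> cf r; apply: (@continuous_comp _ _ _ (fun y => clamp (f y)) (@uval R)).
    exact: continuous_clamp_comp.
  exact: uval_continuous.
have cr1 : continuous (fun w : I * I => r1 w.1).
  by apply: cuc; under eq_fun do rewrite -[_ * _]addr0; exact: caff.
have caffR (m : R) : continuous (fun w : R => m - w) /\ continuous (fun w : R => m + w).
  split=> w.
    by apply: (@cvgB R R^o); [exact: cvg_cst|exact: cvg_id].
  by apply: (@cvgD R R^o); [exact: cvg_cst|exact: cvg_id].
have cr2 : continuous (fun w : I * I => r2 w.1).
  apply: (cuc) => w.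
  apply: (@continuous_comp _ _ _ (fun w : I * I => uval (clamp (2 * uval w.1 - 1)))
    (fun r : R => 1 - r)); last exact: (proj1 (caffR 1)).
  by apply: cuc; exact: caff.
have csrc : continuous (fun w : I * I => side_src g k b (par w.2)).
  move=> w; apply: (@continuous_comp _ _ _ (fun w : I * I => par w.2) (side_src g k b)); first exact: cpar.
  apply: (@continuous_comp _ _ _ (fun u : R => (4 * k + b)%:R + u) (@circle_pt R g)).
    exact: (proj2 (caffR _)).
  exact: circ_continuous.
have ctgt : continuous (fun w : I * I => side_tgt g k b (par w.2)).
  move=> w; apply: (@continuous_comp _ _ _ (fun w : I * I => par w.2) (side_tgt g k b)); first exact: cpar.
  apply: (@continuous_comp _ _ _ (fun u : R => (4 * k + 3 + b)%:R - u) (@circle_pt R g)).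
    exact: (proj1 (caffR _)).
  exact: circ_continuous.
exists (fun w : I * I => if uval w.1 <= 2^-1
   then q (mix z0 (side_src g k b (par w.2)) (r1 w.1))
   else q (mix z0 (side_tgt g k b (par w.2)) (r2 w.1))).
have Dz0 : D z0 by exact: lift_ptD.
split.
- apply: paste_continuous; first exact: continuous_uval_fst.
  + apply: (@continuous_within_comp _ _ _ D q (fun w : I * I => mix z0 (side_src g k b (par w.2)) (r1 w.1))) => //.
      by apply: continuous_mix => // w; exact: cvg_cst.
    by move=> w; apply: disc_mix; rewrite ?uval_itv //; exact: side_src_disc.
  + apply: (@continuous_within_comp _ _ _ D q (fun w : I * I => mix z0 (side_tgt g k b (par w.2)) (r2 w.1))) => //.
      by apply: continuous_mix => // w; exact: cvg_cst.
    by move=> w; apply: disc_mix; rewrite ?uval_itv //; exact: side_tgt_disc.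
  + move=> w wE; rewrite /r1 /r2 wE divff ?pnatr_eq0 // subrr clamp0 uval0 subr0 clamp1 uval1.
    by rewrite !mix1; apply: (q_side q_fibre).
- move=> t; rewrite /par uval0 mul0r addr0 -aE -a'E.
  by rewrite /= /path_cat; case: ifP.
- move=> t; rewrite /par uval1 mul1r addrC subrK -cE -c'E.
  by rewrite /= /path_cat; case: ifP.
- move=> s; rewrite /r1 uval0 invr_ge0 ler0n mulr0 clamp0 uval0 mix0; exact: lift_ptK.
- move=> s; rewrite /r2 uval1 ifF; last by apply/negbTE; rewrite -ltNge; lra.
  rewrite (_ : 2 * 1 - 1 = 1 :> R); last by lra.
  by rewrite clamp1 uval1 subrr clamp0 uval0 mix0; exact: lift_ptK.
Qed.

Definition vertex_lift_src k b : lift (q (side_src g k b 0)) :=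
  Lift (side_src_disc g k b 0) erefl.
(** The loop through two paired end points of sides; they are known to be identified
    for k < g only, whence the default value. *)
Definition side_gen (b : bool) (k : nat) : pi1 R x0 :=
  if pselect (q (side_tgt g k b 0) = q (side_src g k b 0)) is left e
  then fibre_loop (vertex_lift_src k b) (Lift (side_tgt_disc g k b 0) e) else 1%g.

Lemma side_genE k b u x (a a' : lift x) : (k < g)%N -> 0 <= u <= 1 ->
  lpt a = side_src g k b u -> lpt a' = side_tgt g k b u -> fibre_loop a a' = side_gen b k.
Proof.
move=> kg uI aE a'E; have I0 : (0 : R) <= (0 : R) <= 1 by lra.
rewrite /side_gen; case: pselect => [e|[]]; last by rewrite -(q_side q_fibre).
by apply: (side_loop_const (k := k) (b := b) (u := u) (v := 0)).
Qed.

Definition gen_a k : pi1 R x0 := side_gen false k.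
Definition gen_b k : pi1 R x0 := side_gen true k.

(** The four sides of each commutator link five consecutive vertices. *)
Lemma vertex_fibre m : (m <= 4 * g)%N -> q (circle_pt g m%:R) = q (circle_pt g 0).
Proof.
have I0 : (0 : R) <= (0 : R) <= 1 by lra.
have I1 : (0 : R) <= (1 : R) <= 1 by lra.
have s0 k (b : bool) : (k < g)%N -> q (circle_pt g (4 * k + b)%:R) = q (circle_pt g (4 * k + 3 + b)%:R).
  by move=> kg; have := q_side q_fibre b kg I0; rewrite /side_src /side_tgt addr0 subr0.
have s1 k (b : bool) : (k < g)%N -> q (circle_pt g (4 * k + b).+1%:R) = q (circle_pt g (4 * k + 2 + b)%:R).
  move=> kg; have := q_side q_fibre b kg I1; rewrite /side_src /side_tgt natr1 => ->.
  by congr (q (circle_pt g _)); rewrite !natrD; ring.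
have quad k : (k < g)%N -> [/\ q (circle_pt g (4 * k + 1)%:R) = q (circle_pt g (4 * k)%:R),
    q (circle_pt g (4 * k + 2)%:R) = q (circle_pt g (4 * k)%:R),
    q (circle_pt g (4 * k + 3)%:R) = q (circle_pt g (4 * k)%:R) &
    q (circle_pt g (4 * k + 4)%:R) = q (circle_pt g (4 * k)%:R)].
  have at_ (n n' i i' : nat) : n = n' -> i = i' ->
      q (circle_pt g n'%:R) = q (circle_pt g i'%:R) ->
      q (circle_pt g n%:R) = q (circle_pt g i%:R) by move=> -> ->.
  move=> kg.
  have e03 : q (circle_pt g (4 * k)%:R) = q (circle_pt g (4 * k + 3)%:R).
    by apply: (at_ _ _ _ _ _ _ (s0 _ false kg)); rewrite /=; lia.
  have e14 : q (circle_pt g (4 * k + 1)%:R) = q (circle_pt g (4 * k + 4)%:R).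
    by apply: (at_ _ _ _ _ _ _ (s0 _ true kg)); rewrite /=; lia.
  have e12 : q (circle_pt g (4 * k + 1)%:R) = q (circle_pt g (4 * k + 2)%:R).
    by apply: (at_ _ _ _ _ _ _ (s1 _ false kg)); rewrite /=; lia.
  have e23 : q (circle_pt g (4 * k + 2)%:R) = q (circle_pt g (4 * k + 3)%:R).
    by apply: (at_ _ _ _ _ _ _ (s1 _ true kg)); rewrite /=; lia.
  by rewrite -e14 e12 e23 e03.
elim: m => // m IH mg.
have mE : m = (4 * (m %/ 4) + m %% 4)%N by rewrite mulnC -divn_eq.
have kg : (m %/ 4 < g)%N by rewrite ltn_divLR // mulnC.
have [q1 q2 q3 q4] := quad _ kg; have r4 : (m %% 4 < 4)%N by rewrite ltn_mod.
rewrite -IH; last exact: ltnW.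
move: q1 q2 q3 q4 mE r4; move: (m %/ 4)%N (m %% 4)%N => k r q1 q2 q3 q4 -> r4.
by rewrite -addnS; case: r r4 => [|[|[|[|]]]] // _; rewrite ?addn0 ?q1 ?q2 ?q3 ?q4.
Qed.

(** Each generator can be taken at either end of its side.  Chosen well, the factors
    of a commutator are loops through consecutive pairs of vertices, and the
    product is the loop from the vertex 0 to the vertex 4 g, which is the same
    point of the disc. *)
Lemma surface_relation : surface_relator g gen_a gen_b = 1%g.
Proof.
have I0 : (0 : R) <= (0 : R) <= 1 by lra.
have I1 : (0 : R) <= (1 : R) <= 1 by lra.
pose v m (mg : (m <= 4 * g)%N) : lift (q (circle_pt g 0)) :=
  Lift (circ_in_disc g m%:R) (vertex_fibre mg).
have partial n (ng : (4 * n <= 4 * g)%N) : surface_relator n gen_a gen_b =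
    fibre_loop (v _ (leq0n _)) (v _ ng).
  elim: n ng => [|n IH] ng.
    rewrite /surface_relator big_nil -(fibre_loopxx (v _ (leq0n _))).
    by congr fibre_loop; apply: lift_inj.
  have nS : (n < g)%N by lia.
  have b0 : (4 * n <= 4 * g)%N by lia.
  have b1 : (4 * n + 1 <= 4 * g)%N by lia.
  have b2 : (4 * n + 2 <= 4 * g)%N by lia.
  have b3 : (4 * n + 3 <= 4 * g)%N by lia.
  rewrite /surface_relator big_nat_recr //= -/(surface_relator n _ _) (IH b0).
  rewrite /comm_g invgK.
  have -> : gen_a n = fibre_loop (v _ b0) (v _ b3).
    by symmetry; apply: (side_genE (u := 0)); rewrite // /side_src /side_tgt /= ?addn0 ?addr0 ?subr0.
  (* the inverse generators are taken at the other ends of their sides, which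
     makes the four factors composable *)
  rewrite {2}(_ : fibre_loop (v _ b0) (v _ b3) = fibre_loop (v _ b1) (v _ b2)); last first.
    transitivity (gen_a n).
      by apply: (side_genE (u := 0)); rewrite // /side_src /side_tgt /= ?addn0 ?addr0 ?subr0.
    symmetry; apply: (side_genE (u := 1)) => //; rewrite /side_src /side_tgt /=; congr circle_pt;
      rewrite !natrD; ring.
  have -> : gen_b n = fibre_loop (v _ b1) (v _ ng).
    symmetry; apply: (side_genE (u := 0)); rewrite // /side_src /side_tgt /= ?addr0 ?subr0 //.
    by congr circle_pt; congr (_%:R); lia.
  rewrite {1}(_ : fibre_loop (v _ b1) (v _ ng) = fibre_loop (v _ b2) (v _ b3)); last first.
    transitivity (gen_b n).
      apply: (side_genE (u := 0)); rewrite // /side_src /side_tgt /= ?addr0 ?subr0 //.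
      by congr circle_pt; congr (_%:R); lia.
    symmetry; apply: (side_genE (u := 1)) => //; rewrite /side_src /side_tgt /=; congr circle_pt;
      rewrite !natrD; ring.
  by rewrite !fibre_loopV !mulgA !fibre_loopM.
rewrite (partial g (leqnn _)) -(fibre_loopxx (v _ (leq0n _))).
congr fibre_loop; apply: lift_inj; rewrite /= circ_period //.
Qed.

Section Generation.
Variable P : pi1 R x0 -> Prop.
Hypotheses (P1 : P 1%g) (PM : forall c d, P c -> P d -> P (c * d)%g)
  (PV : forall c, P c -> P c^-1%g) (Pgen : forall k, (k < g)%N -> P (gen_a k) /\ P (gen_b k)).

(** Loops through points of one fibre compose like the identifications. *)
Lemma fibre_loop_gen x (a b : lift x) : P (fibre_loop a b).
Proof.
have side_q z v : side_pairing g z v -> [/\ D z, D v & q z = q v].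
  move=> /side_pairingE[k [s [u [kg uI -> ->]]]]; split.
  - exact: side_src_disc.
  - exact: side_tgt_disc.
  - exact: (q_side q_fibre).
pose C z v := [/\ D z <-> D v, D z -> q z = q v &
  forall y (c d : lift y), lpt c = z -> lpt d = v -> P (fibre_loop c d)].
suff [_ _] : C (lpt a) (lpt b) by apply.
have /(q_fibreE q_fibre (lptD a) (lptD b)) : q (lpt a) = q (lpt b) by rewrite !lptE.
elim=> [z v zv|z|z v _ [dzv qzv IH]|z v w _ [d1 q1 IH1] _ [d2 q2 IH2]].
- have [Dz Dv qzv] := side_q _ _ zv; split => // y c d cz dv.
  move: zv => /side_pairingE[k [s [u [kg uI zE vE]]]].
  rewrite (@side_genE k s u) ?cz ?dv //.
  by have [] := Pgen kg; case: (s).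
- split => // y c d cz dz; rewrite (_ : c = d) ?fibre_loopxx //.
  by apply: lift_inj; rewrite cz dz.
- split; first by symmetry.
    by move=> /dzv Dz; rewrite qzv.
  by move=> y c d cv dz; rewrite -fibre_loopV; apply: PV; exact: IH.
- split; first by rewrite d1.
    by move=> Dz; rewrite q1 // q2 //; exact/d1.
  move=> y c d cz dw; have Dz : D z by rewrite -cz; exact: lptD.
  have qv : q v = y by rewrite -q1 // -cz lptE.
  rewrite -(fibre_loopM c (Lift (proj1 d1 Dz) qv) d).
  by apply: PM; [exact: IH1|exact: IH2].
Qed.

Lemma eq_path_homotopic (x y : X) (p p' : {path I from x to y in X}) :
  (forall t, p t = p' t) -> path_homotopic p p'.
Proof.
move=> pp'; have [H [cH H0 H1 Hx Hy]] := path_homotopic_refl p.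
by exists H; split => // t; rewrite H1 pp'.
Qed.

Lemma lift_nonempty x : exists a : lift x, True.
Proof. by have [z Dz zx] := lift_exists q_surj x; exists (Lift Dz zx). Qed.

Section Subpaths.
Variables (x y : X) (f : {path I from x to y in X}).
Local Notation pt r := (f (clamp r)).

Definition sub_fun (a b : R) (t : I) : X := f (clamp (a + (b - a) * uval t)).

Fact sub_continuous a b : continuous (sub_fun a b).
Proof.
apply: continuous_path_clamp; under eq_fun do rewrite addrC.
by apply: continuous_affine; exact: uval_continuous.
Qed.
Fact sub_zero a b : sub_fun a b zero = pt a.
Proof. by rewrite /sub_fun uval0 mulr0 addr0. Qed.
Fact sub_one a b : sub_fun a b one = pt b.
Proof. by rewrite /sub_fun uval1 mulr1 addrC subrK. Qed.

Definition subpath a b : {path I from pt a to pt b in X} :=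
  path_of (@sub_continuous a b) (sub_zero a b) (sub_one a b).

Lemma subpath_cat a b c :
  path_homotopic (path_cat (subpath a b) (subpath b c)) (subpath a c).
Proof.
(* the parameter runs from a to b during the first half, then from b to c *)
have cmin : continuous (fun r : R => Num.min (2 * r + 0) (0 * r + 1)).
  by apply: continuous_minR; exact: continuous_affineR.
have cmax : continuous (fun r : R => Num.max (2 * r + -1) (0 * r + 0)).
  by apply: continuous_maxR; exact: continuous_affineR.
apply: (@reparam_homotopic _ _ _ _ _ _ f _ _
  (fun r => (b - a) * Num.min (2 * r + 0) (0 * r + 1) + ((c - b) * Num.max (2 * r + -1) (0 * r + 0) + a))
  (fun r => (c - a) * r + a)).
- move=> r; apply: (@cvgD R R^o).
    by apply: (@cvgM R); [exact: cvg_cst|exact: cmin].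
  apply: (@cvgD R R^o); last exact: cvg_cst.
  by apply: (@cvgM R); [exact: cvg_cst|exact: cmax].
- exact: continuous_affineR.
- have -> : Num.min (2 * 0 + 0) (0 * 0 + 1) = 0 :> R by rewrite /Num.min; case: ifPn; lra.
  have -> : Num.max (2 * 0 + -1) (0 * 0 + 0) = 0 :> R by rewrite /Num.max; case: ifPn; lra.
  by ring.
- have -> : Num.min (2 * 1 + 0) (0 * 1 + 1) = 1 :> R by rewrite /Num.min; case: ifPn; lra.
  have -> : Num.max (2 * 1 + -1) (0 * 1 + 0) = 1 :> R by rewrite /Num.max; case: ifPn; lra.
  by ring.
- move=> t; have tI := uval_itv t; rewrite /= /path_cat; case: ifP => tle.
    rewrite /= /path_of /sub_fun clampK; last by lra.
    have -> : Num.min (2 * uval t + 0) (0 * uval t + 1) = 2 * uval t.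
      by rewrite /Num.min; case: ifPn; lra.
    have -> : Num.max (2 * uval t + -1) (0 * uval t + 0) = 0.
      by rewrite /Num.max; case: ifPn; lra.
    by congr (f (clamp _)); ring.
  have {}tle : 2^-1 < uval t by rewrite ltNge tle.
  rewrite /= /path_of /sub_fun clampK; last by lra.
  have -> : Num.min (2 * uval t + 0) (0 * uval t + 1) = 1.
    by rewrite /Num.min; case: ifPn; lra.
  have -> : Num.max (2 * uval t + -1) (0 * uval t + 0) = 2 * uval t - 1.
    by rewrite /Num.max; case: ifPn; lra.
  by congr (f (clamp _)); ring.
- by move=> t; rewrite /= /path_of /sub_fun addrC.
Qed.

Lemma transport_local x' (a b : lift x') y1 y2 (u : lift y1) (v : lift y2)
    (p : {path I from y1 to y2 in X}) :
  path_homotopic p (path_cat (straight u a) (straight b v)) ->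
  transport u p v = fibre_loop a b.
Proof.
move=> pE; rewrite (transport_homotopic _ _ pE) (transport_cat _ a) transport_straight mul1g.
have /path_homotopic_sym e := path_cat1p (straight b v).
rewrite (transport_homotopic _ _ e) (transport_cat _ b) transport_straight mulg1.
exact: transport_cst.
Qed.

(** A short piece of a path around the time t lies in a set where paths with common
    ends are homotopic, and its ends have lifts close to lifts of the point at
    time t; so it can be replaced by two segments through that point. *)
Lemma transport_subpath (u : lift (pt 0)) (v : lift (pt 1)) : P (transport u (subpath 0 1) v).
Proof.
move: u v; apply: (@interval_induction R 0 1 (fun a b =>
  forall (u : lift (pt a)) (v : lift (pt b)), P (transport u (subpath a b) v))) => //.
  move=> a b c _ _ _ _ Pab Pbc u v; have [w _] := lift_nonempty (pt b).
  rewrite -(transport_homotopic _ _ (subpath_cat a b c)) (transport_cat _ w).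
  exact: PM.
move=> t tI; have [U nU U_simple] := X_local (pt t).
pose V := \bigcup_(z in [set z | D z /\ q z = pt t]) (\bigcup_(e in [set e | 0 < e /\
   forall w, D w -> sup_close e z w -> U (q w)]) [set w | sup_close e z w]).
have nV : \forall y \near pt t, forall z, D z -> q z = y -> V z.
  apply: (fibre_nbhs X_hausdorff q_cont).
    by do 2!apply: bigcup_open => ? _; exact: open_sup_close.
  move=> z Dz zx; exists z => //.
  move/subspace_continuousP : q_cont => /(_ z Dz) cz.
  have : nbhs (q z) U by rewrite zx.
  move=> /cz; rewrite /nbhs /= => /sup_close_nbhs[e e0 eP].
  exists e; last exact: sup_close_refl.
  by split => // w Dw /eP; apply.
have cpt : continuous (fun r : R => pt r) by apply: continuous_path_clamp => r; exact: cvg_id.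
have [/= d d0 dP] := cpt t _ nV.
exists d => // a b _ at_ tb _ ad bd u v.
have inV r : a <= r <= b -> forall z, D z -> q z = pt r -> V z.
  by move=> rI; apply: (dP r); rewrite /= ltr_norml; lra.
have Vu : V (lpt u) by apply: (inV a); [lra|exact: lptD|exact: lptE].
have Vv : V (lpt v) by apply: (inV b); [lra|exact: lptD|exact: lptE].
move: Vu => [z [Dz zx] [e [e0 eP] zu]]; move: Vv => [w [Dw wx] [e' [e'0 e'P] wv]].
rewrite (@transport_local _ (Lift Dz zx) (Lift Dw wx)); first exact: fibre_loop_gen.
apply: U_simple => s.
  rewrite /= /path_of /sub_fun.
  have [z' Dz' z'x] := lift_exists q_surj (pt (a + (b - a) * uval s)).
  have sI := uval_itv s.
  have [|z'' [Dz'' _] [e'' [_ e''P] cz]] := inV (a + (b - a) * uval s) _ z' Dz' z'x.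
    have h1 : 0 <= (b - a) * uval s by rewrite mulr_ge0; lra.
    have h2 : (b - a) * uval s <= (b - a) * 1 by rewrite ler_wpM2l; lra.
    lra.
  by rewrite -z'x; exact: (e''P _ Dz' cz).
rewrite /= /path_cat; case: ifP => _; rewrite straightE /=.
  apply: eP; last by apply: sup_close_mix => //; exact: uval_itv.
  by apply: disc_mix => //; [exact: lptD|exact: uval_itv].
apply: e'P; last by apply: sup_close_mixr => //; exact: uval_itv.
by apply: disc_mix => //; [exact: lptD|exact: uval_itv].
Qed.

End Subpaths.

Lemma surface_generation c : P c.
Proof.
elim/quotW: c => f.
(* x0 and the ends f (clamp 0), f (clamp 1) are not convertible, so the base
   point needs to be seen as a lift of each of them *)
have e0 : q (lpt base_lift) = f (clamp 0) by rewrite clamp0 path_zero lptE.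
have e1 : q (lpt base_lift) = f (clamp 1) by rewrite clamp1 path_one lptE.
have := transport_subpath (Lift (lptD base_lift) e0) (Lift (lptD base_lift) e1).
congr P.
have triv (s : I) : base base_lift s = x0.
  by rewrite /base straightE mixx lptE.
apply/pi1_eqP; apply: (@path_homotopic_trans _ _ _ _ _
  (path_cat (path_cat (cst x0 : {path I from x0 to x0 in X}) f) (cst x0))).
  apply: eq_path_homotopic => t.
  rewrite /= /path_cat; case: ifP => _ /=.
    rewrite /path_cat; case: ifP => _ /=; first exact: triv.
    by rewrite /path_of /sub_fun subr0 mul1r add0r uvalK.
  exact: triv.
apply: path_homotopic_trans (path_catp1 _) _; exact: path_cat1p.
Qed.
End Generation.

Section LoopHolonomy.
Variables (G : groupType) (A B : nat -> G).
Hypothesis relAB : surface_relator g A B = 1%g.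
Local Notation H := (@potential R g G A B).
Local Notation dev := (develop g_gt0 X_hausdorff q_cont q_surj q_fibre A B).
Let nbhs_dev := nbhs_sheet_at g_gt0 X_hausdorff q_cont q_surj q_fibre.
Let dev1 := develop1 g_gt0 X_hausdorff q_cont q_surj q_fibre A B.
Let devM := @developM R X g q g_gt0 X_hausdorff q_cont q_surj q_fibre G A B relAB.
Local Notation Hol := (hol nbhs_dev devM).

(** The segment lies in one copy of the polygon. *)
Lemma hol_base x (a : lift x) : Hol (base a) = ((H (lpt a))^-1 * H (lift_pt q_surj x))%g.
Proof.
pose W (t : R) := mix z0 (lpt a) (uval (clamp t)).
have cW : continuous W.
  apply: continuous_mix; [exact: cst_continuous|exact: cst_continuous|].
  move=> t; apply: (@continuous_comp _ _ _ (@clamp R) (@uval R)).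
    exact: clamp_continuous.
  exact: uval_continuous.
have DW t : D (W t).
  by apply: disc_mix; [exact: lift_ptD|exact: lptD|exact: uval_itv].
have fW := @flat_lift R X g q g_gt0 X_hausdorff q_cont q_surj q_fibre G A B relAB W cW DW.
have fl : flat_along dev (base a) (fun t => (H (W t))^-1 * H (lift_pt q_surj (q (W t))))%g.
  move=> t tI; apply: filterS (fW t Logic.I) => t' E _; exact: E.
rewrite (holE _ _ fl) /W clamp0 clamp1 uval0 uval1 mix0 mix1 lptE.
by rewrite (lift_ptK q_surj x0) -/z0 mulVg invg1 mul1g.
Qed.

Lemma hol_fibre_loop x (a b : lift x) :
  pi1_hol nbhs_dev devM (fibre_loop a b) =
  ((H (lpt a))^-1 * H (lpt b))%g.
Proof.
rewrite (pi1_holE nbhs_dev dev1 devM).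
rewrite (hol_cat nbhs_dev devM (base a) (path_rev (base b))).
rewrite (hol_rev nbhs_dev dev1 devM (base b)) !hol_base invgM invgK.
by rewrite mulgA mulgK.
Qed.

Lemma surface_hom : exists f : pi1 R x0 -> G, {morph f : c d / (c * d)%g} /\
  forall k, (k < g)%N -> f (gen_a k) = A k /\ f (gen_b k) = B k.
Proof.
exists (pi1_hol nbhs_dev devM (x := x0)); split; first exact: (pi1_holM nbhs_dev dev1 devM).
have I0 : (0 : R) <= (0 : R) <= 1 by lra.
have gen k b : (k < g)%N -> exists x (a a' : lift x), [/\ lpt a = side_src g k b 0,
    lpt a' = side_tgt g k b 0 & side_gen b k = fibre_loop a a'].
  move=> kg; exists (q (side_src g k b 0)), (vertex_lift_src k b),
    (Lift (side_tgt_disc g k b 0) (esym (q_side q_fibre b kg I0))).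
  by split => //; symmetry; apply: (side_genE (u := 0)).
move=> k kg; rewrite /gen_a /gen_b; split.
  have [x [a [a' [aE a'E ->]]]] := gen k false kg.
  by rewrite hol_fibre_loop aE a'E (potential_side g_gt0 relAB).
have [x [a [a' [aE a'E ->]]]] := gen k true kg.
by rewrite hol_fibre_loop aE a'E (potential_side g_gt0 relAB).
Qed.

End LoopHolonomy.

End SurfaceLoops.

(** * Charts *)

Section Charts.
Context (R : realType) (X : topologicalType).
Local Notation I := (unitI R).
Local Notation C := (cplx R).

Definition cmix (z w : C) (r : R) : C := z + (r%:C)%C * (w - z).

Lemma continuous_real_complex : continuous (fun r : R => (r%:C)%C : C).
Proof.
move=> r; apply/cvgrPdist_lt => e e0.
have [d d0 dE] : exists2 d : R, 0 < d & (d%:C)%C <= e.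
  exists (complex.Re e); first by move: e0; rewrite ltcE => /andP[].
  by move: e0; case: e => a b; rewrite ltcE lecE /= => /andP[/eqP -> _]; rewrite eqxx lexx.
have : \forall t \near r, `|r - t| < d by exact: (@nbhsx_ballx R R r d d0).
apply: filterS => t rt; rewrite -rmorphB normc_def /= expr0n /= addr0 sqrtr_sqr.
by apply: lt_le_trans dE; rewrite ltcR.
Qed.

(** The chart maps a neighbourhood of x to a ball, which is convex. *)
Lemma chart_simple (c : complex_chart R X) x : chart_dom c x ->
  exists2 U : set X, nbhs x U &
  forall y y' (p1 p2 : {path I from y to y' in X}),
    (forall t, U (p1 t)) -> (forall t, U (p2 t)) -> path_homotopic p1 p2.
Proof.
move=> cx; pose phi := chart_map c; pose psi := chart_inv c.
have : nbhs (phi x) (phi @` chart_dom c).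
  apply: open_nbhs_nbhs; split; first exact: chart_img_open.
  by exists x.
move=> [/= e e0 eP].
pose Bl := [set z : C | `|phi x - z| < e].
exists [set y | chart_dom c y /\ Bl (phi y)].
  have := @chart_map_continuous _ _ c => /subspace_continuousP/(_ x cx) cphi.
  have nB : nbhs (phi x) Bl by apply/nbhs_ballP; exists e.
  have nd : nbhs x (chart_dom c).
    by apply: open_nbhs_nbhs; split => //; exact: chart_dom_open.
  have := cphi _ nB; rewrite /nbhs /= => nBl.
  by apply: filterS2 nd nBl => y dy /(_ dy).
move=> y y' p1 p2 U1 U2.
have cphi (p : {path I from y to y' in X}) :
    (forall t, chart_dom c (p t)) -> continuous (phi \o p).
  move=> pc; apply: (@continuous_within_comp _ _ _ (chart_dom c)) => //.
    exact: chart_map_continuous.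
  exact: cts_fun.
apply: (@convex_homotopic R X C Bl psi cmix y y' p1 p2 (phi \o p1) (phi \o p2)).
- apply: (continuous_subspaceW _ (@chart_inv_continuous _ _ c)); exact: eP.
- move=> z; rewrite /cmix.
  have c1 : continuous (fun z : (C * C) * R => z.1.1).
    by move=> v; apply: (@continuous_comp _ _ _ fst fst); exact: cvg_fst.
  have c2 : continuous (fun z : (C * C) * R => z.1.2).
    by move=> v; apply: (@continuous_comp _ _ _ fst snd); [exact: cvg_fst|exact: cvg_snd].
  have c3 : continuous (fun z : (C * C) * R => (z.2%:C)%C : C).
    by move=> v; apply: (@continuous_comp _ _ _ snd (fun r : R => (r%:C)%C : C));
      [exact: cvg_snd|exact: continuous_real_complex].
  apply: (@cvgD C C^o); first exact: c1.
  apply: (@cvgM C); first exact: c3.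
  by apply: (@cvgB C C^o); [exact: c2|exact: c1].
- by move=> u v; rewrite /cmix mul0r addr0.
- by move=> u v; rewrite /cmix mul1r addrC subrK.
- by move=> u s; rewrite /cmix subrr mulr0 addr0.
- move=> u v s; rewrite /Bl /= => Bu Bv sI; rewrite /cmix.
  have -> : phi x - (u + (s%:C)%C * (v - u)) =
      ((1 - s)%:C)%C * (phi x - u) + (s%:C)%C * (phi x - v).
    by rewrite rmorphB rmorph1; ring.
  apply: le_lt_trans (ler_normD _ _) _; rewrite !normrM.
  have s0 : 0 <= (s%:C)%C :> C by rewrite ler0c; lra.
  have s1 : 0 <= ((1 - s)%:C)%C :> C by rewrite ler0c; lra.
  rewrite (ger0_norm s1) (ger0_norm s0) -subr_gt0.
  set al := ((1 - s)%:C)%C in s1 *; set be := (s%:C)%C in s0 *.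
  have ab : al + be = 1 by rewrite /al /be -rmorphD subrK.
  rewrite (_ : e - _ = al * (e - `|phi x - u|) + be * (e - `|phi x - v|)); last first.
    by rewrite !mulrBr addrACA -mulrDl ab mul1r opprD.
  have pu : 0 < e - `|phi x - u| by rewrite subr_gt0.
  have pv : 0 < e - `|phi x - v| by rewrite subr_gt0.
  have [al0|al0] := eqVneq al 0.
    have be1 : be = 1 by rewrite -ab al0 add0r.
    by rewrite al0 be1 mul0r add0r mul1r.
  apply: ltr_pwDl; first by rewrite mulr_gt0 // lt_neqAle eq_sym al0.
  by rewrite mulr_ge0 // ltW.
- by apply: cphi => t; case: (U1 t).
- by apply: cphi => t; case: (U2 t).
- by move=> t; case: (U1 t).
- by move=> t; case: (U2 t).
- by rewrite /= !path_zero.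
- by rewrite /= !path_one.
- by move=> t; rewrite /= /psi /phi chart_mapK // inE; case: (U1 t).
- by move=> t; rewrite /= /psi /phi chart_mapK // inE; case: (U2 t).
Qed.

End Charts.

End SurfaceTopology.
Export SurfaceTopology.

(** * The embedding *)

Import GRing.Theory.
Local Open Scope classical_set_scope.
Local Open Scope card_scope.
Local Open Scope ring_scope.

Lemma GL_of_det2 (K : fieldType) (M : 'M[K]_2) : det2 M != 0 -> exists x : GL 2 K, val x = M.
Proof.
move=> M0; suff Mu : M \in unitmx by exists (Sub M Mu).
apply: (proj1 (@mulmx1_unit _ _ M ((det2 M)^-1 *: adj2 M) _)).
by rewrite -scalemxAr mulmx_adj2 scale_scalar_mx mulVf.
Qed.

Lemma two_in_I2 (T : Type) (B : set T) : `I_2 #<= B ->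
  exists b : 'I_2 -> T, injective b /\ forall i, B (b i).
Proof.
move=> /card_leP[f].
have in2 (i : 'I_2) : (i : nat) \in (`I_2 : set nat) by rewrite inE /=.
exists (fun i => set_val (f (SigSub (in2 i)))); split; last by move=> i; exact: set_valP.
move=> i j /val_inj e; apply: val_inj.
have := @inj _ _ _ f _ _ (mem_set Logic.I) (mem_set Logic.I) e.
by move/(congr1 set_val).
Qed.

Theorem theorem5 (p g : nat) (p_prime : prime p) (p_ge5 : (5 <= p)%N)
    (g_ge2 : (2 <= g)%N)
    (R : realType) (X : topologicalType)
    (X_surface : closed_riemann_surface R X) (X_genus : has_genus R g X) (x0 : X)
    (K : fieldType) (K_char : p \in [pchar K])
    (B : set K) (B_basis : transcendence_basis p B) (B_ge2 : `I_2 #<= B) :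
  exists n : nat, (0 < n)%N /\
    contains_subgroup_isomorphic_to (GL n K) (pi1 R x0).
Proof.
exists 2%N; split => //.
have [b [b_inj bB]] := two_in_I2 _ _ B_ge2.
have [phi phi_inj] := polynomial_embedding p_prime K_char (proj1 B_basis) b_inj bB.
have phi_neq0 (P : {poly {poly 'F_p}}) : P != 0 -> phi P != 0.
  by move=> P0; rewrite -(rmorph0 phi) (inj_eq phi_inj).
have two_neq0 : 2 != 0 :> 'F_p.
  apply/eqP => e; have := val_Fp_nat p_prime 2; rewrite e modn_small //=.
  by apply: leq_trans p_ge5.
have det2_map (M : 'M[{poly 'F_p}]_2) : det2 M != 0 -> det2 (map_mx phi (liftT M)) != 0.
  move=> M0; rewrite /det2 !mxE -!rmorphM -!rmorphB; apply: phi_neq0.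
  by rewrite polyC_eq0.
have [a a_val] := GL_of_det2 _ _ (det2_map _ (det2_lettermx 'F_p (false, false))).
have [c c_val] := GL_of_det2 _ _ (det2_map _ (det2_lettermx 'F_p (true, false))).
have [|d d_val] := GL_of_det2 _ (mx2 (phi 'X) 0 0 1).
  rewrite /det2 !mxE /= mulr1 mulr0 subr0; apply: phi_neq0; exact: polyX_neq0.
have val1 : val (1%g : GL 2 K) = 1%:M by [].
have valM (x y : GL 2 K) : val (x * y)%g = val x *m val y by [].
have [m gE] : exists m, g = m.+2 by exists g.-2; lia.
subst g.
have [X_hausdorff _ _ [atlas [cover _]]] := X_surface.
have [q [q_cont q_surj q_fibre]] := X_genus.
have X_local (x : X) : exists2 U : set X, nbhs x U &
    forall y y' (p1 p2 : {path unitI R from y to y' in X}),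
    (forall t, U (p1 t)) -> (forall t, U (p2 t)) -> path_homotopic p1 p2.
  by have [e _ ex] := cover x; exact: chart_simple ex.
pose mu (x : GL 2 K) : 'M[K]_2 := val x.
have mu_inj : injective mu by exact: val_inj.
have dc := @d_comm _ _ phi _ mu val1 valM _ _ _ a_val c_val d_val mu_inj.
have [f [fM fgen]] := surface_hom (ltn0Sn _) X_hausdorff q_cont q_surj q_fibre x0
  (cover_relator dc m).
have f_ker := @rho_faithful _ _ phi two_neq0 phi_inj _ mu val1 valM _ _ _ a_val c_val
  d_val mu_inj _ _ _ _ (surface_relation (ltn0Sn _) q_cont q_surj q_fibre x0)
  (@surface_generation _ _ _ _ X_hausdorff q_cont q_surj q_fibre X_local x0) _ fM
  (fun k kg => proj1 (fgen k kg)) (fun k kg => proj2 (fgen k kg)).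
have f1 : f 1%g = 1%g by apply: (mulIg (f 1%g)); rewrite -fM !mul1g.
have fV x : f x^-1%g = (f x)^-1%g by apply/esym/mulg1_eq; rewrite -fM mulgV.
exists (fun y => `[< exists x, f x = y >]), f; split => //.
- split; first by rewrite unfold_in; apply/asboolP; exists 1%g.
  move=> _ _ /asboolP[x <-] /asboolP[y <-]; rewrite unfold_in; apply/asboolP.
  by exists (x / y)%g; rewrite fM fV.
- move=> x y e; apply: divg1_eq; apply: f_ker.
  by rewrite fM fV e mulgV.
- by move=> y; rewrite unfold_in; split=> [/asboolP|?]; last exact/asboolP.
Qed.
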